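(* Let $(R,\Lambda)$ be a Noetherian algebra such that $R$ is ring indecomposable and the following conditions are satisfied. (i) The localization map $(-)_{\mathfrak p}:\mathsf{2}\text{-}\mathsf{silt}\,\Lambda\to\mathsf{2}\text{-}\mathsf{silt}\,\Lambda_{\mathfrak p}$ is an isomorphism of posets for any $\mathfrak p\in\operatorname{Spec}R$. (ii) $\mathsf{s}\text{-}\mathsf{tors}(\mathsf{fl}\,\Lambda_{\mathfrak p})=\mathsf{tors}(\mathsf{fl}\,\Lambda_{\mathfrak p})$ holds for any $\mathfrak p\in\operatorname{Spec}R$. Then $(R,\Lambda)$ is compatible and there is an isomorphism of posets $$\mathsf{tors}\,\Lambda\simeq\operatorname{Hom}_{\rm poset}(\operatorname{Spec}R,\mathsf{2}\text{-}\mathsf{silt}\,\Lambda).$$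
   Context: A Noetherian algebra $(R,\Lambda)$ is a commutative Noetherian ring $R$ with a (not necessarily commutative) $R$-algebra $\Lambda$ that is finitely generated as an $R$-module. $\Lambda_{\mathfrak p}:=R_{\mathfrak p}\otimes_R\Lambda$. $\mathsf{mod}$, $\mathsf{fl}$, $\mathsf{proj}$ denote finitely generated, finite length, finitely generated projective left modules. Torsion classes: a torsion class of an abelian category is a full subcategory (containing $0$, closed under isomorphisms) closed under extensions and factor objects; $\mathsf{tors}\,\mathcal A$ is the set of these ordered by inclusion, $\mathsf{tors}\,\Lambda:=\mathsf{tors}(\mathsf{mod}\,\Lambda)$. Silting: for a ring $\Gamma$, a complex $P\in\mathsf K^{\rm b}(\mathsf{proj}\,\Gamma)$ is silting if $\operatorname{Hom}(P,P[i])=0$ for all $i>0$ and the smallest triangulated subcategory of $\mathsf K^{\rm b}(\mathsf{proj}\,\Gamma)$ closed under direct summands and containing $P$ is everything; it is two-term if it is isomorphic in $\mathsf K^{\rm b}(\mathsf{proj}\,\Gamma)$ to a complex concentrated in degrees $-1,0$. $\mathsf{2}\text{-}\mathsf{silt}\,\Gamma$ is the set of two-term silting complexes up to additive equivalence ($\mathsf{add}\,P=\mathsf{add}\,Q$), with partial order $Q\le P$ iff $\operatorname{Hom}(P,Q[i])=0$ for all $i>0$. A silting $\Gamma$-module is a module of the form $H^0(P)$ with $P$ two-term silting. For a module $M$, $\mathsf{gen}\,M$ is the category of factor modules of finite direct sums of copies of $M$. $\mathsf{s}\text{-}\mathsf{tors}(\mathsf{fl}\,\Gamma):=\{\mathsf{gen}\,M\cap\mathsf{fl}\,\Gamma\mid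 M\text{ a silting }\Gamma\text{-module}\}$. Compatibility: for a subcategory $\mathcal C$ of modules, $\mathcal C_{\mathfrak p}:=\{X_{\mathfrak p}\mid X\in\mathcal C\}$. For $\mathcal X\in\mathsf{tors}(\mathsf{fl}\,\Lambda_{\mathfrak p})$ let $\psi_{\mathfrak p}(\mathcal X):=\{X\in\mathsf{mod}\,\Lambda_{\mathfrak p}\mid X/\mathfrak pX\in\mathcal X\}$ and, for primes $\mathfrak p\supseteq\mathfrak q$, ${\rm r}_{\mathfrak p,\mathfrak q}(\mathcal X):=\psi_{\mathfrak p}(\mathcal X)_{\mathfrak q}\cap\mathsf{fl}\,\Lambda_{\mathfrak q}$. $\mathbb T^{\rm c}_R(\Lambda)$ is the set of $(\mathcal X^{\mathfrak p})_{\mathfrak p}\in\prod_{\mathfrak p\in\operatorname{Spec}R}\mathsf{tors}(\mathsf{fl}\,\Lambda_{\mathfrak p})$ with ${\rm r}_{\mathfrak p,\mathfrak q}(\mathcal X^{\mathfrak p})\supseteq\mathcal X^{\mathfrak q}$ for all primes $\mathfrak p\supseteq\mathfrak q$. $(R,\Lambda)$ is compatible if the image of $\Phi_{\rm t}:\mathsf{tors}\,\Lambda\to\prod_{\mathfrak p}\mathsf{tors}(\mathsf{fl}\,\Lambda_{\mathfrak p})$, $\mathcal T\mapsto(\mathcal T_{\mathfrak p}\cap\mathsf{fl}\,\Lambda_{\mathfrak p})_{\mathfrak p}$, equals $\mathbb T^{\rm c}_R(\Lambda)$. $\operatorname{Spec}R$ is ordered by inclusion ($\mathfrak q\le\mathfrak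 p$ iff $\mathfrak q\subseteq\mathfrak p$). $\operatorname{Hom}_{\rm poset}(X,Y)$ is the set of order-preserving maps $X\to Y$, ordered by $f\le g$ iff $f(x)\le g(x)$ for all $x\in X$. *)

(* Defs.v *)
From HB Require Import structures.
From mathcomp Require Import all_boot all_order all_algebra.
From mathcomp Require Import ring boolp.

Set Implicit Arguments.
Unset Strict Implicit.
Unset Printing Implicit Defensive.

Import GRing.Theory.
Local Open Scope ring_scope.
Local Open Scope quotient_scope.

(* Modules: [lmodType A] is the type of left A-modules. Rings are [pzRingType]s,
   so the zero ring is allowed, as localizations of algebras may vanish. *)

Section Modules.
Variable A : pzRingType.
Implicit Types M N : lmodType A.

Definition zero_mod M : Prop := forall x : M, x = 0.

Definition mod_iso M N : Prop := exists f : {linear M -> N}, bijective f.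

Definition surj (S T : Type) (f : S -> T) : Prop := forall y, exists x, f x = y.

Definition fin_gen M : Prop :=
  exists n (g : 'I_n -> M), forall x, exists c : 'I_n -> A,
    x = \sum_(k < n) c k *: g k.

Definition projective M : Prop :=
  forall (N N' : lmodType A) (g : {linear N -> N'}) (f : {linear M -> N'}),
    surj g -> exists h : {linear M -> N}, forall x, g (h x) = f x.

Definition fg_projective M : Prop := fin_gen M /\ projective M.

(* Existence of a composition series; simplicity of the factors is expressed
   by the absence of intermediate submodules. *)
Definition finite_length M : Prop :=
  exists n (F : nat -> {pred M}),
    [/\ forall i, submod_closed (F i),
        forall x, (x \in F 0) = (x == 0),
        forall x, x \in F n
      & forall i, (i < n)%N ->
          [/\ {subset F i <= F i.+1}, ~ {subset F i.+1 <= F i}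
            & forall U : {pred M}, submod_closed U ->
                {subset F i <= U} -> {subset U <= F i.+1} ->
                {subset U <= F i} \/ {subset F i.+1 <= U}]].

Definition short_exact (X Y Z : lmodType A)
    (f : {linear X -> Y}) (g : {linear Y -> Z}) : Prop :=
  [/\ injective f, surj g & forall y, g y = 0 <-> exists x, f x = y].

Definition gen_by M N : Prop :=
  exists n (f : {linear {ffun 'I_n -> M} -> N}), surj f.

(* Torsion classes of the full subcategory C of modules. It is used for C the
   finitely generated or the finite length modules over a Noetherian ring, where
   epimorphisms and short exact sequences are those of modules. *)
Definition is_torsion_class (C T : lmodType A -> Prop) : Prop :=
  [/\ forall X, T X -> C X,
      forall X, zero_mod X -> T X,
      forall X Y, mod_iso X Y -> T X -> T Y,
      forall (X Y Z : lmodType A) (f : {linear X -> Y}) (g : {linear Y -> Z}),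
        C Y -> short_exact f g -> T X -> T Z -> T Y
    & forall (X Y : lmodType A) (f : {linear X -> Y}),
        C Y -> surj f -> T X -> T Y].

Record tors (C : lmodType A -> Prop) := Tors {
  tors_class :> lmodType A -> Prop;
  torsP : is_torsion_class C tors_class }.

Definition tors_le (C : lmodType A -> Prop) (S T : tors C) : Prop :=
  forall X, S X -> T X.

End Modules.

Definition restrict (A B : pzRingType) (f : {rmorphism A -> B})
  (M : lmodType B) : Type := M.

Section Restrict.
Variables (A B : pzRingType) (f : {rmorphism A -> B}) (M : lmodType B).

HB.instance Definition _ := GRing.Zmodule.on (restrict f M).

Definition restrict_scale (a : A) (x : restrict f M) : restrict f M :=
  f a *: (x : M).

Fact restrict_scaleA a b x :
  restrict_scale a (restrict_scale b x) = restrict_scale (a * b) x.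
Proof. by rewrite /restrict_scale scalerA rmorphM. Qed.

Fact restrict_scale1 : left_id 1 restrict_scale.
Proof. by move=> x; rewrite /restrict_scale rmorph1 scale1r. Qed.

Fact restrict_scaleDr : right_distributive restrict_scale +%R.
Proof. by move=> a x y; rewrite /restrict_scale scalerDr. Qed.

Fact restrict_scaleDl x :
  {morph (fun a : A => restrict_scale a x) : a b / a + b >-> a + b}.
Proof. by move=> a b; rewrite /restrict_scale rmorphD scalerDl. Qed.

HB.instance Definition _ := GRing.Zmodule_isLmodule.Build A (restrict f M)
  restrict_scaleA restrict_scale1 restrict_scaleDr restrict_scaleDl.

End Restrict.

Section SubQuotient.
Variables (A : pzRingType) (V : lmodType A) (S : submodClosed V).

Definition sub_mod : Type := {x : V | x \in S}.
HB.instance Definition _ := SubChoice.on sub_mod.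
HB.instance Definition _ := [SubChoice_isSubLmodule of sub_mod by <:].

Definition submod_pred : {pred V} := S.

Fact submod_pred_closed : zmod_closed submod_pred.
Proof.
split=> [|x y Sx Sy]; first exact: (rpred0 S).
by rewrite -scaleN1r; apply: (rpredD (S := S)) => //; apply: (rpredZ (s := S)).
Qed.

HB.instance Definition _ :=
  GRing.isZmodClosed.Build V submod_pred submod_pred_closed.

Definition quot_mod : Type := Quotient.quot submod_pred.
HB.instance Definition _ := GRing.Zmodule.on quot_mod.

Definition quot_proj (x : V) : quot_mod :=
  \pi_(Quotient.quot submod_pred) x.

Fact quot_projP (y : quot_mod) : exists x, quot_proj x = y.
Proof. by exists (repr (y : Quotient.quot submod_pred)); exact: reprK. Qed.

Fact quot_proj_eq x y : quot_proj x = quot_proj y <-> x - y \in S.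
Proof.
have -> : (x - y \in S) = (quot_proj x == quot_proj y).
  exact: Quotient.idealrBE submod_pred x y.
by split=> /eqP.
Qed.

Fact quot_projD : {morph quot_proj : x y / x + y}.
Proof. exact: Quotient.pi_add. Qed.

Definition quot_scale (a : A) (y : quot_mod) : quot_mod :=
  quot_proj (a *: repr (y : Quotient.quot submod_pred)).

Fact quot_scaleE a x : quot_scale a (quot_proj x) = quot_proj (a *: x).
Proof.
apply/quot_proj_eq; rewrite -scalerBr; apply: (rpredZ (s := S)).
exact: (quot_proj_eq _ _).1 (reprK _).
Qed.

Fact quot_scaleA a b y : quot_scale a (quot_scale b y) = quot_scale (a * b) y.
Proof. by have [x <-] := quot_projP y; rewrite !quot_scaleE scalerA. Qed.

Fact quot_scale1 : left_id 1 quot_scale.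
Proof. by move=> y; have [x <-] := quot_projP y; rewrite quot_scaleE scale1r. Qed.

Fact quot_scaleDr : right_distributive quot_scale +%R.
Proof.
move=> a y y'; have [x <-] := quot_projP y; have [x' <-] := quot_projP y'.
by rewrite -quot_projD !quot_scaleE scalerDr quot_projD.
Qed.

Fact quot_scaleDl y :
  {morph (fun a : A => quot_scale a y) : a b / a + b >-> a + b}.
Proof.
move=> a b; have [x <-] := quot_projP y.
by rewrite !quot_scaleE scalerDl quot_projD.
Qed.

HB.instance Definition _ := GRing.Zmodule_isLmodule.Build A quot_mod
  quot_scaleA quot_scale1 quot_scaleDr quot_scaleDl.

End SubQuotient.

Definition noetherian (R : comNzRingType) : Prop :=
  forall I : {pred R^o}, submod_closed I ->
    exists n (g : 'I_n -> R), (forall k, g k \in I) /\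
      forall x, x \in I -> exists c : 'I_n -> R, x = \sum_(k < n) c k * g k.

Definition ring_indecomposable (R : comNzRingType) : Prop :=
  forall (S T : comPzRingType) (f : {rmorphism R -> S * T}), bijective f ->
    (forall x : S, x = 0) \/ (forall x : T, x = 0).

(* R-algebras; [algType R] is not used since it excludes the zero ring. *)
Record algebra (R : comNzRingType) := Algebra {
  alg_ring :> pzRingType;
  alg_map : {rmorphism R -> alg_ring};
  alg_central : forall r x, alg_map r * x = x * alg_map r }.

Definition noetherian_algebra (R : comNzRingType) (L : algebra R) : Prop :=
  noetherian R /\ fin_gen (restrict (alg_map L) L^o).

Section Denominators.
Variables (R : comNzRingType) (p : prime_idealr R).

Definition den : Type := {s : R | s \notin p}.
HB.instance Definition _ := SubChoice.on den.
Definition dval (s : den) : R := val s.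

Fact dval_inj : injective dval.
Proof. exact: val_inj. Qed.

Fact den1_subproof : 1 \notin p.
Proof. by rewrite idealr1. Qed.
Definition den1 : den := exist _ 1 den1_subproof.

Fact denM_subproof (s t : den) : dval s * dval t \notin p.
Proof. by rewrite prime_idealrM negb_or (valP s) (valP t). Qed.
Definition denM (s t : den) : den :=
  exist _ (dval s * dval t) (denM_subproof s t).

Fact dvalE : (dval den1 = 1) * (forall s t, dval (denM s t) = dval s * dval t).
Proof. by []. Qed.

Fact denMC : commutative denM.
Proof. by move=> s t; apply: dval_inj; rewrite !dvalE mulrC. Qed.

Fact denMA : associative denM.
Proof. by move=> s t u; apply: dval_inj; rewrite !dvalE mulrA. Qed.

Fact den1M : left_id den1 denM.
Proof. by move=> s; apply: dval_inj; rewrite !dvalE mul1r. Qed.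

End Denominators.

Section BaseAction.
Variables (R : comNzRingType) (L : algebra R) (M : lmodType L).

Definition ract (r : R) (x : M) : M := alg_map L r *: x.

Fact ractA r s x : ract r (ract s x) = ract (r * s) x.
Proof. by rewrite /ract scalerA rmorphM. Qed.

Fact ract1 x : ract 1 x = x.
Proof. by rewrite /ract rmorph1 scale1r. Qed.

Fact ractD r x y : ract r (x + y) = ract r x + ract r y.
Proof. exact: scalerDr. Qed.

Fact ractN r x : ract r (- x) = - ract r x.
Proof. exact: scalerN. Qed.

Fact ract0 r : ract r 0 = 0.
Proof. exact: scaler0. Qed.

Fact ractZ r a x : a *: ract r x = ract r (a *: x).
Proof. by rewrite /ract !scalerA alg_central. Qed.

End BaseAction.

Section Fractions.
Variables (R : comNzRingType) (p : prime_idealr R).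
Variables (L : algebra R) (M : lmodType L).
Notation den := (den p).

Definition frac_rel (x y : M * den) : bool :=
  `[< exists u : den,
        ract (dval u) (ract (dval y.2) x.1) =
        ract (dval u) (ract (dval x.2) y.1) >].

Fact frac_rel_equiv : equiv_class_of frac_rel.
Proof.
split=> [x|x y|y x z]; first by apply/asboolP; exists (den1 p).
  by apply/idP/idP=> /asboolP[u E]; apply/asboolP; exists u.
move=> /asboolP[u E] /asboolP[v F]; apply/asboolP.
exists (denM (denM u v) y.2); rewrite !dvalE !ractA in E F *.
have -> : dval u * dval v * dval y.2 * dval z.2 =
          (dval v * dval z.2) * (dval u * dval y.2) by ring.
rewrite -ractA E ractA.
have -> : dval v * dval z.2 * (dval u * dval x.2) =
          (dval u * dval x.2) * (dval v * dval z.2) by ring.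
rewrite -ractA F ractA.
by congr (ract _ _); ring.
Qed.

Canonical frac_equiv := EquivRelPack frac_rel_equiv.

Definition frac_mod : Type := {eq_quot frac_rel}.
HB.instance Definition _ := Choice.on frac_mod.

Definition frac (x : M) (s : den) : frac_mod := \pi_{eq_quot frac_rel} (x, s).

Fact fracP (z : frac_mod) : exists x s, frac x s = z.
Proof.
have := reprK (z : {eq_quot frac_rel}); case: (repr _) => x s E.
by exists x, s.
Qed.

Fact frac_eq x s y t : frac x s = frac y t <->
  exists u : den, ract (dval u) (ract (dval t) x) =
                  ract (dval u) (ract (dval s) y).
Proof.
split=> [/eqP|H]; first by rewrite /frac piE => /asboolP.
by apply/eqP; rewrite /frac piE; apply/asboolP.
Qed.

Definition frac_repr (z : frac_mod) : M * den := repr (z : {eq_quot frac_rel}).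

Fact frac_reprK z : frac (frac_repr z).1 (frac_repr z).2 = z.
Proof. by rewrite /frac -surjective_pairing; exact: reprK. Qed.

Definition frac_add (z w : frac_mod) : frac_mod :=
  let: (x, s) := frac_repr z in let: (y, t) := frac_repr w in
  frac (ract (dval t) x + ract (dval s) y) (denM s t).

Definition frac_opp (z : frac_mod) : frac_mod :=
  frac (- (frac_repr z).1) (frac_repr z).2.

Fact frac_addE x s y t : frac_add (frac x s) (frac y t) =
  frac (ract (dval t) x + ract (dval s) y) (denM s t).
Proof.
rewrite /frac_add.
have := frac_reprK (frac x s); case: (frac_repr _) => x' s' /=.
move/frac_eq=> [u E]; have := frac_reprK (frac y t).
case: (frac_repr _) => y' t' /= /frac_eq[v F]; apply/frac_eq.
exists (denM u v); rewrite ?dvalE !ractD !ractA in E F *; congr (_ + _).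
  have -> : dval u * dval v * (dval s * dval t) * dval t' =
            dval v * dval t * dval t' * (dval u * dval s) by ring.
  by rewrite -ractA E ractA; congr (ract _ _); ring.
have -> : dval u * dval v * (dval s * dval t) * dval s' =
          dval u * dval s * dval s' * (dval v * dval t) by ring.
by rewrite -ractA F ractA; congr (ract _ _); ring.
Qed.

Fact frac_oppE x s : frac_opp (frac x s) = frac (- x) s.
Proof.
have /frac_eq[u E] := frac_reprK (frac x s); apply/frac_eq.
by exists u; rewrite !ractN E.
Qed.

Fact frac_addA : associative frac_add.
Proof.
move=> z z' z''; have [x [s <-]] := fracP z; have [y [t <-]] := fracP z'.
have [w [r <-]] := fracP z''; rewrite !frac_addE denMA; congr (frac _ _).
rewrite !dvalE !ractD !ractA addrA.
by congr (ract _ _ + ract _ _ + ract _ _); ring.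
Qed.

Fact frac_addC : commutative frac_add.
Proof.
move=> z z'; have [x [s <-]] := fracP z; have [y [t <-]] := fracP z'.
by rewrite !frac_addE denMC addrC.
Qed.

Fact frac_add0 : left_id (frac 0 (den1 p)) frac_add.
Proof.
move=> z; have [x [s <-]] := fracP z.
by rewrite frac_addE ract0 add0r dvalE ract1 den1M.
Qed.

Fact frac_addN : left_inverse (frac 0 (den1 p)) frac_opp frac_add.
Proof.
move=> z; have [x [s <-]] := fracP z.
rewrite frac_oppE frac_addE ractN addNr; apply/frac_eq.
by exists (den1 p); rewrite !ract0.
Qed.

HB.instance Definition _ :=
  GRing.isZmodule.Build frac_mod frac_addA frac_addC frac_add0 frac_addN.

Fact fracD x y s : frac x s + frac y s = frac (x + y) s.
Proof.
rewrite [LHS]frac_addE; apply/frac_eq; exists (den1 p).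
by rewrite dvalE !ract1 -ractD ractA.
Qed.

Fact frac0 s : frac 0 s = 0.
Proof. by apply/frac_eq; exists (den1 p); rewrite !ract0. Qed.

Fact frac_simpl (u : den) x s : frac (ract (dval u) x) (denM u s) = frac x s.
Proof.
apply/frac_eq; exists (den1 p); rewrite !dvalE !ract1 !ractA.
by congr (ract _ _); ring.
Qed.

Fact frac_common z w : exists x y s, z = frac x s /\ w = frac y s.
Proof.
have [x [s <-]] := fracP z; have [y [t <-]] := fracP w.
exists (ract (dval t) x), (ract (dval s) y), (denM s t).
by rewrite frac_simpl denMC frac_simpl.
Qed.

End Fractions.

Section Localization.
Variables (R : comNzRingType) (L : algebra R) (p : prime_idealr R).

Definition loc_ring : Type := frac_mod p L^o.
HB.instance Definition _ := GRing.Zmodule.on loc_ring.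

Definition lfrac (a : L) (s : den p) : loc_ring := frac (a : L^o) s.

Fact lfracP (z : loc_ring) : exists a s, lfrac a s = z.
Proof. exact: (fracP (z : frac_mod p L^o)). Qed.

Section Action.
Variable M : lmodType L.

Definition loc_mod : Type := frac_mod p M.
HB.instance Definition _ := GRing.Zmodule.on loc_mod.

Definition loc_scale (z : loc_ring) (w : loc_mod) : loc_mod :=
  let: (a, s) := frac_repr z in let: (x, t) := frac_repr w in
  frac ((a : L) *: x) (denM s t).

Fact loc_scaleE a s (x : M) t :
  loc_scale (lfrac a s) (frac x t) = frac (a *: x) (denM s t).
Proof.
rewrite /loc_scale.
have := frac_reprK (lfrac a s : frac_mod p L^o).
case: (frac_repr _) => a' s' /= /frac_eq[u E].
have := frac_reprK (frac x t); case: (frac_repr _) => x' t' /= /frac_eq[v F].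
have {}E y : ract (dval u) (ract (dval s) ((a' : L) *: y)) =
             ract (dval u) (ract (dval s') (a *: y)) :> M.
  rewrite /ract !scalerA; rewrite -!mulrA; congr (_ *: _); exact: E.
apply/frac_eq; exists (denM u v); rewrite !dvalE.
transitivity (ract (dval v * dval t)
  (ract (dval u) (ract (dval s) ((a' : L) *: x')))).
  by rewrite !ractA; congr (ract _ _); ring.
rewrite {}E; transitivity (ract (dval u * dval s')
  (a *: ract (dval v) (ract (dval t) x'))).
  by rewrite !ractZ !ractA; congr (ract _ _); ring.
by rewrite F !ractZ !ractA; congr (ract _ _); ring.
Qed.

Fact loc_scaleDr : right_distributive loc_scale +%R.
Proof.
move=> z w w'; have [a [s <-]] := lfracP z.
have [x [y [t [-> ->]]]] := frac_common w w'.
by rewrite fracD !loc_scaleE scalerDr -fracD.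
Qed.

Fact loc_scaleDl w :
  {morph (fun z : loc_ring => loc_scale z w) : z z' / z + z' >-> z + z'}.
Proof.
move=> z z'; have [a [b [s [-> ->]]]] := frac_common z z'.
have [x [t <-]] := fracP w.
have -> : frac a s + frac b s = lfrac (a + b) s by exact: fracD.
by rewrite !loc_scaleE scalerDl -fracD.
Qed.

End Action.

Definition loc_one : loc_ring := lfrac 1 (den1 p).
Definition loc_mul (z w : loc_ring) : loc_ring := loc_scale (M := L^o) z w.

Fact loc_mulE a s b t : loc_mul (lfrac a s) (lfrac b t) =
  lfrac (a * b) (denM s t).
Proof. exact: loc_scaleE. Qed.

Fact loc_scaleA (M : lmodType L) z z' (w : loc_mod M) :
  loc_scale z (loc_scale z' w) = loc_scale (loc_mul z z') w.
Proof.
have [a [s <-]] := lfracP z; have [b [t <-]] := lfracP z'.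
have [x [r <-]] := fracP w.
by rewrite loc_mulE !loc_scaleE scalerA denMA.
Qed.

Fact loc_scale1 (M : lmodType L) : left_id loc_one (@loc_scale M).
Proof.
by move=> w; have [x [s <-]] := fracP w; rewrite loc_scaleE scale1r den1M.
Qed.

Fact loc_mulA : associative loc_mul.
Proof. by move=> x y z; exact: loc_scaleA. Qed.

Fact loc_mul1r : right_id loc_one loc_mul.
Proof.
move=> z; have [a [s <-]] := lfracP z.
by rewrite loc_mulE mulr1 denMC den1M.
Qed.

Fact loc_mulDl : left_distributive loc_mul +%R.
Proof. by move=> z z' w; exact: loc_scaleDl. Qed.

HB.instance Definition _ := GRing.Zmodule_isPzRing.Build loc_ring
  loc_mulA (@loc_scale1 L^o) loc_mul1r loc_mulDl (@loc_scaleDr L^o).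

HB.instance Definition _ (M : lmodType L) :=
  GRing.Zmodule_isLmodule.Build loc_ring (loc_mod M)
    (@loc_scaleA M) (@loc_scale1 M) (@loc_scaleDr M) (@loc_scaleDl M).

Definition loc_can (a : L) : loc_ring := lfrac a (den1 p).

Fact loc_can_is_zmod_morphism : zmod_morphism loc_can.
Proof.
move=> a b; rewrite -[LHS](addrK (loc_can b)); congr (_ - _).
by have := fracD (a - b : L^o) b (den1 p); rewrite subrK.
Qed.

Fact loc_can_is_monoid_morphism : monoid_morphism loc_can.
Proof.
by split=> // a b; rewrite [RHS]loc_mulE den1M.
Qed.

HB.instance Definition _ :=
  GRing.isZmodMorphism.Build L loc_ring loc_can loc_can_is_zmod_morphism.
HB.instance Definition _ :=
  GRing.isMonoidMorphism.Build L loc_ring loc_can loc_can_is_monoid_morphism.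

Definition loc_alg_map : {rmorphism R -> loc_ring} :=
  (loc_can : {rmorphism L -> loc_ring}) \o alg_map L.

Fact loc_alg_central r z : loc_alg_map r * z = z * loc_alg_map r.
Proof.
have [a [s <-]] := lfracP z.
by rewrite [LHS]loc_mulE [RHS]loc_mulE alg_central denMC.
Qed.

Definition loc_alg : algebra R := Algebra loc_alg_central.

Section Functor.
Variables (M N : lmodType L) (f : {linear M -> N}).

Definition loc_map (z : loc_mod M) : loc_mod N :=
  frac (f (frac_repr z).1) (frac_repr z).2.

Fact loc_mapE x s : loc_map (frac x s) = frac (f x) s.
Proof.
have /frac_eq[u E] := frac_reprK (frac x s).
apply/frac_eq; exists u; have := congr1 f E.
by rewrite /ract !linearZ.
Qed.

Fact loc_map_is_linear : linear loc_map.
Proof.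
move=> z w w'; have [a [s <-]] := lfracP z.
have [x [y [t [-> ->]]]] := frac_common w w'.
have scE (M' : lmodType L) (v : M') : lfrac a s *: (frac v t : loc_mod M')
  = frac (a *: v) (denM s t) by exact: loc_scaleE.
rewrite loc_mapE [in RHS]loc_mapE !scE.
rewrite -(frac_simpl s y t) -(frac_simpl s (f y) t).
by rewrite [X in loc_map X]fracD [RHS]fracD loc_mapE /ract linearP linearZ.
Qed.

HB.instance Definition _ :=
  GRing.isLinear.Build loc_ring (loc_mod M) (loc_mod N) _ loc_map
    loc_map_is_linear.

End Functor.

End Localization.

(* M_p is the tensor product of R_p and M over R, where r/s (x) x = (r x)/s:
   [tens] is the universal R-balanced biadditive map, and by [tensZ] the ring
   structure of L_p and its action on M_p are those of the tensor products. *)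
Section Tensor.
Variables (R : comNzRingType) (L : algebra R) (p : prime_idealr R).
Variable M : lmodType L.

Fact base_alg_central (r x : R) : idfun r * x = x * idfun r.
Proof. exact: mulrC. Qed.
Definition base_alg : algebra R := @Algebra R R idfun base_alg_central.
Notation Rp := (loc_ring base_alg p).
Notation "r '/_' s" := (lfrac (L := base_alg) r s : Rp) (at level 40).

Definition tens (z : Rp) (x : M) : loc_mod p M :=
  frac (ract ((frac_repr z).1 : R) x) (frac_repr z).2.

Fact tensE (r : R) s x : tens (r /_ s) x = frac (ract r x) s.
Proof.
have /frac_eq[u E] := frac_reprK (r /_ s : frac_mod p base_alg^o).
apply/frac_eq; exists u; rewrite !ractA.
move: E; rewrite /ract /= => E; congr (ract _ x).
by rewrite -!mulrA; exact: E.
Qed.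

Fact tensDl x : {morph tens^~ x : z w / z + w}.
Proof.
move=> z w; have [r [r' [s [-> ->]]]] := frac_common z w.
rewrite [X in tens X](fracD (M := base_alg^o)).
by rewrite [LHS]tensE [in RHS]tensE [in RHS]tensE fracD /ract rmorphD scalerDl.
Qed.

Fact tensDr z : {morph tens z : x y / x + y}.
Proof.
by move=> x y; have [r [s <-]] := lfracP z; rewrite !tensE fracD ractD.
Qed.

Fact tens_balanced z r x : tens (z * (r /_ den1 p)) x = tens z (ract r x).
Proof.
have [r' [s <-]] := lfracP z.
by rewrite [X in tens X]loc_mulE !tensE denMC den1M ractA.
Qed.

Fact tens_universal (B : zmodType) (b : Rp -> M -> B) :
  (forall x, {morph b^~ x : z w / z + w}) ->
  (forall z, {morph b z : x y / x + y}) ->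
  (forall z r x, b (z * (r /_ den1 p)) x = b z (ract r x)) ->
  exists! g : loc_mod p M -> B,
    {morph g : v w / v + w} /\ forall z x, g (tens z x) = b z x.
Proof.
move=> bDl bDr bR.
pose g (w : loc_mod p M) := b (1 /_ (frac_repr w).2) (frac_repr w).1.
have b_simpl (u s : den p) x : b (1 /_ denM u s) (ract (dval u) x) = b (1 /_ s) x.
  rewrite -bR; congr (b _ _); rewrite [LHS]loc_mulE; apply/frac_eq.
  exists (den1 p); rewrite !dvalE !ract1 /ract /= mul1r !mulr1.
  by rewrite /GRing.scale /= mulr1 mulrC.
have gE x s : g (frac x s) = b (1 /_ s) x.
  rewrite /g; have := frac_reprK (frac x s); case: (frac_repr _) => y t /=.
  move=> /frac_eq[u E].
  rewrite -(b_simpl (denM u s)) -(b_simpl (denM u t) s).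
  by rewrite !dvalE -!ractA E; congr (b (1 /_ _) _);
    rewrite -!denMA (denMC s).
exists g; split; first split.
- move=> v w; have [x [y [s [-> ->]]]] := frac_common v w.
  by rewrite fracD !gE bDr.
- move=> z x; have [r [s <-]] := lfracP z; rewrite tensE gE -bR.
  by congr (b _ _); rewrite [LHS]loc_mulE mul1r denMC den1M.
- move=> h [_ hb]; apply: funext => w; have [x [s <-]] := fracP w.
  by rewrite gE -hb tensE ract1.
Qed.

End Tensor.

Fact tensZ (R : comNzRingType) (L : algebra R) (p : prime_idealr R)
    (M : lmodType L) (z w : loc_ring (base_alg R) p) (a : L) (x : M) :
  (tens z (a : L^o) : loc_ring L p) *: tens w x = tens (z * w) (a *: x).
Proof.
have [r [s <-]] := lfracP z; have [r' [s' <-]] := lfracP w.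
rewrite [X in tens X (_ *: _)]loc_mulE !tensE.
rewrite [LHS]loc_scaleE; congr (frac _ _).
have -> : (r : R) * (r' : R) = r' * r by exact: mulrC.
by rewrite -[RHS]ractA ractZ; congr (ract _ _); rewrite /ract -scalerA.
Qed.

Definition succz (i : int) : int := i + 1.

Record complex (A : pzRingType) := Complex {
  cobj :> int -> lmodType A;
  cdiff : forall i, {linear cobj i -> cobj (succz i)};
  cdiffK : forall i x, cdiff (succz i) (cdiff i x) = 0 }.

Record chain_map (A : pzRingType) (X Y : complex A) := ChainMap {
  cmap :> forall i, {linear X i -> Y i};
  cmapE : forall i x, cmap (succz i) (cdiff X i x) = cdiff Y i (cmap i x) }.

Section Complexes.
Variable A : pzRingType.
Implicit Types X Y Z : complex A.

(* f - g = d h + h d; the degree is written succz i so that no transport along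
   succz (i - 1) = i is needed. *)
Definition homotopic X Y (f g : forall i, {linear X i -> Y i}) : Prop :=
  exists h : forall i, {linear X (succz i) -> Y i}, forall i x,
    f (succz i) x - g (succz i) x =
    cdiff Y i (h i x) + h (succz i) (cdiff X (succz i) x).

(* Isomorphism in the homotopy category. *)
Definition hiso X Y : Prop :=
  exists (f : chain_map X Y) (g : chain_map Y X),
    homotopic (fun i => g i \o f i : {linear X i -> X i}) (fun i => idfun)
    /\ homotopic (fun i => f i \o g i : {linear Y i -> Y i}) (fun i => idfun).

(* Hom(X, Y) = 0 in the homotopy category. *)
Definition hom_zero X Y : Prop :=
  forall f : chain_map X Y, homotopic f (fun i => \0).

Section Shift.
Variable X : complex A.
Definition shift_diff_fun i (x : X (succz i)) : X (succz (succz i)) :=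
  - cdiff X (succz i) x.
Fact shift_diff_linear i : linear (@shift_diff_fun i).
Proof. by move=> a x y; rewrite /shift_diff_fun linearP opprD scalerN. Qed.
HB.instance Definition _ i := GRing.isLinear.Build A _ _ _
  (@shift_diff_fun i) (@shift_diff_linear i).
Fact shift_diffK i x : shift_diff_fun (@shift_diff_fun i x) = 0.
Proof. by rewrite /shift_diff_fun linearN cdiffK !oppr0. Qed.
Definition shift : complex A := Complex (cobj := fun i => X (succz i))
  (cdiff := @shift_diff_fun) shift_diffK.
End Shift.

Definition shiftn (n : nat) X : complex A := iter n shift X.

Section DirectSum.
Variables X Y : complex A.
Definition dsum_diff_fun i (z : X i * Y i) : X (succz i) * Y (succz i) :=
  (cdiff X i z.1, cdiff Y i z.2).
Fact dsum_diff_linear i : linear (@dsum_diff_fun i).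
Proof. by move=> a z w; rewrite /dsum_diff_fun !linearP. Qed.
HB.instance Definition _ i := GRing.isLinear.Build A _ _ _
  (@dsum_diff_fun i) (@dsum_diff_linear i).
Fact dsum_diffK i z : dsum_diff_fun (@dsum_diff_fun i z) = 0.
Proof. by rewrite /dsum_diff_fun !cdiffK. Qed.
Definition dsum : complex A :=
  Complex (cobj := fun i => (X i * Y i)%type) (cdiff := @dsum_diff_fun) dsum_diffK.
End DirectSum.

Section Copies.
Variables (n : nat) (X : complex A).
Definition copies_diff_fun i (z : {ffun 'I_n -> X i}) : {ffun 'I_n -> X (succz i)} :=
  [ffun k => cdiff X i (z k)].
Fact copies_diff_linear i : linear (@copies_diff_fun i).
Proof. by move=> a z w; apply/ffunP => k; rewrite !ffunE linearP. Qed.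
HB.instance Definition _ i := GRing.isLinear.Build A _ _ _
  (@copies_diff_fun i) (@copies_diff_linear i).
Fact copies_diffK i z : copies_diff_fun (@copies_diff_fun i z) = 0.
Proof. by apply/ffunP => k; rewrite !ffunE cdiffK. Qed.
Definition copies : complex A :=
  Complex (cobj := fun i => {ffun 'I_n -> X i})
    (cdiff := @copies_diff_fun) copies_diffK.
End Copies.

Section Cone.
Variables (X Y : complex A) (f : chain_map X Y).
Definition cone_diff_fun i (z : X (succz i) * Y i) :
    X (succz (succz i)) * Y (succz i) :=
  (- cdiff X (succz i) z.1, f (succz i) z.1 + cdiff Y i z.2).
Fact cone_diff_linear i : linear (@cone_diff_fun i).
Proof.
move=> a z w; rewrite /cone_diff_fun !linearP /=; congr (_, _) => /=.
by rewrite scalerDr addrACA.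
Qed.
HB.instance Definition _ i := GRing.isLinear.Build A _ _ _
  (@cone_diff_fun i) (@cone_diff_linear i).
Fact cone_diffK i z : cone_diff_fun (@cone_diff_fun i z) = 0.
Proof.
rewrite /cone_diff_fun /= !linearN linearD /= !cdiffK !oppr0 addr0.
by rewrite cmapE addNr.
Qed.
Definition cone : complex A :=
  Complex (cobj := fun i => (X (succz i) * Y i)%type)
    (cdiff := @cone_diff_fun) cone_diffK.
End Cone.

(* Objects of K^b(proj A). *)
Definition is_kb X : Prop :=
  (forall i, fg_projective (X i)) /\
  (exists n : nat, forall i, (n < `|i|)%N -> zero_mod (X i)).

(* Triangulated subcategories of K^b(proj A) closed under direct summands:
   distinguished triangles are those isomorphic to X -> Y -> cone f -> X[1]. *)
Definition is_thick (C : complex A -> Prop) : Prop :=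
  [/\ forall X, C X -> is_kb X,
      forall X Y, is_kb Y -> hiso X Y -> C X -> C Y,
      forall X, is_kb X -> (C X <-> C (shift X)),
      forall X Y (f : chain_map X Y), C X -> C Y -> C (cone f)
    & forall X Y, is_kb X -> is_kb Y -> C (dsum X Y) -> C X].

Definition in_thick (P X : complex A) : Prop :=
  forall C : complex A -> Prop, is_thick C -> C P -> C X.

Definition is_silting (P : complex A) : Prop :=
  [/\ is_kb P,
      forall n, (0 < n)%N -> hom_zero P (shiftn n P)
    & forall X, is_kb X -> in_thick P X].

Definition is_two_term (P : complex A) : Prop :=
  exists Q, [/\ is_kb Q, hiso P Q &
    forall i : int, i != -1 -> i != 0 -> zero_mod (Q i)].

Definition two_silting (P : complex A) : Prop := is_silting P /\ is_two_term P.

Definition in_add (P X : complex A) : Prop :=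
  is_kb X /\ exists n Y, is_kb Y /\ hiso (dsum X Y) (copies n P).

Definition add_eq (P Q : complex A) : Prop := forall X, in_add P X <-> in_add Q X.

Definition silt_le (Q P : complex A) : Prop :=
  forall n, (0 < n)%N -> hom_zero P (shiftn n Q).

(* 2-silt A: an element is a class of two-term silting complexes for additive
   equivalence. *)
Record silt2 := Silt2 {
  silt2_class :> complex A -> Prop;
  silt2P : exists2 P, two_silting P &
    forall Q, silt2_class Q <-> two_silting Q /\ add_eq P Q }.

Definition silt2_le (S T : silt2) : Prop :=
  forall Q P, S Q -> T P -> silt_le Q P.

(* H^0(P): note that succz (-1) reduces to 0. *)
Section H0.
Variable P : complex A.

Definition cycles : {pred P (succz (-1))} := fun x => cdiff P (succz (-1)) x == 0.
Fact cycles_closed : subsemimod_closed cycles.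
Proof.
split; [split=> [|x y] | move=> a x]; rewrite !unfold_in /=.
- by rewrite linear0.
- by rewrite linearD => /eqP-> /eqP->; rewrite addr0.
- by rewrite linearZ => /eqP->; rewrite /= scaler0.
Qed.
HB.instance Definition _ := GRing.isSubmodClosed.Build A _ cycles cycles_closed.

Definition boundaries : {pred sub_mod cycles} :=
  fun z => `[< exists y : P (-1), val z = cdiff P (-1) y >].
Fact boundaries_closed : subsemimod_closed boundaries.
Proof.
split; [split=> [|z w] | move=> a z]; rewrite !unfold_in /=.
- by apply/asboolP; exists 0; rewrite linear0.
- move=> /asboolP[x E] /asboolP[y F]; apply/asboolP; exists (x + y).
  by rewrite !raddfD /= E F.
- move=> /asboolP[x E]; apply/asboolP; exists (a *: x).
  by rewrite !linearZ /= E.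
Qed.
HB.instance Definition _ :=
  GRing.isSubmodClosed.Build A _ boundaries boundaries_closed.

Definition H0 : lmodType A := quot_mod boundaries.
End H0.

Definition silting_module (M : lmodType A) : Prop :=
  exists2 P, two_silting P & mod_iso M (H0 P).

(* The subcategories gen M \cap fl A of fl A, M a silting module. *)
Definition in_s_tors (C : lmodType A -> Prop) : Prop :=
  exists2 M, silting_module M &
    forall X : lmodType A, C X <-> gen_by M X /\ finite_length X.

End Complexes.

Section Posets.
Variables (X Y : Type) (leX : X -> X -> Prop) (leY : Y -> Y -> Prop).

Definition poset_iso (f : X -> Y) : Prop :=
  bijective f /\ forall x y, leX x y <-> leY (f x) (f y).

Record hom_poset := HomPoset {
  hom_fun :> X -> Y;
  hom_mono : forall x y, leX x y -> leY (hom_fun x) (hom_fun y) }.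

Definition hom_le (f g : hom_poset) : Prop := forall x, leY (f x) (g x).

End Posets.

(* Spec R is [prime_idealr R], ordered by inclusion. *)
Definition spec_le (R : comNzRingType) (q p : prime_idealr R) : Prop :=
  {subset q <= p}.

Section PrimeMultiples.
Variables (R : comNzRingType) (L : algebra R) (p : prime_idealr R).
Variable M : lmodType L.

Definition pmul : {pred M} := fun x =>
  `[< exists n (r : 'I_n -> R) (y : 'I_n -> M),
        (forall k, r k \in p) /\ x = \sum_(k < n) alg_map L (r k) *: y k >].

Fact pmul_closed : subsemimod_closed pmul.
Proof.
split; [split=> [|x x'] | move=> a x]; rewrite !unfold_in /=.
- apply/asboolP; exists 0, (fun=> 0), (fun=> 0).
  by split=> [k|]; [rewrite idealr0 | rewrite big_ord0].
- move=> /asboolP[n [r [y [rp ->]]]] /asboolP[m [s [z [sp ->]]]].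
  apply/asboolP; exists (n + m)%N.
  exists (fun k => match split k with inl i => r i | inr j => s j end).
  exists (fun k => match split k with inl i => y i | inr j => z j end).
  split=> [k|]; first by case: (split k).
  rewrite big_split_ord /=; congr (_ + _); apply: eq_bigr => k _.
    by have := unsplitK (inl k : 'I_n + 'I_m); rewrite /unsplit => ->.
  by have := unsplitK (inr k : 'I_n + 'I_m); rewrite /unsplit => ->.
- move=> /asboolP[n [r [y [rp ->]]]]; apply/asboolP.
  exists n, r, (fun k => a *: y k); split=> //.
  rewrite scaler_sumr; apply: eq_bigr => k _.
  by rewrite !scalerA alg_central.
Qed.
HB.instance Definition _ := GRing.isSubmodClosed.Build L M pmul pmul_closed.

Definition mod_p : lmodType L := quot_mod pmul.

End PrimeMultiples.

Section Compatibility.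
Variables (R : comNzRingType) (L : algebra R).
Notation Lp p := (loc_alg L p).

Section LocComplex.
Variables (p : prime_idealr R) (X : complex L).
Fact loc_diffK i (x : loc_mod p (X i)) :
  loc_map (cdiff X (succz i)) (loc_map (cdiff X i) x) = 0.
Proof.
by have [y [s <-]] := fracP x; rewrite !loc_mapE cdiffK; exact: frac0.
Qed.
Definition loc_complex : complex (Lp p) :=
  Complex (A := Lp p) (cobj := fun i => loc_mod p (X i))
    (cdiff := fun i => @loc_map R L p _ _ (cdiff X i)) loc_diffK.
End LocComplex.

(* (-)_p : 2-silt L -> 2-silt L_p is an isomorphism of posets. *)
Definition loc_silt_iso (p : prime_idealr R) : Prop :=
  exists F : silt2 L -> silt2 (Lp p),
    (forall (S : silt2 L) P, S P -> F S (loc_complex p P)) /\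
    poset_iso (@silt2_le L) (@silt2_le (Lp p)) F.

Definition all_tors_silting (p : prime_idealr R) : Prop :=
  forall C : lmodType (Lp p) -> Prop,
    in_s_tors C <-> is_torsion_class (@finite_length (Lp p)) C.

(* C_p, closed under isomorphisms *)
Definition loc_class (p : prime_idealr R) (C : lmodType L -> Prop) :
    lmodType (Lp p) -> Prop :=
  fun Y => exists2 X, C X & mod_iso Y (loc_mod p X).

Definition psi (p : prime_idealr R) (C : lmodType (Lp p) -> Prop) :
    lmodType (Lp p) -> Prop :=
  fun X => fin_gen X /\ C (mod_p p X).

(* r_{p,q}(C), for q contained in p. An L_p-module is localized at q as an
   L-module, which gives an L_q-module. *)
Definition r_pq (p q : prime_idealr R) (C : lmodType (Lp p) -> Prop) :
    lmodType (Lp q) -> Prop :=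
  fun Y => finite_length Y /\ exists2 X : lmodType (Lp p), psi C X &
    mod_iso Y (loc_mod q (restrict (@loc_can R L p) X)).

Definition Phi (T : lmodType L -> Prop) (p : prime_idealr R) :
    lmodType (Lp p) -> Prop :=
  fun Y => loc_class T Y /\ finite_length Y.

Definition Tc (X : forall p : prime_idealr R, lmodType (Lp p) -> Prop) : Prop :=
  (forall p, is_torsion_class (@finite_length (Lp p)) (X p)) /\
  (forall p q, spec_le q p -> forall Y, X q Y -> r_pq (X p) Y).

Definition compatible : Prop :=
  forall X : forall p : prime_idealr R, lmodType (Lp p) -> Prop,
    (exists T : tors (@fin_gen L), forall p Y, X p Y <-> Phi T Y) <-> Tc X.

End Compatibility.

(* Main.v *)
(* For a two-term complex P with P^-1 -> P^0, a module M is a quotient of a finite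
   sum of copies of H^0(P) iff Hom(P, M[1]) = 0, as soon as P is silting and M is
   finitely generated. Over L_p, Nakayama's lemma lifts Hom(P, M[1]) = 0 from M/pM
   to M, so P |-> gen H^0(P) \cap fl L_p embeds 2-silt L_p in tors(fl L_p) as an
   ordered set, and (ii) makes it an isomorphism. By (i) all these posets are 2-silt L,
   and the compatibility condition r_{p,q}(X^p) >= X^q becomes monotonicity in p.

   A torsion class T of mod L is determined by its image under Phi: a minimal
   counterexample is killed by a prime p and torsion free over R/p, and such a module
   contains a nonzero submodule in T as soon as its localization at p does. Conversely a
   monotone family (P_p) is the image of the torsion class of all M such that
   Hom(P_p, M_p[1]) = 0 for all p: a finite length quotient Y of (P_p^0)^n is the
   localization of the image M of (P^0)^n in Y, which is supported on V(p). *)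

Require Import Defs.
From HB Require Import structures.
From mathcomp Require Import all_boot all_order all_algebra.
From mathcomp Require Import ring zify boolp.

Set Implicit Arguments.
Unset Strict Implicit.
Unset Printing Implicit Defensive.

Import GRing.Theory.
Local Open Scope ring_scope.

(** * Linear maps, submodules and quotients *)

Section Linear.
Variable A : pzRingType.
Implicit Types M N V W P : lmodType A.

(** Recovering a monotone family from its torsion class needs antisymmetry of [silt2_le]: equality
    in 2-silt is additive equivalence. It is obtained from finite add-approximations, which exist
    because chain maps between two-term complexes form a finitely generated R-module. This is the
    reason for the explicit homotopies, and for replacing direct summands by [summand], retractions
    up to homotopy, which compose. By (i) the order of 2-silt L can be tested at any single prime,
    so classes living over different primes become comparable elements of one poset. An L_p-module Y
    is restricted to L and compared with an L-module A through a map with [dense] image. Torsion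
    classes are closed under quotients, so A may be replaced by its image, whose localization is Y;
    vanishing of Hom(P, -[1]) passes along dense maps. The groups Hom(P^-1, X) are modules over R_p
    but not over L_p. Nakayama's lemma is therefore stated for R_p-submodules ([sat_sub]). *)

Lemma ex_linear M N (f : M -> N) : linear f ->
  exists g : {linear M -> N}, g =1 f.
Proof.
move=> H; pose g : {linear M -> N} := HB.pack f (GRing.isLinear.Build A M N _ f H).
by exists g.
Qed.

(** Submodules are [Prop]-valued because images, kernels and traces are given by existence
    statements; [submodP_closed] passes to the boolean predicates of the structures. *)
Definition submodP V (U : V -> Prop) : Prop :=
  U 0 /\ forall a x y, U x -> U y -> U (a *: x + y).

Lemma submodP_closed V (U : V -> Prop) :
  submodP U <-> submod_closed [pred x | `[< U x >]].
Proof.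
split=> -[U0 UD]; split.
- by rewrite inE; apply/asboolP.
- by move=> a x y /asboolP Ux /asboolP Uy; apply/asboolP; apply: UD.
- by move: U0; rewrite inE => /asboolP.
- move=> a x y Ux Uy; have := UD a x y; rewrite !inE => H.
  by apply/asboolP/H; apply/asboolP.
Qed.

Lemma submodPD V (U : V -> Prop) x y : submodP U -> U x -> U y -> U (x + y).
Proof. by move=> [_ H] Ux Uy; rewrite -[x]scale1r; apply: H. Qed.

Lemma submodPZ V (U : V -> Prop) a x : submodP U -> U x -> U (a *: x).
Proof. by move=> [U0 H] Ux; rewrite -[a *: x]addr0; apply: H. Qed.

Lemma submodPN V (U : V -> Prop) x : submodP U -> U x -> U (- x).
Proof. by move=> H Ux; rewrite -scaleN1r; apply: submodPZ. Qed.

Lemma submodPB V (U : V -> Prop) x y : submodP U -> U x -> U y -> U (x - y).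
Proof. by move=> H Ux Uy; apply: submodPD => //; apply: submodPN. Qed.

Lemma submodP_sum V (U : V -> Prop) (I : finType) (F : I -> V) :
  submodP U -> (forall i, U (F i)) -> U (\sum_i F i).
Proof.
move=> H HF; apply: big_ind => [|x y|//]; first by case: H.
exact: submodPD.
Qed.

Lemma sub_ex V (U : V -> Prop) : submodP U ->
  exists (S : lmodType A) (i : {linear S -> V}),
    injective i /\ forall x, U x <-> exists y, i y = x.
Proof.
move=> /submodP_closed H.
pose U' : {pred V} := [pred x | `[< U x >]].
pose S : submodClosed V :=
  HB.pack (U' : V -> bool) (GRing.isSubmodClosed.Build A V U' (GRing.submod_closed_semi H)).
have [i Ei] := @ex_linear (sub_mod S) V val (fun a x y => erefl _).
exists (sub_mod S), i; split=> [x y|x]; first by rewrite !Ei => /val_inj.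
split=> [Ux|[y <-]].
  have xS : x \in S by rewrite inE; apply/asboolP.
  by exists (exist _ x xS : sub_mod S); rewrite Ei.
by rewrite Ei; have := valP y => /asboolP.
Qed.

Lemma quot_ex V (U : V -> Prop) : submodP U ->
  exists (Q : lmodType A) (pi : {linear V -> Q}),
    surj pi /\ forall x, pi x = 0 <-> U x.
Proof.
move=> /submodP_closed H.
pose U' : {pred V} := [pred x | `[< U x >]].
pose S : submodClosed V :=
  HB.pack (U' : V -> bool) (GRing.isSubmodClosed.Build A V U' (GRing.submod_closed_semi H)).
have L : linear (quot_proj S).
  move=> a x y; rewrite quot_projD; congr (_ + _).
  by rewrite -quot_scaleE.
have [pi Epi] := ex_linear L.
exists (quot_mod S), pi; split=> [y|x].
  by have [x <-] := quot_projP y; exists x; rewrite Epi.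
have {}Epi y : pi y = quot_proj S y by exact: Epi.
have <- : pi 0 = 0 by exact: linear0.
rewrite !Epi quot_proj_eq subr0 inE.
by split=> /asboolP.
Qed.

(** Uniqueness of the values makes the chosen function linear. This serves for maps known only by a
    property of their values: on quotients, on fractions, or dividing by a denominator. *)
Lemma lin_of_rel M N (r : M -> N -> Prop) :
  (forall x, exists y, r x y) ->
  (forall x y y', r x y -> r x y' -> y = y') ->
  (forall a x x' y y', r x y -> r x' y' -> r (a *: x + x') (a *: y + y')) ->
  exists g : {linear M -> N}, forall x, r x (g x).
Proof.
move=> /choice[f Hf] fn lin.
have /ex_linear[g Eg] : linear f by move=> a x y; apply: (fn _ _ _ (Hf _)); apply: lin.
by exists g => x; rewrite Eg.
Qed.

Lemma factor_surj V N W (pi : {linear V -> N}) (f : {linear V -> W}) :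
  surj pi -> (forall x, pi x = 0 -> f x = 0) ->
  exists g : {linear N -> W}, forall x, g (pi x) = f x.
Proof.
move=> sp H.
have [|||g Hg] := @lin_of_rel N W (fun y w => exists2 x, pi x = y & f x = w).
- by move=> y; have [x <-] := sp y; exists (f x), x.
- move=> y w w' [x <- <-] [x' E <-]; apply/eqP; rewrite -subr_eq0 -linearB.
  by apply/eqP/H; rewrite linearB E subrr.
- move=> a x x' y y' [z <- <-] [z' <- <-]; exists (a *: z + z');
  by rewrite linearP.
exists g => x; have [x' E <-] := Hg (pi x).
apply/eqP; rewrite -subr_eq0 -linearB.
by apply/eqP/H; rewrite linearB E subrr.
Qed.

Lemma factor_inj M V W (i : {linear M -> V}) (f : {linear W -> V}) :
  injective i -> (forall x, exists y, i y = f x) ->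
  exists g : {linear W -> M}, forall x, i (g x) = f x.
Proof.
move=> ii H; apply: (@lin_of_rel _ _ (fun x y => i y = f x)) => //.
- by move=> x y y' <- /ii.
- by move=> a x x' y y' E F; rewrite !linearP E F.
Qed.

Lemma submodP_image V W (f : {linear V -> W}) :
  submodP (fun y => exists x, f x = y).
Proof.
split=> [|a _ _ [x <-] [y <-]]; first by exists 0; rewrite linear0.
by exists (a *: x + y); rewrite linearP.
Qed.

Lemma submodP_ker V W (f : {linear V -> W}) : submodP (fun x => f x = 0).
Proof.
split=> [|a x y E F]; first exact: linear0.
by rewrite linearP E F scaler0 addr0.
Qed.

Lemma image_factor V W (f : {linear V -> W}) :
  exists (S : lmodType A) (e : {linear V -> S}) (i : {linear S -> W}),
    [/\ surj e, injective i & forall x, i (e x) = f x].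
Proof.
have [S [i [ii Hi]]] := sub_ex (submodP_image f).
have [x|e He] := @factor_inj S W V i f ii; first by apply/(Hi (f x)); exists x.
exists S, e, i; split=> // y; have /(Hi (i y))[x E] : exists y', i y' = i y by exists y.
by exists x; apply: ii; rewrite He.
Qed.

(** Corestrict to the image of [g]. Differentials, along which maps are lifted later, are not
    onto. *)
Lemma lift_proj P N N' (g : {linear N -> N'}) (f : {linear P -> N'}) :
  projective P -> (forall x, exists y, g y = f x) ->
  exists h : {linear P -> N}, forall x, g (h x) = f x.
Proof.
move=> pP H; have [S [e [i [se ii E]]]] := image_factor g.
have [x|f' Ef] := @factor_inj S N' P i f ii.
  by have [y <-] := H x; exists (e y).
by have [h Eh] := pP _ _ e f' se; exists h => x; rewrite -E Eh.
Qed.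

Lemma mod_iso_ex M N (f : {linear M -> N}) :
  injective f -> surj f -> mod_iso M N.
Proof.
move=> fi /choice[g Hg]; exists f; exists g => // x; exact/fi/Hg.
Qed.

Lemma mod_iso_bij M N : mod_iso M N ->
  exists f : {linear M -> N}, injective f /\ surj f.
Proof.
move=> [f [g fK gK]]; exists f; split; first exact: can_inj fK.
by move=> y; exists (g y).
Qed.

Lemma inj_lin M N (f : {linear M -> N}) :
  (forall x, f x = 0 -> x = 0) -> injective f.
Proof.
move=> H x y E; apply/eqP; rewrite -subr_eq0; apply/eqP/H.
by rewrite linearB E subrr.
Qed.

Lemma mod_iso_sym M N : mod_iso M N -> mod_iso N M.
Proof.
move=> /mod_iso_bij[f [fi fs]].
have [x|g Hg] := @factor_inj M N N f idfun fi; first exact: fs.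
exists g; exists f => // x; apply: fi; exact: Hg.
Qed.

Lemma mod_iso_trans N M V : mod_iso M N -> mod_iso N V -> mod_iso M V.
Proof. by move=> [f bf] [g bg]; exists (g \o f); apply: bij_comp. Qed.

(** * Finite generation and projectivity *)

Lemma fin_gen_surj M N (f : {linear M -> N}) : surj f -> fin_gen M -> fin_gen N.
Proof.
move=> sf [n [g Hg]]; exists n, (fun k => f (g k)) => y.
have [x <-] := sf y; have [c ->] := Hg x; exists c.
by rewrite linear_sum; apply: eq_bigr => k _; rewrite linearZ.
Qed.

Lemma fin_gen_iso M N : mod_iso M N -> fin_gen M -> fin_gen N.
Proof. by move=> /mod_iso_bij[f [_ sf]]; apply: fin_gen_surj sf. Qed.

Lemma fin_gen_finType (I : finType) M (g : I -> M) :
  (forall x, exists c : I -> A, x = \sum_i c i *: g i) -> fin_gen M.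
Proof.
move=> H; exists #|I|, (fun k => g (enum_val k)) => x.
have [c ->] := H x; exists (fun k => c (enum_val k)).
by rewrite (reindex _ (onW_bij _ (enum_val_bij I))).
Qed.

Lemma fin_gen_copies (I : finType) M : fin_gen M -> fin_gen {ffun I -> M}.
Proof.
move=> [n [g Hg]].
apply: (@fin_gen_finType (I * 'I_n)%type _
  (fun ik => [ffun i => if i == ik.1 then g ik.2 else 0])) => x.
have /choice[c Hc] := fun i => Hg (x i).
exists (fun ik => c ik.1 ik.2); apply/ffunP => i.
rewrite sum_ffunE (Hc i) -(pair_bigA _ (fun j k => (c j k *: [ffun i => if i == j then g k else 0] : {ffun I -> M}) i)) /=.
rewrite (bigD1 i) //= [X in _ + X]big1 ?addr0 => [|j ji].
  by apply: eq_bigr => k _; rewrite !ffunE eqxx.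
by apply: big1 => k _; rewrite !ffunE eq_sym (negbTE ji) scaler0.
Qed.

Lemma fin_gen_self : fin_gen A^o.
Proof.
exists 1, (fun=> 1 : A^o) => x; exists (fun=> x).
by rewrite big_ord1; symmetry; exact: mulr1.
Qed.

Lemma fin_gen_prod M N : fin_gen M -> fin_gen N -> fin_gen (M * N)%type.
Proof.
move=> [n [g Hg]] [m [h Hh]].
apply: (@fin_gen_finType ('I_n + 'I_m)%type _
  (fun s => match s with inl i => (g i, 0) | inr j => (0, h j) end)).
move=> [x y]; have [c ->] := Hg x; have [d ->] := Hh y.
exists (fun s => match s with inl i => c i | inr j => d j end).
rewrite big_sumType /= [X in X + _](_ : _ = (\sum_i c i *: g i, 0)); last first.
  rewrite (eq_bigr (fun i => (c i *: g i, 0))); last first.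
    by move=> i _; congr (_, _); rewrite /= scaler0.
  by elim/big_rec2: _ => // i x' y' _ ->; congr (_, _); rewrite /= addr0.
rewrite [X in _ + X](_ : _ = (0, \sum_i d i *: h i)); last first.
  rewrite (eq_bigr (fun i => (0, d i *: h i))); last first.
    by move=> i _; congr (_, _); rewrite /= scaler0.
  by elim/big_rec2: _ => // i x' y' _ ->; congr (_, _); rewrite /= addr0.
by congr (_, _); rewrite /= ?addr0 ?add0r.
Qed.

Lemma projective_prod M N : projective M -> projective N -> projective (M * N)%type.
Proof.
move=> pM pN V W g f sg.
have /ex_linear[f1 E1] : linear (fun x => f (x, 0)).
  by move=> a x y; rewrite -linearP; congr (f (_, _)); rewrite /= scaler0 addr0.
have /ex_linear[f2 E2] : linear (fun x => f (0, x)).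
  by move=> a x y; rewrite -linearP; congr (f (_, _)); rewrite /= scaler0 addr0.
have [h1 H1] := pM _ _ g f1 sg; have [h2 H2] := pN _ _ g f2 sg.
have /ex_linear[h Eh] : linear (fun z : M * N => h1 z.1 + h2 z.2).
  by move=> a x y; rewrite !linearP /= scalerDr addrACA.
exists h => -[x y]; rewrite Eh linearD H1 H2 E1 E2 -linearD.
by congr (f (_, _)); rewrite /= ?addr0 ?add0r.
Qed.

Lemma free_ext (I : finType) N (v : I -> N) :
  exists f : {linear {ffun I -> A^o} -> N},
    forall c, f c = \sum_i (c i : A) *: v i.
Proof.
apply: ex_linear => a c c'; rewrite scaler_sumr -big_split /=.
by apply: eq_bigr => k _; rewrite !ffunE scalerDl scalerA.
Qed.

Lemma free_unit (I : finType) (c : {ffun I -> A^o}) :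
  c = \sum_k (c k : A) *: [ffun j => ((j == k)%:R : A^o)].
Proof.
apply/ffunP => j; rewrite sum_ffunE (bigD1 j) //= !ffunE eqxx.
rewrite big1 ?addr0 => [|k kj]; last first.
  by rewrite !ffunE eq_sym (negbTE kj); exact: mulr0.
by symmetry; exact: mulr1.
Qed.

Lemma projective_free (I : finType) : projective {ffun I -> A^o}.
Proof.
move=> N N' g f sg.
have /choice[v Hv] := fun i => sg (f [ffun j => ((j == i)%:R : A^o)]).
have [h Hh] := free_ext v; exists h => c.
rewrite Hh {2}(free_unit c) !linear_sum; apply: eq_bigr => k _.
by rewrite !linearZ Hv.
Qed.

Lemma fg_projective_free (I : finType) : fg_projective {ffun I -> A^o}.
Proof.
by split; [apply/fin_gen_copies/fin_gen_self | exact: projective_free].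
Qed.

Lemma fg_projective_prod M N :
  fg_projective M -> fg_projective N -> fg_projective (M * N)%type.
Proof.
by move=> [? ?] [? ?]; split; [exact: fin_gen_prod | exact: projective_prod].
Qed.

Lemma dual_basis P : fg_projective P ->
  exists n (b : 'I_n -> P) (f : {linear P -> {ffun 'I_n -> A^o}}),
    forall x, x = \sum_i (f x i : A) *: b i.
Proof.
move=> [[n [b Hb]] pP]; have [g Hg] := free_ext b.
have [x|f Hf] := @lift_proj P _ _ g idfun pP.
  have [c Ec] := Hb x; exists [ffun k => c k]; rewrite Hg Ec.
  by apply: eq_bigr => k _; rewrite ffunE.
by exists n, b, f => x; rewrite -Hg Hf.
Qed.

Lemma copies_sum (I : finType) M N (f : I -> {linear M -> N}) :
  exists g : {linear {ffun I -> M} -> N}, forall x, g x = \sum_i f i (x i).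
Proof.
apply: ex_linear => a x y; rewrite scaler_sumr -big_split /=.
by apply: eq_bigr => i _; rewrite !ffunE linearP.
Qed.

End Linear.

(** * Equalities in abelian groups *)

(** Identities in a module are out of reach of [ring]; both sides are reified and compared through
    the integer coefficients of their atoms. *)
Inductive zexp := ZV of nat | ZD of zexp & zexp | ZN of zexp | Z0.

Fixpoint zeval (V : zmodType) (env : seq V) (e : zexp) : V :=
  match e with
  | ZV n => env`_n
  | ZD a b => zeval env a + zeval env b
  | ZN a => - zeval env a
  | Z0 => 0
  end.

Fixpoint zcoef (i : nat) (e : zexp) : int :=
  match e with
  | ZV n => ((n == i) : nat)%:Z
  | ZD a b => zcoef i a + zcoef i b
  | ZN a => - zcoef i a
  | Z0 => 0
  end.

Lemma zevalE (V : zmodType) (env : seq V) e :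
  zeval env e = \sum_(i < size env) env`_i *~ zcoef i e.
Proof.
elim: e => [n|a IHa b IHb|a IHa|] /=.
- case: (ltnP n (size env)) => ln; last first.
    by rewrite nth_default // big1 // => i _; rewrite gtn_eqF // (leq_trans (ltn_ord i)).
  rewrite (bigD1 (Ordinal ln)) //= eqxx mulr1z big1 ?addr0 // => i ni.
  by rewrite [n == i]eq_sym; move: ni; rewrite -val_eqE /= => /negbTE->.
- by rewrite IHa IHb -big_split; apply: eq_bigr => i _; rewrite mulrzDr.
- by rewrite IHa -sumrN; apply: eq_bigr => i _; rewrite mulrNz.
- by rewrite big1 // => i _; rewrite mulr0z.
Qed.

Lemma zeval_eq (V : zmodType) (env : seq V) e f :
  all (fun i => zcoef i e == zcoef i f) (iota 0 (size env)) ->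
  zeval env e = zeval env f.
Proof.
move=> /allP H; rewrite !zevalE; apply: eq_bigr => i _.
by rewrite (eqP (H i _)) // mem_iota /=.
Qed.

(** Atoms are matched up to conversion, since one term can occur under different presentations of
    its structures. The nested [match goal] lets [unify] run inside a tactic that returns a term. *)
Ltac zsame x y :=
  match goal with
  | _ => let _ := match goal with _ => unify x y end in constr:(true)
  | _ => constr:(false)
  end.
Ltac zmem x l :=
  match l with
  | nil => constr:(false)
  | cons ?y ?t =>
      let b := zsame x y in
      match b with true => constr:(true) | false => zmem x t end
  end.
Ltac zidx x l :=
  match l with
  | cons ?y ?t =>
      let b := zsame x y in
      match b with
      | true => constr:(O)
      | false => let n := zidx x t in constr:(S n)
      end
  end.
Ltac zvars l t :=
  match t with
  | @GRing.add _ ?a ?b => let l := zvars l a in zvars l b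
  | @GRing.opp _ ?a => zvars l a
  | @GRing.zero _ => l
  | _ => let b := zmem t l in
         match b with true => l | false => constr:(cons t l) end
  end.
Ltac zreify l t :=
  match t with
  | @GRing.add _ ?a ?b =>
      let a := zreify l a in let b := zreify l b in constr:(ZD a b)
  | @GRing.opp _ ?a => let a := zreify l a in constr:(ZN a)
  | @GRing.zero _ => constr:(Z0)
  | _ => let n := zidx t l in constr:(ZV n)
  end.
Ltac zmodule :=
  match goal with
  | |- @eq ?T ?a ?b =>
      let l := zvars (@nil T) a in
      let l := zvars l b in
      let ea := zreify l a in let eb := zreify l b in
      apply: (@zeval_eq _ l ea eb); vm_compute; reflexivity
  end.

(** * The homotopy category *)

Lemma dep_choice (I : Type) (T : I -> Type) (r : forall i, T i -> Prop) :
  (forall i, exists y, r i y) -> exists f : forall i, T i, forall i, r i (f i).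
Proof.
move=> H; exists (fun i => projT1 (cid (H i))) => i.
exact: projT2 (cid (H i)).
Qed.

(** A degree is a successor only up to a propositional equality; the whole statement is rewritten
    along it, so that no module is ever cast. *)
Lemma succz_case (Q : int -> Prop) : (forall i, Q (succz i)) -> forall i, Q i.
Proof. by move=> H i; rewrite -(subrK 1 i); apply: H. Qed.

Ltac linx := repeat (rewrite ?opprD ?opprK; first [rewrite linearD | rewrite linearN]).

Section Homotopy.
Variable A : pzRingType.
Implicit Types X Y Z P : complex A.

Lemma lin_sum (I : finType) (M N : lmodType A) (f : I -> {linear M -> N}) :
  exists g : {linear M -> N}, forall x, g x = \sum_i f i x.
Proof.
apply: ex_linear => a x y; rewrite scaler_sumr -big_split /=.
by apply: eq_bigr => i _; rewrite linearP.
Qed.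

Lemma cm_comp X Y Z (f : chain_map X Y) (g : chain_map Y Z) :
  exists k : chain_map X Z, forall i x, k i x = g i (f i x).
Proof.
by exists (@ChainMap _ X Z (fun i => g i \o f i) (fun i x =>
  etrans (congr1 (g (succz i)) (cmapE f x)) (cmapE g (f i x)))).
Qed.

Lemma cm_sum (I : finType) X Y (f : I -> chain_map X Y) :
  exists k : chain_map X Y, forall i x, k i x = \sum_j f j i x.
Proof.
have [k Hk] := dep_choice (fun i => lin_sum (fun j => f j i)).
have E i x : k (succz i) (cdiff X i x) = cdiff Y i (k i x).
  by rewrite !Hk linear_sum; apply: eq_bigr => j _; rewrite cmapE.
by exists (ChainMap E).
Qed.

Lemma cm_id X : exists f : chain_map X X, forall i x, f i x = x.
Proof. by exists (@ChainMap _ X X (fun i => idfun) (fun i x => erefl)). Qed.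

Lemma cm_shift X Y (f : chain_map X Y) :
  exists g : chain_map (shift X) (shift Y), forall i x, g i x = f (succz i) x.
Proof.
have E i (x : X (succz i)) :
    f (succz (succz i)) (cdiff (shift X) i x) = cdiff (shift Y) i (f (succz i) x).
  by rewrite [LHS]linearN cmapE.
by exists (@ChainMap _ (shift X) (shift Y) (fun i => f (succz i)) E).
Qed.

(* X is a retract, up to homotopy, of a finite sum of copies of P. *)
Definition summand X P : Prop :=
  exists (I : finType) (a : I -> chain_map X P) (b : I -> chain_map P X)
    (h : forall i, {linear X (succz i) -> X i}),
    forall i x, \sum_j b j (succz i) (a j (succz i) x) - x =
      cdiff X i (h i x) + h (succz i) (cdiff X (succz i) x).

Lemma summand_refl X : summand X X.
Proof.
have [e He] := cm_id X.
exists 'I_1, (fun=> e), (fun=> e), (fun i => \0) => i x.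
by rewrite big_ord1 !He subrr !linear0 addr0.
Qed.

Lemma summand_trans Y X Z : summand X Y -> summand Y Z -> summand X Z.
Proof.
move=> [I [a [b [h H]]]] [J [c [d [k K]]]].
have /dep_choice[ca Hca] := fun ij : I * J => cm_comp (a ij.1) (c ij.2).
have /dep_choice[bd Hbd] := fun ij : I * J => cm_comp (d ij.2) (b ij.1).
(* The homotopy of the composite adds to that of [X] the homotopy of [Y] carried over by [a] and
   [b]. *)
have /dep_choice[m Hm] : forall i, exists m : {linear X (succz i) -> X i},
    forall x, m x = h i x + \sum_j b j i (k i (a j (succz i) x)).
  move=> i.
  have [s Hs] := lin_sum (fun j => b j i \o k i \o a j (succz i)).
  by exists (h i \+ s) => x; rewrite /= Hs.
exists (I * J)%type, ca, bd, m => i x.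
rewrite (eq_bigr (fun pq => bd (pq.1, pq.2) (succz i) (ca (pq.1, pq.2) (succz i) x))) => [|[]//].
rewrite -(pair_bigA _ (fun p q => bd (p, q) (succz i) (ca (p, q) (succz i) x))) /=.
have -> : \sum_p \sum_q bd (p, q) (succz i) (ca (p, q) (succz i) x) =
   \sum_p b p (succz i) (a p (succz i) x) +
   (cdiff X i (\sum_j b j i (k i (a j (succz i) x))) +
   \sum_j b j (succz i) (k (succz i) (a j _ (cdiff X (succz i) x)))).
  rewrite linear_sum -!big_split /=; apply: eq_bigr => p _.
  transitivity (b p (succz i) (\sum_q d q (succz i) (c q (succz i) (a p (succz i) x)))).
    by rewrite linear_sum; apply: eq_bigr => q _; rewrite Hbd Hca.
  rewrite cmapE -cmapE -!linearD -K; congr (b p _ _).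
  by rewrite addrC subrK.
by rewrite !Hm linearD addrACA -H; zmodule.
Qed.

Lemma summand_shift X P : summand X P -> summand (shift X) (shift P).
Proof.
move=> [I [a [b [h H]]]].
have /dep_choice[a' Ha] := fun j => cm_shift (a j).
have /dep_choice[b' Hb] := fun j => cm_shift (b j).
(* The sign compensates for the negated differential of [shift]. *)
have /dep_choice[k Hk] : forall i, exists k : {linear shift X (succz i) -> shift X i},
    forall x, k x = - h (succz i) x.
  by move=> i; exists (\- h (succz i)).
exists I, a', b', k => i x.
under eq_bigr do rewrite Ha Hb.
rewrite H !Hk; congr (_ + _).
  by rewrite [RHS]linearN opprK.
by rewrite -[LHS]opprK; congr (- _); rewrite -linearN.
Qed.

Lemma summand_shiftn n X P : summand X P -> summand (shiftn n X) (shiftn n P).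
Proof. by move=> H; elim: n => //= n; exact: summand_shift. Qed.

Lemma hiso_sym X Y : hiso X Y -> hiso Y X.
Proof. by move=> [f [g [? ?]]]; exists g, f. Qed.

Lemma hiso_summand X Y : hiso X Y -> summand X Y.
Proof.
move=> [f [g [[h Hh] _]]].
by exists 'I_1, (fun=> f), (fun=> g), h => i x; rewrite big_ord1 -Hh.
Qed.

Lemma hiso_refl X : hiso X X.
Proof.
have [e He] := cm_id X; exists e, e.
by split; exists (fun i => \0) => i x; rewrite /= !He subrr !linear0 addr0.
Qed.

(** The map [f] differs from the sum of the f b_j a_j by the boundary of f h, and each f b_j is
    null-homotopic by hypothesis; this gives the homotopy [m]. *)
Lemma hom_zero_summandl X P Z : summand X P -> hom_zero P Z -> hom_zero X Z.
Proof.
move=> [I [a [b [h H]]]] Z0 f.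
have /dep_choice[fb Hfb] := fun j => cm_comp (b j) f.
have /dep_choice[k Hk] := fun j => Z0 (fb j).
have /dep_choice[m Hm] : forall i, exists m : {linear X (succz i) -> Z i},
    forall x, m x = \sum_j k j i (a j (succz i) x) - f i (h i x).
  move=> i.
  have [s Hs] := lin_sum (fun j => k j i \o a j (succz i)).
  by exists (s \- (f i \o h i)) => x; rewrite /= Hs.
exists m => i x; rewrite subr0 !Hm linearB linear_sum addrACA -big_split /=.
have E := H i x.
rewrite -cmapE -opprD -linearD -E linearB opprB linear_sum.
rewrite [X in _ = X + _](_ : _ = \sum_j f (succz i) (b j (succz i) (a j (succz i) x))).
  by zmodule.
apply: eq_bigr => j _; have := Hk j i (a j (succz i) x).
by rewrite subr0 Hfb cmapE => ->.
Qed.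

Lemma hom_zero_summandr X P Z : summand X P -> hom_zero Z P -> hom_zero Z X.
Proof.
move=> [I [a [b [h H]]]] Z0 f.
have /dep_choice[fa Hfa] := fun j => cm_comp f (a j).
have /dep_choice[k Hk] := fun j => Z0 (fa j).
have /dep_choice[m Hm] : forall i, exists m : {linear Z (succz i) -> X i},
    forall x, m x = \sum_j b j i (k j i x) - h i (f (succz i) x).
  move=> i.
  have [s Hs] := lin_sum (fun j => b j i \o k j i).
  by exists (s \- (h i \o f (succz i))) => x; rewrite /= Hs.
exists m => i x; rewrite subr0 !Hm linearB linear_sum addrACA -big_split /=.
rewrite cmapE -opprD -H opprB.
rewrite [X in _ = X + _](_ : _ = \sum_j b j (succz i) (a j (succz i) (f (succz i) x))).
  by zmodule.
apply: eq_bigr => j _; have := Hk j i x.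
by rewrite subr0 Hfa -cmapE -linearD => ->.
Qed.

Lemma cm_copies_proj (n : nat) X (j : 'I_n) :
  exists f : chain_map (copies n X) X, forall i x, f i x = x j.
Proof.
have /dep_choice[f Hf] : forall i, exists f : {linear copies n X i -> X i},
    forall x, f x = x j.
  by move=> i; apply: ex_linear => a x y; rewrite !ffunE.
have E i x : f (succz i) (cdiff (copies n X) i x) = cdiff X i (f i x).
  by rewrite !Hf ffunE.
by exists (ChainMap E).
Qed.

Lemma cm_copies_inj (n : nat) X (j : 'I_n) :
  exists f : chain_map X (copies n X), forall i x k, f i x k = if k == j then x else 0.
Proof.
have /dep_choice[f Hf] : forall i, exists f : {linear X i -> copies n X i},
    forall x, f x = [ffun k => if k == j then x else 0].
  move=> i; apply: ex_linear => a x y; apply/ffunP => k.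
  by rewrite !ffunE; case: eqP; rewrite ?scaler0 ?addr0.
have E i x : f (succz i) (cdiff X i x) = cdiff (copies n X) i (f i x).
  by rewrite !Hf; apply/ffunP => k; rewrite !ffunE; case: eqP; rewrite ?linear0.
by exists (ChainMap E) => i x k /=; rewrite Hf ffunE.
Qed.

Lemma summand_copies n X : summand (copies n X) X.
Proof.
have /dep_choice[a Ha] := @cm_copies_proj n X.
have /dep_choice[b Hb] := @cm_copies_inj n X.
exists 'I_n, a, b, (fun i => \0) => i x; rewrite !linear0 addr0.
apply/eqP; rewrite subr_eq0; apply/eqP/ffunP => k.
rewrite sum_ffunE (bigD1 k) //= Hb eqxx Ha big1 ?addr0 // => j jk.
by rewrite Hb eq_sym (negbTE jk).
Qed.

Lemma summand_dsum X Y : summand X (dsum X Y).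
Proof.
have /dep_choice[f Hf] : forall i, exists f : {linear X i -> dsum X Y i},
    forall x, f x = (x, 0).
  move=> i; apply: ex_linear => a x y.
  by congr (_, _); rewrite /= scaler0 addr0.
have E i x : f (succz i) (cdiff X i x) = cdiff (dsum X Y) i (f i x).
  by rewrite !Hf; congr (_, _); rewrite /= linear0.
have /dep_choice[g Hg] : forall i, exists g : {linear dsum X Y i -> X i},
    forall x, g x = x.1.
  by move=> i; apply: ex_linear => a x y.
have E' i x : g (succz i) (cdiff (dsum X Y) i x) = cdiff X i (g i x).
  by rewrite !Hg.
exists 'I_1, (fun=> ChainMap E), (fun=> ChainMap E'), (fun i => \0) => i x.
by rewrite big_ord1 /= Hg Hf subrr !linear0 addr0.
Qed.

Lemma summand_hiso X Y : hiso X Y -> summand Y X.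
Proof. by move=> /hiso_sym/hiso_summand. Qed.

(* In a triangulated category a retraction X -> Z -> X splits Z as the sum of X
   and the cone of X -> Z; here with explicit homotopies. *)
Lemma retract_cone X Z (a : chain_map X Z) (b : chain_map Z X) :
  homotopic (fun i => b i \o a i : {linear X i -> X i}) (fun i => idfun) ->
  hiso (dsum X (cone a)) Z.
Proof.
move=> [h0 H0].
have /dep_choice[h Hh] : forall i, exists h : {linear X (succz i) -> X i},
    forall x, h x = - h0 i x.
  by move=> i; exists (\- h0 i).
have {H0} H i (x : X (succz i)) : b _ (a _ x) =
    x - cdiff X i (h i x) - h (succz i) (cdiff X (succz i) x).
  have := H0 i x; rewrite /= !Hh linearN !opprK => E.
  by rewrite -[LHS](subrK x) E; zmodule.
set W := dsum X (cone a).
have /dep_choice[F HF] : forall i, exists F : {linear Z i -> W i},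
    forall z, F z = (b i z, (0, z)).
  move=> i; apply: ex_linear => c z z'.
  congr (_, (_, _)); rewrite /= ?linearP //.
  by rewrite scaler0 addr0.
have FE i z : F (succz i) (cdiff Z i z) = cdiff W i (F i z).
  rewrite !HF; congr (_, (_, _)); rewrite /= ?cmapE //.
    by rewrite linear0 oppr0.
  by rewrite linear0 add0r.
(* The map 1 - a b vanishes on the image of [a] only up to homotopy; the term a h corrects this on
   the component X[1] of the cone. Then [G] after [F] is the identity on the nose, and only the
   other composite needs a homotopy. *)
have /dep_choice[G HG] : forall i, exists G : {linear W i -> Z i},
    forall w, G w =
     a i w.1 + w.2.2 - a i (b i w.2.2) + a i (h i w.2.1).
  move=> i; apply: ex_linear => c z z' /=.
  by rewrite !linearP /= !scalerDr ?scalerN ?opprD; zmodule.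
have GE : forall i w, G (succz i) (cdiff W i w) = cdiff Z i (G i w).
  apply: succz_case => i w.
  rewrite !HG /=; linx; rewrite -!cmapE H; linx; rewrite ?cdiffK.
  by zmodule.
exists (ChainMap GE), (ChainMap FE); split.
  have /dep_choice[K HK] : forall i, exists K : {linear W (succz i) -> W i},
    forall w, K w =
      (- h i (w.1 - b _ w.2.2 + h _ w.2.1), (w.1 - b _ w.2.2 + h _ w.2.1, 0)).
    move=> i; apply: ex_linear => c z z' /=.
    have -> : c *: z.1 + z'.1 - b (succz i) (c *: z.2.2 + z'.2.2) + h (succz i) (c *: z.2.1 + z'.2.1)
      = c *: (z.1 - b (succz i) z.2.2 + h (succz i) z.2.1) + (z'.1 - b (succz i) z'.2.2 + h (succz i) z'.2.1).
      by rewrite !linearP /= !scalerDr ?scalerN; zmodule.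
    congr (_, (_, _)).
    - by rewrite !linearP.
    - by rewrite /= scaler0 addr0.
  exists K => i [x [x' z]]; rewrite /= HF HG !HK /=.
  congr (_, (_, _)); rewrite /=.
  - linx; rewrite ?H; linx; rewrite ?cmapE ?cdiffK ?linear0 ?H; linx.
    by zmodule.
  - linx; rewrite ?H; linx; rewrite ?cmapE ?cdiffK ?linear0 ?H; linx.
    by zmodule.
  - by linx; rewrite ?linear0; zmodule.
exists (fun i => \0) => i z; rewrite /= HG HF /= !linear0.
by zmodule.
Qed.

Lemma is_kb_shift X : is_kb X -> is_kb (shift X).
Proof.
move=> [pX [n Hn]]; split=> [i|]; first exact: pX.
exists n.+1 => i ni; apply: (Hn (succz i)).
by rewrite /succz; lia.
Qed.

Lemma is_kb_cone X Y (f : chain_map X Y) : is_kb X -> is_kb Y -> is_kb (cone f).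
Proof.
move=> /is_kb_shift[pX [n Hn]] [pY [m Hm]]; split=> [i|].
  exact: fg_projective_prod (pX i) (pY i).
exists (n + m)%N => i H [x y]; congr (_, _).
  by apply: Hn; apply: leq_ltn_trans H; rewrite leq_addr.
by apply: Hm; apply: leq_ltn_trans H; rewrite leq_addl.
Qed.

(** By [retract_cone], the cone of X -> P^n is a complement of X in P^n, so a mere retraction
    suffices. Additive equivalence thus becomes a pair of relations that compose. *)
Lemma in_addP P X : is_kb P -> in_add P X <-> is_kb X /\ summand X P.
Proof.
move=> kP; split=> [[kX [n [Y [_ H]]]]|[kX]].
  split=> //; apply: summand_trans (summand_copies n P).
  exact: summand_trans (summand_dsum X Y) (hiso_summand H).
move=> [I [a [b [h H]]]]; split=> //.
set n := #|I|; set Z := copies n P.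
have /dep_choice[ia Hia] := fun j : 'I_n => cm_copies_inj P j.
have /dep_choice[pb Hpb] := fun j : 'I_n => cm_copies_proj P j.
have /dep_choice[ia' Hia'] := fun j : 'I_n => cm_comp (a (enum_val j)) (ia j).
have /dep_choice[pb' Hpb'] := fun j : 'I_n => cm_comp (pb j) (b (enum_val j)).
have [a' Ha'] := cm_sum ia'.
have [b' Hb'] := cm_sum pb'.
exists n, (cone a'); split.
  apply: is_kb_cone => //; have [pP [m Hm]] := kP; split=> [i|].
    split; first by apply: fin_gen_copies; case: (pP i).
    move=> N N' g f sg.
    have /dep_choice[u Hu] : forall j : 'I_n, exists u : {linear P i -> N},
        forall x, g (u x) = f (ia j i x) by move=> j; apply: (pP i).2 _ _ g (f \o ia j i) sg.
    have [v Hv] := copies_sum u; exists v => x; rewrite Hv linear_sum.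
    rewrite (eq_bigr (fun j => f (ia j i (x j)))) => [|j _]; last by rewrite Hu.
    rewrite -linear_sum; congr (f _); apply/ffunP => k.
    rewrite sum_ffunE (bigD1 k) //= Hia eqxx big1 ?addr0 // => j jk.
    by rewrite Hia eq_sym (negbTE jk).
  by exists m => i Hi x; apply/ffunP => k; rewrite ffunE; apply: Hm.
apply: (@retract_cone X Z a' b'); exists h => i x; rewrite -H /=; congr (_ - _).
rewrite Hb' (reindex _ (onW_bij _ (enum_val_bij I))); apply: eq_bigr => j _ /=.
rewrite Hpb' Hpb Ha' sum_ffunE (bigD1 j) //= Hia' Hia eqxx big1 ?addr0 // => k kj.
by rewrite Hia' Hia eq_sym (negbTE kj).
Qed.

Lemma add_eqP P Q : is_kb P -> is_kb Q ->
  add_eq P Q <-> summand P Q /\ summand Q P.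
Proof.
move=> kP kQ; split=> [H|[PQ QP] X].
  split.
    by have /in_addP[] // := (H P).1 ((in_addP P kP).2 (conj kP (summand_refl P))).
  by have /in_addP[] // := (H Q).2 ((in_addP Q kQ).2 (conj kQ (summand_refl Q))).
rewrite !in_addP //; split=> -[kX sX]; split=> //.
  exact: summand_trans sX PQ.
exact: summand_trans sX QP.
Qed.

Lemma silt_le_summand P P' Q Q' : summand P' P -> summand Q' Q ->
  silt_le Q P -> silt_le Q' P'.
Proof.
move=> HP HQ H n n0; apply: hom_zero_summandl HP _.
by apply: hom_zero_summandr (H n n0); exact: summand_shiftn.
Qed.

(** Two-term on the nose and not only up to homotopy equivalence. Each element of 2-silt has such a
    representative ([silt2_strict]), which amounts to a single map between two projectives. *)
Definition strict_two_term P : Prop :=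
  is_kb P /\ forall i : int, i != -1 -> i != 0 -> zero_mod (P i).

Lemma two_silting_hiso P Q : two_silting P -> hiso P Q -> strict_two_term Q ->
  two_silting Q /\ add_eq P Q.
Proof.
move=> [[kP P0 thP] _] PQ [kQ sQ]; split; last first.
  by apply/add_eqP => //; split; [exact: hiso_summand | exact: summand_hiso].
split; last by exists Q; split=> //; exact: hiso_refl.
split=> // [|X kX C tC CQ].
  exact: silt_le_summand (summand_hiso PQ) (summand_hiso PQ) P0.
by apply: (thP X kX C tC); case: tC => _ H _ _ _; apply: H kP _ CQ; exact: hiso_sym.
Qed.

Lemma silt2_strict (S : silt2 A) : exists2 P, S P & strict_two_term P.
Proof.
have [P sP SP] := silt2P S; have [_ [Q [kQ PQ zQ]]] := sP.
exists Q => //; apply/SP; exact: two_silting_hiso PQ _.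
Qed.

Lemma silt2_mem (S : silt2 A) P : S P -> two_silting P.
Proof. by have [Q _ H] := silt2P S => /H[]. Qed.

Lemma silt2_summand (S : silt2 A) P Q : S P -> S Q -> summand P Q.
Proof.
have [W sW H] := silt2P S => /H[sP aP] /H[sQ aQ].
have k Z : two_silting Z -> is_kb Z by case=> -[].
have [/(add_eqP (k _ sW) (k _ sP)) [_ ?] /(add_eqP (k _ sW) (k _ sQ)) [? _]] := conj aP aQ.
exact: (@summand_trans W).
Qed.

Lemma silt2_leP (S T : silt2 A) P Q : S P -> T Q ->
  silt2_le S T <-> silt_le P Q.
Proof.
move=> SP TQ; split=> [H|H P' Q' SP' TQ']; first exact: H.
exact: silt_le_summand (silt2_summand TQ' TQ) (silt2_summand SP' SP) H.
Qed.

Lemma silt2_of P : two_silting P -> exists S : silt2 A, S P.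
Proof.
move=> sP.
have H : exists2 W, two_silting W &
    forall Q, (two_silting Q /\ add_eq P Q) <-> two_silting Q /\ add_eq W Q.
  by exists P.
by exists (Silt2 H); split.
Qed.

Lemma silt2_eq (S T : silt2 A) P Q : S P -> T Q -> add_eq P Q -> S = T.
Proof.
move=> SP TQ PQ.
have [W sW HW] := silt2P S; have [V sV HV] := silt2P T.
have [sP WP] := (HW _).1 SP; have [sQ VQ] := (HV _).1 TQ.
have E : silt2_class S = silt2_class T.
  apply/funext => Z; apply/propext; rewrite HW HV.
  split=> -[sZ aZ]; split=> // X.
    by rewrite VQ -PQ -WP aZ.
  by rewrite WP PQ -VQ aZ.
case: S {SP HW} E => S pS; case: T {TQ HV} => T pT /= E.
by subst T; congr Silt2; exact: Prop_irrelevance.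
Qed.

End Homotopy.

(** * Two-term complexes *)

Section Families.
Variable A : pzRingType.
Implicit Types M N V W : lmodType A.

Lemma gen_byP M N : gen_by M N <->
  exists (I : finType) (u : I -> {linear M -> N}),
    forall y, exists x : I -> M, y = \sum_i u i (x i).
Proof.
split=> [[n [f sf]]|[I [u Hu]]].
  have /dep_choice[u Hu] : forall j : 'I_n, exists u : {linear M -> N},
      forall x, u x = f [ffun k => if k == j then x else 0].
    move=> j; apply: ex_linear => a x y; rewrite -linearP; congr (f _).
    by apply/ffunP => k; rewrite !ffunE; case: eqP; rewrite ?scaler0 ?addr0.
  exists 'I_n, u => y; have [x <-] := sf y; exists x.
  under eq_bigr do rewrite Hu; rewrite -linear_sum; congr (f _).
  apply/ffunP => k; rewrite sum_ffunE (bigD1 k) //= ffunE eqxx big1 ?addr0 // => j jk.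
  by rewrite ffunE eq_sym (negbTE jk).
have [f Hf] := copies_sum (fun k : 'I_#|I| => u (enum_val k)).
exists #|I|, f => y; have [x ->] := Hu y; exists [ffun k => x (enum_val k)].
rewrite Hf [RHS](reindex _ (onW_bij _ (enum_val_bij I))).
by apply: eq_bigr => k _; rewrite ffunE.
Qed.

Lemma gen_by_surj M M' N (s : {linear M -> M'}) : surj s ->
  gen_by M' N -> gen_by M N.
Proof.
move=> ss /gen_byP[I [u Hu]]; apply/gen_byP; exists I, (fun i => u i \o s) => y.
have [x ->] := Hu y; have /choice[x' Hx'] := fun i => ss (x i).
by exists x'; apply: eq_bigr => i _; rewrite /= Hx'.
Qed.

Section Trace.
Variables (V M : lmodType A) (D : {linear V -> M} -> Prop).

Definition trace (m : M) : Prop :=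
  exists (I : finType) (u : I -> {linear V -> M}) (x : I -> V),
    (forall i, D (u i)) /\ m = \sum_i u i (x i).

(** Finitely many elements share one family of maps: take the disjoint union of the families, with
    zero entries outside the own block. This lets one sum of copies of V cover all generators of a
    module. *)
Lemma trace_sum n (m : 'I_n -> M) : (forall j, trace (m j)) ->
  exists (I : finType) (u : I -> {linear V -> M}),
    (forall i, D (u i)) /\ forall j, exists x : I -> V, m j = \sum_i u i (x i).
Proof.
move=> /dep_choice[k] /dep_choice[u] /dep_choice[x Hx].
exists {j : 'I_n & k j}, (fun p => u (tag p) (tagged p)); split.
  by move=> p; apply: (Hx _).1.
move=> j; exists (fun p => if tag p == j then x (tag p) (tagged p) else 0).
rewrite -(sig_big_dep xpredT (fun _ => xpredT) (fun i l => u i l (if i == j then x i l else 0))) /=.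
rewrite (bigD1 j) //= [X in _ + X]big1 ?addr0 => [|i ij].
  by rewrite (Hx j).2; apply: eq_bigr => l _; rewrite eqxx.
by apply: big1 => l _; rewrite (negbTE ij) linear0.
Qed.

Lemma submodP_trace : submodP trace.
Proof.
split.
  exists void, (fun i => \0), (fun=> 0); split; first by case.
  by rewrite big_pred0 // => -[].
move=> a _ _ [I [u [x [Du ->]]]] [J [v [y [Dv ->]]]].
exists (I + J)%type.
exists (fun i => match i with inl j => u j | inr j => v j end).
exists (fun i => match i with inl j => a *: x j | inr j => y j end).
split=> [[]//|]; rewrite big_sumType /= scaler_sumr; congr (_ + _).
by apply: eq_bigr => k _; rewrite linearZ.
Qed.

End Trace.

(** A section s of [p] exhibits the kernel as the image of V under x - s(p x). *)
Lemma fin_gen_kernel V W (p : {linear V -> W}) : surj p -> projective W ->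
  fin_gen V -> exists (K : lmodType A) (i : {linear K -> V}),
    [/\ injective i, forall x, p x = 0 <-> exists y, i y = x & fin_gen K].
Proof.
move=> sp pW fV; have [K [i [ii Hi]]] := sub_ex (submodP_ker p).
have [s Hs] := pW _ _ p idfun sp.
have [x|e He] := @factor_inj _ K V V i (idfun \- (s \o p)) ii.
  by apply/Hi; rewrite linearB Hs subrr.
exists K, i; split=> //; apply: (fin_gen_surj (f := e)) fV => y.
have py : p (i y) = 0 by apply/Hi; exists y.
by exists (i y); apply: ii; rewrite He /= py linear0 subr0.
Qed.

End Families.

Section TwoTerm.
Variable A : pzRingType.
Implicit Types (P Q X Y : complex A) (M N : lmodType A).

Lemma H0_ex P : exists (Z : lmodType A) (i : {linear Z -> P (succz (-1))})
    (pi : {linear Z -> H0 P}),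
  [/\ injective i, forall x, cdiff P (succz (-1)) x = 0 <-> exists z, i z = x,
      surj pi & forall z, pi z = 0 <-> exists y, cdiff P (-1) y = i z].
Proof.
have [i Ei] := @ex_linear _ (sub_mod (@cycles A P)) (P (succz (-1))) val (fun a x y => erefl _).
have L : linear (quot_proj (@boundaries A P)).
  move=> a x y; rewrite quot_projD; congr (_ + _).
  by rewrite -quot_scaleE.
have [pi Epi] := ex_linear L.
exists (sub_mod (@cycles A P)), i, pi; split.
- by move=> x y; rewrite !Ei => /val_inj.
- move=> x; split=> [Ex|[z <-]].
    have Zx : x \in @cycles A P by rewrite unfold_in Ex.
    by exists (exist _ x Zx : sub_mod (@cycles A P)); rewrite Ei.
  by rewrite Ei; apply/eqP; exact: (valP z).
- by move=> y; have [x <-] := quot_projP y; exists x; rewrite Epi.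
move=> z; have {}Epi y : pi y = quot_proj (@boundaries A P) y by exact: Epi.
have <- : pi 0 = 0 by exact: linear0.
rewrite !Epi quot_proj_eq subr0 unfold_in Ei; split=> [/asboolP[y ->]|[y <-]].
  by exists y.
by apply/asboolP; exists y.
Qed.

(** Surjections in both directions are enough later on, because [gen_by] passes along
    surjections. *)
Lemma H0_surj P Q : hiso P Q -> exists s : {linear H0 P -> H0 Q}, surj s.
Proof.
move=> [f [g [_ [h Hh]]]].
have [Z [i [pi [ii ci si ki]]]] := H0_ex P.
have [Z' [i' [pi' [ii' ci' si' ki']]]] := H0_ex Q.
have [z|fz Hfz] := @factor_inj _ Z' (Q (succz (-1))) Z i' (f _ \o i) ii'.
  by apply/ci'; rewrite /= -cmapE (ci _).2 ?linear0 //; exists z.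
have [z /ki[y Ey]|s Hs] := @factor_surj _ Z _ _ pi (pi' \o fz) si.
  by apply/ki'; exists (f _ y); rewrite Hfz /= -Ey cmapE.
exists s => y; have [z' <-] := si' y.
have [z Ez] : exists z, i z = g _ (i' z').
  by apply/ci; rewrite -cmapE (ci' _).2 ?linear0 //; exists z'.
exists (pi z); rewrite Hs /=; apply/eqP; rewrite -subr_eq0 -linearB.
apply/eqP/ki'; exists (h (-1) (i' z')).
rewrite linearB Hfz /= Ez; have := Hh (-1) (i' z'); rewrite /= => ->.
by rewrite (ci' _).2 ?linear0 ?addr0 //; exists z'.
Qed.

(* For a two-term P, Hom(P, M[1]) = 0. *)
Definition ext_zero P M : Prop :=
  forall f : {linear P (-1) -> M}, exists g : {linear P (succz (-1)) -> M},
    forall x, g (cdiff P (-1) x) = f x.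

(* For a two-term P, M is a quotient of a finite sum of copies of H^0(P). *)
Definition quo P M : Prop :=
  exists (I : finType) (u : I -> {linear P (succz (-1)) -> M}),
    (forall i x, u i (cdiff P (-1) x) = 0) /\
    forall y, exists x : I -> P (succz (-1)), y = \sum_i u i (x i).

Lemma strict_kb P i : strict_two_term P -> fg_projective (P i).
Proof. by case=> -[]. Qed.

Lemma H0_strict P : strict_two_term P ->
  exists pi : {linear P (succz (-1)) -> H0 P},
    surj pi /\ forall x, pi x = 0 <-> exists y, cdiff P (-1) y = x.
Proof.
move=> [_ zP]; have [Z [i [pi [ii ci si ki]]]] := H0_ex P.
have c0 x : cdiff P (succz (-1)) x = 0.
  by apply: (zP (succz (succz (-1)))).
have [x|j Hj] := @factor_inj _ Z _ (P (succz (-1))) i idfun ii.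
  exact/ci/c0.
exists (pi \o j); split=> [y|x] /=; last by rewrite ki Hj.
by have [z <-] := si y; exists (i z) => /=; congr (pi _); apply: ii; rewrite Hj.
Qed.

Lemma gen_H0 P M : strict_two_term P -> gen_by (H0 P) M <-> quo P M.
Proof.
move=> /H0_strict[pi [spi kpi]]; rewrite gen_byP; split=> -[I [u]].
  move=> Hu; exists I, (fun i => u i \o pi); split=> [i x|y] /=.
    by rewrite (kpi _).2 ?linear0 //; exists x.
  have [x ->] := Hu y; have /choice[x' Hx'] := fun i => spi (x i).
  by exists x'; apply: eq_bigr => i _; rewrite Hx'.
move=> [u0 Hu].
have /dep_choice[v Hv] : forall i, exists v : {linear H0 P -> M}, forall x, v (pi x) = u i x.
  move=> i; apply: factor_surj => // x /kpi[y <-]; exact: u0.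
exists I, v => y; have [x ->] := Hu y; exists (fun i => pi (x i)).
by apply: eq_bigr => i _; rewrite Hv.
Qed.

Lemma quo_fin_gen P M : strict_two_term P -> quo P M -> fin_gen M.
Proof.
move=> sP [I [u [_ Hu]]]; have [f Hf] := copies_sum u.
apply: (fin_gen_surj (f := f)); last exact: fin_gen_copies (strict_kb _ sP).1.
move=> y; have [x ->] := Hu y; exists [ffun i => x i]; rewrite Hf.
by apply: eq_bigr => i _; rewrite ffunE.
Qed.

Lemma quo_surj P M N (f : {linear M -> N}) : surj f -> quo P M -> quo P N.
Proof.
move=> sf [I [u [u0 Hu]]]; exists I, (fun i => f \o u i); split=> [i x|y] /=.
  by rewrite u0 linear0.
by have [z <-] := sf y; have [x ->] := Hu z; exists x; rewrite linear_sum.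
Qed.

Lemma ext_zero_surj P M N (f : {linear M -> N}) : projective (P (-1)) -> surj f ->
  ext_zero P M -> ext_zero P N.
Proof.
move=> pP sf H g; have [h Hh] := pP _ _ f g sf; have [k Hk] := H h.
by exists (f \o k) => x /=; rewrite Hk Hh.
Qed.

Lemma ext_zero_ext P (X Y Z : lmodType A) (f : {linear X -> Y}) (g : {linear Y -> Z}) :
  projective (P (succz (-1))) ->
  short_exact f g -> ext_zero P X -> ext_zero P Z -> ext_zero P Y.
Proof.
move=> pP [fi gs fg] HX HZ u; have [v Hv] := HZ (g \o u).
have [w Hw] := pP _ _ g v gs.
have [x|t Ht] := @factor_inj _ X Y _ f (u \- (w \o cdiff P (-1))) fi.
  by apply/fg; rewrite /= linearB /= Hw Hv subrr.
have [s Hs] := HX t; exists (w \+ (f \o s)) => x /=.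
by rewrite Hs Ht /= addrC subrK.
Qed.

Lemma strict_eq0 P i (x : P i) : strict_two_term P -> i != -1 -> i != 0 -> x = 0.
Proof. by move=> [_ H] i1 i0; apply: H. Qed.

Lemma strict_eq P i (x y : P i) : strict_two_term P -> i != -1 -> i != 0 -> x = y.
Proof. by move=> sP i1 i0; rewrite (strict_eq0 x) // (strict_eq0 y). Qed.

(** For degree reasons only Hom(P, Q[1]) can be nonzero. A chain map P -> Q[1] is any linear map
    P^-1 -> Q^0, and a null-homotopy is a pair (s, t). *)
Lemma silt_le_strict P Q : strict_two_term P -> strict_two_term Q ->
  silt_le Q P <-> forall f : {linear P (-1) -> Q (succz (-1))},
    exists (s : {linear P (succz (-1)) -> Q (succz (-1))}) (t : {linear P (-1) -> Q (-1)}),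
      forall x, f x = s (cdiff P (-1) x) + cdiff Q (-1) (t x).
Proof.
move=> sP sQ; split=> [H f|H].
  (* [Negz 0] is the degree -1; matching on the degree avoids every transport. *)
  pose c i : {linear P i -> shift Q i} :=
    match i with Negz 0 => f | _ => \0 end.
  have E i x : c (succz i) (cdiff P i x) = cdiff (shift Q) i (c i x).
    case: i x => [n|[|[|n]]] x /=.
    - by apply: (@strict_eq Q (succz (succz n))); rewrite // /succz; lia.
    - by apply: (@strict_eq Q (succz (succz (-1)))).
    - by rewrite !linear0 (strict_eq0 x) ?linear0.
    - by rewrite !linear0.
  have [h Hh] := H 1%N isT (ChainMap E).
  (* The differential of [shift Q] is negated, whence the sign. *)
  exists (h (-1)), (\- h (-2)) => x.
  by have := Hh (-2) x; rewrite /= subr0 linearN addrC.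
case=> [//|[|n]] _ f; last first.
  exists (fun i => \0) => i x; rewrite subr0 !linear0 addr0.
  have zs m j (y : shiftn m Q j) : j + m%:Z != -1 -> j + m%:Z != 0 -> y = 0.
    elim: m j y => [|m IH] j y j1 j0; first by apply: (strict_eq0 _ sQ); lia.
    by apply: (IH (succz j)); rewrite /succz; lia.
  case: (boolP (succz i == -1)) => [/eqP E|i1].
    by apply: zs; lia.
  case: (boolP (succz i == 0)) => [/eqP E|i0].
    by apply: zs; lia.
  by rewrite (strict_eq0 x sP i1 i0) linear0.
have [s [t Hst]] := H (f (-1)).
pose h i : {linear P (succz i) -> shift Q i} :=
    match i with Negz 0 => s | Negz 1 => \- t | _ => \0 end.
exists h => i x; rewrite subr0.
case: i x => [n|[|[|n]]] x.
- by rewrite (strict_eq0 x sP) ?linear0 ?addr0 //; rewrite /succz; lia.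
- by apply: (@strict_eq Q (succz (succz (-1)))) sQ _ _.
- by rewrite [LHS]Hst addrC /= linearN opprK.
- by rewrite (strict_eq0 x sP) ?linear0 ?addr0 //; rewrite /succz; lia.
Qed.

(** H^0(Q) sees Q^0 modulo the image of the differential. The error left by lifting [g] to Q^0 lies
    in that image, and projectivity of P^-1 turns it into [t]. *)
Lemma ext_zero_silt_le P Q : strict_two_term P -> strict_two_term Q ->
  ext_zero P (H0 Q) -> silt_le Q P.
Proof.
move=> sP sQ H; apply/silt_le_strict => // f.
have [pi [spi kpi]] := H0_strict sQ.
have [g Hg] := H (pi \o f).
have [s Hs] := (strict_kb (succz (-1)) sP).2 _ _ pi g spi.
have [x|t Ht] := @lift_proj _ _ _ _ (cdiff Q (-1)) (f \- (s \o cdiff P (-1))) (strict_kb (-1) sP).2.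
  by apply/kpi; rewrite /= linearB Hs Hg subrr.
by exists s, t => x; rewrite Ht /= addrC subrK.
Qed.

(** A map P^-1 -> M lifts to copies of Q^0; there Hom(P, Q[1]) = 0 writes it as s d + d t, and the
    maps [u] kill the second term. *)
Lemma quo_ext_zero P Q M : strict_two_term P -> strict_two_term Q ->
  silt_le Q P -> quo Q M -> ext_zero P M.
Proof.
move=> sP sQ /(silt_le_strict sP sQ) H [I [u [u0 Hu]]] f.
have [g Hg] := copies_sum u.
have [x|f' Hf'] := @lift_proj _ _ _ _ g f (strict_kb (-1) sP).2.
  have [y ->] := Hu (f x); exists [ffun i => y i]; rewrite Hg.
  by apply: eq_bigr => i _; rewrite ffunE.
have /dep_choice[fi Hfi] : forall i, exists fi : {linear P (-1) -> Q (succz (-1))},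
    forall x, fi x = f' x i.
  by move=> i; apply: ex_linear => a x y; rewrite linearP !ffunE.
have /dep_choice[s] := fun i => H (fi i).
move=> /dep_choice[t Hst].
have [k Hk] := lin_sum (fun i => u i \o s i).
exists k => x; rewrite Hk -Hf' Hg; apply: eq_bigr => i _.
by rewrite -Hfi Hst linearD u0 addr0.
Qed.

Lemma quo_H0 P : strict_two_term P -> quo P (H0 P).
Proof.
move=> /H0_strict[pi [spi kpi]]; exists 'I_1, (fun=> pi); split=> [_ x|y].
  by apply/kpi; exists x.
by have [x <-] := spi y; exists (fun=> x); rewrite big_ord1.
Qed.

(** * Silting complexes detect the zero module *)

Section Exact.
Variable N : lmodType A.

(* Hom(X, N[i]) = 0 for all i. *)
Definition hom_exact X : Prop :=
  forall i (f : {linear X (succz i) -> N}), (forall x, f (cdiff X i x) = 0) ->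
    exists g : {linear X (succz (succz i)) -> N},
      forall x, g (cdiff X (succz i) x) = f x.

Lemma hom_exact_summand X Y : summand X Y -> hom_exact Y -> hom_exact X.
Proof.
move=> [I [a [b [h Hh]]]] H i f f0.
have /dep_choice[g Hg] : forall j, exists g : {linear Y (succz (succz i)) -> N},
    forall y, g (cdiff Y (succz i) y) = f (b j _ y).
  by move=> j; apply: (H i (f \o b j _)) => y /=; rewrite cmapE f0.
have [k Hk] := lin_sum (fun j => g j \o a j _).
exists (k \- (f \o h _)) => x /=; rewrite Hk.
have /(congr1 f) := Hh i x; rewrite linearB linearD f0 add0r => <-.
rewrite linear_sum (eq_bigr (fun j => f (b j _ (a j _ x)))) => [|j _]; last first.
  by rewrite /= cmapE Hg.
by zmodule.
Qed.

(** Thickness lets the vanishing spread from a silting complex to all of K^b(proj A). The cone case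
    is a long exact sequence done by hand: a cocycle on the cone is solved on [Y], then the
    remaining error on [X]. *)
Lemma hom_exact_thick : is_thick (fun X => is_kb X /\ hom_exact X).
Proof.
split=> [X []//|X Y kY XY [kX HX]|X kX|X Y f [kX HX] [kY HY]|X Y kX kY [_ H]].
- by split=> //; apply: hom_exact_summand HX; exact: summand_hiso.
- split=> -[_ H]; split=> //; first exact: is_kb_shift.
    move=> i f f0; have [x|g Hg] := H (succz i) f.
      by apply/eqP; rewrite -oppr_eq0 -linearN; apply/eqP/f0.
    by exists (\- g) => x; rewrite /= -Hg linearN opprK.
  apply: succz_case => i f f0; have [x|g Hg] := H i f.
    by rewrite /= linearN f0 oppr0.
  by exists (\- g) => x; rewrite /= -Hg /= /shift_diff_fun linearN.
- split=> [|i u u0]; first exact: is_kb_cone.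
  have [uX HuX] : exists uX : {linear X (succz (succz i)) -> N}, forall x, uX x = u (x, 0).
    apply: ex_linear => a x y; rewrite -linearP; congr (u (_, _)).
    by rewrite /= scaler0 addr0.
  have [uY HuY] : exists uY : {linear Y (succz i) -> N}, forall y, uY y = u (0, y).
    apply: ex_linear => a x y; rewrite -linearP; congr (u (_, _)).
    by rewrite /= scaler0 addr0.
  have uE x y : u (x, y) = uX x + uY y.
    by rewrite HuX HuY -linearD; congr (u (_, _)); rewrite /= ?addr0 ?add0r.
  have [y|v Hv] := HY i uY.
    have := u0 (0, y); rewrite /= /cone_diff_fun /= uE !linear0 ?oppr0 ?linear0.
    by rewrite !add0r.
  have [x|w Hw] := HX (succz i) (uX \- (v \o f _)).
    have := u0 (x, 0); rewrite /= /cone_diff_fun /= uE linearN !linear0 addr0.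
    by rewrite cmapE Hv => E; apply/eqP; rewrite -oppr_eq0 opprB addrC; apply/eqP.
  have /ex_linear[k Hk] : linear (fun z : cone f (succz (succz i)) => - w z.1 + v z.2).
    by move=> a y z; rewrite !linearP /= !scalerDr ?scalerN; zmodule.
  exists k => -[x y]; rewrite Hk /= linearN linearD opprK Hw Hv /= uE.
  by zmodule.
- by split=> //; apply: hom_exact_summand H; exact: summand_dsum.
Qed.

End Exact.

(** A in degree 0: the index type ['I_(i == 0)] has one element there and none elsewhere, so all
    degrees are free modules of the same form. *)
Definition stalk : complex A :=
  @Complex A (fun i => {ffun 'I_(i == 0) -> A^o}) (fun i => \0)
    (fun i x => erefl).

Lemma is_kb_stalk : is_kb stalk.
Proof.
split=> [i|]; first exact: fg_projective_free.
exists 0 => i i0 x; apply/ffunP => -[k lk]; exfalso; move: lk.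
by have /negbTE-> : i != 0 by lia.
Qed.

Lemma hom_exact_zero P N : is_silting P -> hom_exact N P -> zero_mod N.
Proof.
move=> [kP _ gP] NP x.
have [_ H] := gP _ is_kb_stalk _ (hom_exact_thick N) (conj kP NP).
have [f Hf] := @free_ext _ 'I_1 N (fun=> x).
(* An element of N is a map from the degree 0 term A; it extends along a zero differential, hence is
   zero. *)
have [y|g Hg] := H (-1) f; first by rewrite linear0.
have := Hg [ffun=> (1 : A^o)]; rewrite /= linear0 Hf big_ord1 ffunE.
by move=> E; rewrite [RHS]E; symmetry; exact: scale1r.
Qed.

(* The largest submodule t generated by H^0(P) satisfies Hom(P, t[1]) = 0, so
   Hom(P, (M/t)[i]) = 0 for all i, and M/t = 0 since P generates A. *)
Lemma ext_zero_quo P M : strict_two_term P -> is_silting P -> fin_gen M ->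
  ext_zero P M -> quo P M.
Proof.
move=> sP iP fM PM.
have pP i : projective (P i) by case: (strict_kb i sP).
pose D (u : {linear P (succz (-1)) -> M}) := forall y, u (cdiff P (-1) y) = 0.
have [T [i [ii Hi]]] := sub_ex (submodP_trace D).
have [N [rho [srho krho]]] := quot_ex (submodP_trace D).
(* Finitely many maps P^0 -> M cover the image of f, so f lifts to copies of P^0. There Hom(P, P[1])
   = 0 extends it up to boundaries, which the maps in [D] kill. *)
have PT : ext_zero P T.
  move=> f; have [n [b Hb]] := (strict_kb (-1) sP).1.
  have [j|I [u [Du Hu]]] := @trace_sum _ _ _ D n (fun j => i (f (b j))).
    by apply/Hi; exists (f (b j)).
  have [g Hg] := copies_sum u.
  have [x|f' Hf'] := @lift_proj _ _ _ _ g (i \o f) (pP (-1)).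
    have /choice[y Hy] := Hu; have [c ->] := Hb x.
    exists (\sum_k c k *: [ffun l => y k l]); rewrite /= !linear_sum.
    apply: eq_bigr => k _; rewrite !linearZ Hg Hy; congr (_ *: _).
    by apply: eq_bigr => l _; rewrite ffunE.
  have /dep_choice[fl Hfl] : forall l, exists fl : {linear P (-1) -> P (succz (-1))},
      forall x, fl x = f' x l.
    by move=> l; apply: ex_linear => a x y; rewrite linearP !ffunE.
  have /silt_le_strict PP : silt_le P P by case: iP.
  have /dep_choice[s] := fun l => PP sP sP (fl l); move=> /dep_choice[t Hst].
  have [k Hk] := lin_sum (fun l => u l \o s l).
  have [x|k' Hk'] := @factor_inj _ T _ _ i k ii.
    by apply/Hi; exists I, u, (fun l => s l x); rewrite Hk.
  exists k' => x; apply: ii; rewrite Hk' Hk; have /= <- := Hf' x; rewrite Hg.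
  by apply: eq_bigr => l _; rewrite -Hfl Hst linearD Du addr0.
(* Lift [u] to P^0 -> M. By [PT], subtracting a map into the trace makes the lift kill boundaries;
   it then lies in [D], so its values are in the trace. *)
have hom0 (u : {linear P (succz (-1)) -> N}) :
    (forall y, u (cdiff P (-1) y) = 0) -> forall x, u x = 0.
  move=> u0; have [v Hv] := pP _ _ _ rho u srho.
  have [x|f Hf] := @factor_inj _ T _ _ i (v \o cdiff P (-1)) ii.
    by apply/Hi/krho; rewrite /= Hv.
  have [g Hg] := PT f.
  have Dvg : D (v \- (i \o g)) by move=> y; rewrite /= Hg Hf subrr.
  move=> x; rewrite -Hv; apply/krho.
  rewrite -[v x](subrK (i (g x))); apply: submodPD; first exact: submodP_trace.
    by exists 'I_1, (fun=> v \- (i \o g)), (fun=> x); rewrite big_ord1.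
  by apply/Hi; exists (g x).
have N0 : zero_mod N.
  apply: hom_exact_zero iP _.
  move=> j u u0; case: j u u0 => [j|[|[|j]]] u u0.
  - by exists \0 => x; rewrite (strict_eq0 x) ?linear0 //; rewrite /succz; lia.
  - by exists \0 => x; rewrite [RHS]hom0.
  - exact: (ext_zero_surj (pP _) srho PM).
  - by exists \0 => x; rewrite (strict_eq0 x) ?linear0 //; rewrite /succz; lia.
have [n [m Hm]] := fM.
have [j|I [u [Du Hu]]] := @trace_sum _ _ _ D n m; first exact/krho.
exists I, u; split=> // y; have [c ->] := Hm y; have /choice[x Hx] := Hu.
exists (fun l => \sum_k c k *: x k l).
under [RHS]eq_bigr do rewrite linear_sum.
rewrite exchange_big /=; apply: eq_bigr => k _; rewrite Hx scaler_sumr.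
by apply: eq_bigr => l _; rewrite linearZ.
Qed.

(** * Right approximations between two-term complexes *)

Lemma strict_cm P Q (g1 : {linear P (-1) -> Q (-1)})
    (g0 : {linear P (succz (-1)) -> Q (succz (-1))}) :
  strict_two_term P -> strict_two_term Q ->
  (forall x, g0 (cdiff P (-1) x) = cdiff Q (-1) (g1 x)) ->
  exists c : chain_map P Q, (forall x, c (-1) x = g1 x) /\ (forall x, c (succz (-1)) x = g0 x).
Proof.
move=> sP sQ H.
pose c i : {linear P i -> Q i} :=
  match i with Negz 0 => g1 | Posz 0 => g0 | _ => \0 end.
have E i x : c (succz i) (cdiff P i x) = cdiff Q i (c i x).
  case: i x => [n|[|[|n]]] x.
  - by apply: strict_eq sQ _ _; rewrite /succz; lia.
  - exact: H.
  - by rewrite (strict_eq0 x) // !linear0.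
  - by rewrite (strict_eq0 x) // !linear0.
by exists (ChainMap E).
Qed.

(* [f] is a right add P-approximation of Q in the category of two-term complexes. *)
Definition approximates P Q (I : finType) (f1 : I -> {linear P (-1) -> Q (-1)})
    (f0 : I -> {linear P (succz (-1)) -> Q (succz (-1))}) : Prop :=
  (forall i x, f0 i (cdiff P (-1) x) = cdiff Q (-1) (f1 i x)) /\
  forall (u1 : {linear P (-1) -> Q (-1)}) (u0 : {linear P (succz (-1)) -> Q (succz (-1))}),
    (forall x, u0 (cdiff P (-1) x) = cdiff Q (-1) (u1 x)) ->
    exists (t1 : I -> {linear P (-1) -> P (-1)})
      (t0 : I -> {linear P (succz (-1)) -> P (succz (-1))}),
    [/\ forall i x, t0 i (cdiff P (-1) x) = cdiff P (-1) (t1 i x),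
        forall x, u1 x = \sum_i f1 i (t1 i x) &
        forall x, u0 x = \sum_i f0 i (t0 i x)].

(* If P <= Q <= P, complete a right add P-approximation of Q to a triangle
   Q' -> P^n -> Q -> Q'[1]. Then Hom(P, Q'[1]) = 0, so Hom(Q, Q'[1]) = 0 and Q is
   a direct summand of P^n. Below K and N are the degree 0 term and H^0 of Q'. *)
Lemma approx_summand P Q (I : finType) (f1 : I -> {linear P (-1) -> Q (-1)})
    (f0 : I -> {linear P (succz (-1)) -> Q (succz (-1))}) :
  strict_two_term P -> strict_two_term Q -> is_silting P -> is_silting Q ->
  silt_le P Q -> silt_le Q P -> approximates f1 f0 -> summand Q P.
Proof.
move=> sP sQ iP iQ PQ QP [fc fa].
have fgP i := strict_kb i sP; have fgQ i := strict_kb i sQ.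
set P0 := P (succz (-1)); set Q0 := Q (succz (-1)).
pose V : lmodType A := ({ffun I -> P0} * Q (-1))%type.
have [p Hp] : exists p : {linear V -> Q0},
    forall v, p v = \sum_i f0 i (v.1 i) + cdiff Q (-1) v.2.
  apply: ex_linear => a v w; rewrite scalerDr addrACA; congr (_ + _); last by rewrite linearP.
  rewrite scaler_sumr -big_split /=; apply: eq_bigr => i _.
  by rewrite !ffunE linearP.
(* Since Q <= P, H^0(Q) is a quotient of copies of H^0(P). Each map P^0 -> H^0(Q) that occurs lifts
   to a chain map P -> Q, hence passes through the approximation; what is left of [y] is a
   boundary. *)
have sp : surj p.
  move=> y.
  have [pi [spi kpi]] := H0_strict sQ.
  have [J [u [u0 Hu]]] : quo P (H0 Q).
    apply: ext_zero_quo => //; first exact: quo_fin_gen sQ (quo_H0 sQ).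
    by apply: quo_ext_zero QP (quo_H0 sQ).
  have [x Ex] := Hu (pi y).
  have im0 j z : exists v w, pi w = 0 /\ u j z = pi (p v + w).
    have [g0 Hg0] := (fgP (succz (-1))).2 _ _ pi (u j) spi.
    have [t|g1 Hg1] := @lift_proj _ _ _ _ (cdiff Q (-1)) (g0 \o cdiff P (-1)) (fgP (-1)).2.
      by apply/kpi; rewrite /= Hg0 u0.
    have [t1 [t0 [_ _ Et]]] := fa g1 g0 (fun t => esym (Hg1 t)).
    exists ([ffun i => t0 i z], 0), 0; rewrite linear0; split=> //.
    rewrite addr0 Hp linear0 addr0 -Hg0 Et; congr (pi _).
    by apply: eq_bigr => i _; rewrite ffunE.
  have /choice[v /choice[w Hvw]] := fun j => im0 j (x j).
  have /kpi[t Et] : pi (y - p (\sum_j v j)) = 0.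
    rewrite linearB Ex [p _]linear_sum [X in _ - X]linear_sum -sumrB big1 // => j _.
    have [w0 ->] := Hvw j.
    by rewrite linearD w0 addr0 subrr.
  exists (\sum_j v j + (0, t)); rewrite linearD [p (0, t)]Hp /= Et.
  rewrite [X in _ + (X + _)]big1 ?add0r => [|i _]; last by rewrite ffunE linear0.
  by rewrite addrC subrK.
have pQ0 : projective Q0 := (fgQ (succz (-1))).2.
have fV : fin_gen V.
  apply: fin_gen_prod; last exact: (fgQ (-1)).1.
  exact: fin_gen_copies (fgP (succz (-1))).1.
have [K [k [ki Hk fK]]] := fin_gen_kernel sp pQ0 fV.
pose W : lmodType A := {ffun I -> P (-1)}.
(* The sign makes [p] vanish on [j], so that Q' is the complex W -> K in degrees -1 and 0. *)
have [j Hj] : exists j : {linear W -> V}, forall z,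
    j z = ([ffun i => cdiff P (-1) (z i)], - \sum_i f1 i (z i)).
  apply: ex_linear => a z w; congr (_, _).
    by apply/ffunP => i; rewrite !ffunE linearP.
  rewrite /=.
  have -> : \sum_i f1 i ((a *: z + w) i) = a *: \sum_i f1 i (z i) + \sum_i f1 i (w i).
    rewrite scaler_sumr -big_split /=; apply: eq_bigr => i _.
    by rewrite !ffunE linearP.
  by rewrite opprD /= ?scalerN.
have [z|iota Hiota] := @factor_inj _ K V W k j ki.
  apply/Hk; rewrite Hj Hp /= linearN linear_sum -sumrB big1 // => i _.
  by rewrite ffunE fc subrr.
have [N [rho [srho krho]]] := quot_ex (submodP_image iota).
(* The components of a map P^-1 -> K in copies of P^0 have the form s d + d t by Hom(P, P[1]) = 0.
   The remaining pair (u1, u0) is a chain map P -> Q and factors through the approximation; the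
   factors t0 correct s to a map into K. *)
have PN : ext_zero P N.
  move=> f; have [g Hg] := (fgP (-1)).2 _ _ rho f srho.
  have /dep_choice[gi Hgi] : forall i, exists gi : {linear P (-1) -> P0},
      forall x, gi x = (k (g x)).1 i.
    by move=> i; apply: ex_linear => a x y; rewrite !linearP /= !ffunE.
  have /silt_le_strict PP : silt_le P P by case: iP.
  have /dep_choice[s] := fun i => PP sP sP (gi i); move=> /dep_choice[t Hst].
  have [u0 Hu0] := lin_sum (fun i => f0 i \o s i).
  have /ex_linear[u1 Hu1] : linear (fun x => - (k (g x)).2 - \sum_i f1 i (t i x)).
    move=> a x y; rewrite !linearP /=.
    have -> : \sum_i f1 i (t i (a *: x + y)) =
        a *: \sum_i f1 i (t i x) + \sum_i f1 i (t i y).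
      by rewrite scaler_sumr -big_split; apply: eq_bigr => i _; rewrite !linearP.
    by rewrite scalerDr ?scalerN; zmodule.
  have [x|t1 [t0 [tc E1 E0]]] := fa u1 u0.
    have : p (k (g x)) = 0 by apply/Hk; exists (g x).
    rewrite Hp Hu0 Hu1 linearB linearN linear_sum => /eqP.
    rewrite addrC addr_eq0 => /eqP->; rewrite opprK -sumrB.
    by apply: eq_bigr => i _; rewrite -Hgi Hst linearD /= -fc addrK.
  have /ex_linear[th Hth] : linear (fun x : P0 => ([ffun i => s i x - t0 i x], 0) : V).
    move=> a x y; congr (_, _); last by rewrite /= scaler0 addr0.
    by apply/ffunP => i; rewrite !ffunE !linearP /= scalerDr ?scalerN; zmodule.
  have [x|th' Hth'] := @factor_inj _ K V _ k th ki.
    apply/Hk; rewrite Hp Hth /= linear0 addr0.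
    under eq_bigr do rewrite ffunE linearB.
    by rewrite sumrB -E0 Hu0 subrr.
  exists (rho \o th') => x /=; rewrite -Hg; apply/eqP; rewrite -subr_eq0 -linearB.
  apply/eqP/krho; exists (- [ffun i => t i x + t1 i x]); apply: ki.
  rewrite !linearN linearB Hiota Hth' Hj Hth [RHS](_ : _ = 
    ([ffun i => - cdiff P (-1) (t i x + t1 i x)], \sum_i f1 i (t i x + t1 i x))).
    by congr (_, _); rewrite /= ?opprK; [apply/ffunP => i|apply: eq_bigr => i _]; rewrite !ffunE.
  rewrite [k (g x)]surjective_pairing; congr (_, _); rewrite /=.
    apply/ffunP => i; rewrite !ffunE -Hgi Hst tc; linx.
    by zmodule.
  have := E1 x; rewrite Hu1 => E.
  under eq_bigr do rewrite linearD.
  by rewrite big_split /= -E; zmodule.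
have QN : ext_zero Q N.
  apply: quo_ext_zero PQ _ => //; apply: ext_zero_quo => //.
  exact: fin_gen_surj srho fK.
have [sec Hsec] := pQ0 _ _ p idfun sp.
(* This represents the connecting map Q -> Q'[1] of the triangle, which is null by [QN]. *)
have /ex_linear[ka Hka] : linear (fun y : Q (-1) => sec (cdiff Q (-1) y) - (0, y) : V).
  move=> a x y; rewrite !linearP /=.
  have -> : (0, a *: x + y) = a *: (0, x) + (0, y) :> V.
    by congr (_, _); rewrite /= scaler0 addr0.
  by rewrite scalerDr ?scalerN; zmodule.
have [y|ka' Hka'] := @factor_inj _ K V _ k ka ki.
  apply/Hk; rewrite Hka linearB Hsec [p (0, y)]Hp /= big1 ?add0r ?subrr // => i _.
  by rewrite ffunE linear0.
have [th Hth] := QN (rho \o ka').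
have [th' Hth'] := pQ0 _ _ rho th srho.
have [y|s1 Hs1] := @lift_proj _ _ _ _ iota (ka' \- (th' \o cdiff Q (-1))) (fgQ (-1)).2.
  by apply/krho; rewrite /= linearB Hth' Hth subrr.
have Ks (y : Q (-1)) : sec (cdiff Q (-1) y) - (0, y) - k (th' (cdiff Q (-1) y)) = j (s1 y).
  by rewrite -Hiota Hs1 linearB Hka' Hka.
have /dep_choice[a1 Ha1] : forall i, exists a1 : {linear Q (-1) -> P (-1)}, forall y, a1 y = s1 y i.
  by move=> i; apply: ex_linear => a x y; rewrite linearP !ffunE.
(* The section of [p], corrected by the null-homotopy of the connecting map: its first component
   gives Q^0 -> copies of P^0, and minus its second one is the homotopy. *)
pose D : {linear Q0 -> V} := sec \- (k \o th').
have /dep_choice[a0 Ha0] : forall i, exists a0 : {linear Q0 -> P0},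
    forall y, a0 y = (D y).1 i.
  by move=> i; apply: ex_linear => a x y; rewrite linearP !ffunE.
have [h Hh] : exists h : {linear Q0 -> Q (-1)}, forall y, h y = - (D y).2.
  by apply: ex_linear => a x y; rewrite linearP opprD scalerN.
have /dep_choice[a Ha] : forall i, exists a : chain_map Q P,
    (forall x, a (-1) x = a1 i x) /\ (forall x, a (succz (-1)) x = a0 i x).
  move=> i; apply: strict_cm => // x; rewrite Ha0 Ha1.
  have /(congr1 fst)/ffunP/(_ i) := Ks x; rewrite Hj /= !ffunE => <-.
  by rewrite /=; zmodule.
have /dep_choice[b Hb] : forall i, exists b : chain_map P Q,
    (forall x, b (-1) x = f1 i x) /\ (forall x, b (succz (-1)) x = f0 i x).
  by move=> i; apply: strict_cm.
pose H i : {linear Q (succz i) -> Q i} := match i with Negz 0 => h | _ => \0 end.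
exists I, a, b, H => i x; case: i x => [n|[|[|n]]] x.
- by apply: strict_eq sQ _ _; rewrite /succz; lia.
- rewrite (@strict_eq0 Q (succz (succz (-1))) (cdiff Q _ x) sQ) // linear0 addr0.
  have := Hsec x; rewrite Hp /= => E.
  have : p (k (th' x)) = 0 by apply/Hk; exists (th' x).
  rewrite Hp => E'.
  have {}E : p (sec x - k (th' x)) = x by rewrite linearB !Hp E E' subr0.
  rewrite Hp in E; rewrite -[X in _ - X]E Hh linearN /=.
  rewrite (eq_bigr (fun i => f0 i ((sec x - k (th' x)).1 i))) => [|i _]; last first.
    by rewrite (Hb i).2 (Ha i).2 Ha0.
  by zmodule.
- rewrite linear0 add0r [H _ _]Hh.
  have /(congr1 snd) := Ks x; rewrite Hj /= => E.
  rewrite (eq_bigr (fun i => f1 i (s1 x i))) => [|i _]; last first.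
    by rewrite (Hb i).1 (Ha i).1 Ha1.
  rewrite -[X in X - _ = _]opprK -E /=.
  by zmodule.
- by apply: strict_eq sQ _ _; rewrite /succz; lia.
Qed.

End TwoTerm.

(** * Noetherian algebras *)

Section FgSub.
Variables (A : pzRingType) (V : lmodType A).

Definition fg_sub (U : V -> Prop) : Prop :=
  exists (I : finType) (g : I -> V), (forall k, U (g k)) /\
    forall x, U x -> exists c : I -> A, x = \sum_k c k *: g k.

End FgSub.

(** Induction on n. The possible coefficients of the last generator on elements of U form an ideal,
    finitely generated by hypothesis; subtracting lifts of its generators leads to the part of U
    spanned by the first n generators. *)
Lemma noetherian_span (R : comNzRingType) (V : lmodType R) n (g : 'I_n -> V)
    (U : V -> Prop) :
  noetherian R -> submodP U ->
  (forall x, U x -> exists c : 'I_n -> R, x = \sum_k c k *: g k) -> fg_sub U.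
Proof.
move=> nR; elim: n g U => [|n IH] g U sU HU.
  exists void, (fun=> 0); split=> [[]|x /HU[c ->]].
  by exists (fun=> 0); rewrite big_ord0 big_pred0 // => -[].
pose g' k := g (widen_ord (leqnSn n) k).
pose U' x := U x /\ exists c : 'I_n -> R, x = \sum_k c k *: g' k.
have [||J [y [Uy Hy]]] := IH g' U'.
- split=> [|a x z [Ux [c Ec]] [Uz [d Ed]]]; split; first exact: sU.1.
  + by exists (fun=> 0); rewrite big1 // => k _; rewrite scale0r.
  + exact: sU.2.
  exists (fun k => a * c k + d k); rewrite Ec Ed scaler_sumr -big_split /=.
  by apply: eq_bigr => k _; rewrite scalerDl scalerA.
- by move=> x [].
pose I (r : R^o) := exists x (c : 'I_n -> R), U x /\
  x = \sum_k c k *: g' k + (r : R) *: g ord_max.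
have sI : submodP I.
  split=> [|a r s [x [c [Ux Ec]]] [z [d [Uz Ed]]]].
    exists 0, (fun=> 0); split; first exact: sU.1.
    by rewrite scale0r addr0 big1 // => k _; rewrite scale0r.
  exists (a *: x + z), (fun k => a * c k + d k); split; first exact: sU.2.
  rewrite Ec Ed scalerDr addrACA; congr (_ + _); last first.
    by rewrite scalerDl -scalerA.
  rewrite scaler_sumr -big_split /=.
  by apply: eq_bigr => k _; rewrite scalerDl scalerA.
have [m [r [Ir Hr]]] := nR _ ((submodP_closed I).1 sI).
have /choice[x /choice[c Hx]] : forall j, I (r j) by move=> j; have := Ir j; rewrite inE => /asboolP.
exists (J + 'I_m)%type, (fun s => match s with inl j => y j | inr j => x j end).
split=> [[j|j]|z Uz]; first by case: (Uy j).
  by case: (Hx j).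
have [d Ed] := HU z Uz.
have Id : I (d ord_max).
  exists z, (fun k => d (widen_ord (leqnSn n) k)); split=> //.
  by rewrite {1}Ed big_ord_recr.
have [|e Ee] := Hr (d ord_max); first by rewrite inE; apply/asboolP.
have [|f Ef] := Hy (z - \sum_j e j *: x j).
  split.
    by apply: submodPB => //; apply: submodP_sum => // j; apply: submodPZ => //; case: (Hx j).
  exists (fun k => d (widen_ord (leqnSn n) k) - \sum_j e j * c j k).
  rewrite {1}Ed big_ord_recr /= Ee scaler_suml.
  have -> : \sum_j e j *: x j = \sum_k (\sum_j e j * c j k) *: g' k +
       \sum_j (e j * r j) *: g ord_max.
    under [X in _ = X + _]eq_bigr do rewrite scaler_suml.
    rewrite exchange_big -big_split /=; apply: eq_bigr => j _.
    rewrite (Hx j).2 scalerDr scalerA scaler_sumr; congr (_ + _).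
    by apply: eq_bigr => k _; rewrite scalerA.
  rewrite opprD addrACA subrr addr0 -sumrB.
  by apply: eq_bigr => k _; rewrite scalerBl.
exists (fun s => match s with inl j => f j | inr j => e j end).
by rewrite big_sumType /= -Ef subrK.
Qed.

Lemma noetherian_sub (R : comNzRingType) (V : lmodType R) (U : V -> Prop) :
  noetherian R -> fin_gen V -> submodP U -> fg_sub U.
Proof.
move=> nR [n [g Hg]] sU; apply: (noetherian_span (g := g)) => // x _; exact: Hg.
Qed.

Lemma lin_eq_gen (A : pzRingType) (M N : lmodType A) (I : finType) (g : I -> M)
    (u v : {linear M -> N}) :
  (forall x, exists c : I -> A, x = \sum_k c k *: g k) ->
  (forall k, u (g k) = v (g k)) -> forall x, u x = v x.
Proof.
move=> Hg E x; have [c ->] := Hg x; rewrite !linear_sum.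
by apply: eq_bigr => k _; rewrite !linearZ E.
Qed.

Section NoetherianAlgebra.
Variables (R : comNzRingType) (L : algebra R).
Hypothesis nL : noetherian_algebra L.
Implicit Types M N : lmodType L.

Lemma ract_lin M r : exists f : {linear M -> M}, forall x, f x = ract r x.
Proof. by apply: ex_linear => a x y; rewrite ractD ractZ. Qed.

Lemma fin_gen_restrict M : fin_gen M -> fin_gen (restrict (alg_map L) M).
Proof.
move=> [n [g Hg]]; have [_ [m [l Hl]]] := nL.
apply: (@fin_gen_finType _ ('I_n * 'I_m)%type (restrict (alg_map L) M)
  (fun p => (l p.2 : L) *: (g p.1 : M))) => x.
have [c Ec] := Hg x; have /choice[d Hd] := fun i => Hl (c i).
exists (fun p => d p.1 p.2).
rewrite [LHS]Ec -(pair_bigA _ (fun i j => (d i j *: ((l j : L) *: (g i : M) : restrict (alg_map L) M)))) /=.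
apply: eq_bigr => i _.
have -> : c i = \sum_j alg_map L (d i j) * (l j : L) := Hd i.
by rewrite scaler_suml; apply: eq_bigr => j _; rewrite -scalerA.
Qed.

Lemma restrict_submodP M (U : M -> Prop) :
  submodP U -> submodP (U : restrict (alg_map L) M -> Prop).
Proof. by move=> [U0 UD]; split=> // a x y Ux Uy; apply: UD. Qed.

Lemma fg_sub_algebra M (U : M -> Prop) : fin_gen M -> submodP U -> fg_sub U.
Proof.
move=> /fin_gen_restrict fM /restrict_submodP sU.
have [I [g [Ug Hg]]] := noetherian_sub nL.1 fM sU.
exists I, g; split=> // x /Hg[c Ec]; exists (fun k => alg_map L (c k)).
exact: Ec.
Qed.

(** Otherwise choice builds a strictly increasing chain; the generators of its union already lie in
    one of its terms. *)
Lemma maximal_sub M (Pr : (M -> Prop) -> Prop) (U0 : M -> Prop) :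
  fin_gen M -> submodP U0 -> Pr U0 ->
  exists U, [/\ submodP U, Pr U & forall U', submodP U' -> Pr U' ->
    (forall x, U x -> U' x) -> forall x, U' x -> U x].
Proof.
move=> fM sU0 pU0; apply: contrapT => nH.
pose T := {U : M -> Prop | submodP U /\ Pr U}.
have /choice[nx Hnx] : forall U : T, exists U' : T,
    (forall x, sval U x -> sval U' x) /\ exists x, sval U' x /\ ~ sval U x.
  move=> [U [sU pU]] /=; apply: contrapT => nU; apply: nH; exists U; split=> // U' sU' pU' UU' x U'x.
  apply: contrapT => nUx; apply: nU; exists (exist _ U' (conj sU' pU')) => /=.
  by split=> //; exists x.
pose F n : T := iter n nx (exist _ U0 (conj sU0 pU0)).
have FS n m x : (n <= m)%N -> sval (F n) x -> sval (F m) x.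
  move=> nm; rewrite -(subnK nm); elim: (m - n)%N => // k IH /IH; apply: (Hnx _).1.
pose U x := exists n, sval (F n) x.
have sU : submodP U.
  split=> [|a x y [n Hn] [m Hm]]; first by exists 0 => /=; apply: sU0.1.
  exists (n + m)%N; apply: (svalP (F _)).1.2.
    by apply: FS Hn; rewrite leq_addr.
  by apply: FS Hm; rewrite leq_addl.
have [I [g [/choice[k Hk] Hg]]] := fg_sub_algebra fM sU.
pose m := (\sum_i k i)%N.
have [x [Fx nFx]] := (Hnx (F m)).2; apply: nFx.
have [|c ->] := Hg x; first by exists m.+1.
apply: submodP_sum => [|i]; first exact: (svalP (F m)).1.
apply: submodPZ; first exact: (svalP (F m)).1.
by apply: FS (Hk i); rewrite /m (bigD1 i) //= leq_addr.
Qed.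

(** Chain maps are recorded by their values on generators of P. They form a submodule over R only,
    so generators are taken over R, and the coefficients of a chain map act on P as the central
    endomorphisms [t1] and [t0]. *)
Lemma approximation_exists (P Q : complex L) :
  strict_two_term P -> strict_two_term Q ->
  exists (I : finType) (f1 : I -> {linear P (-1) -> Q (-1)})
    (f0 : I -> {linear P (succz (-1)) -> Q (succz (-1))}), approximates f1 f0.
Proof.
move=> sP sQ.
have [n1 [b1 Hb1]] := (strict_kb (-1) sP).1.
have [n0 [b0 Hb0]] := (strict_kb (succz (-1)) sP).1.
pose E : lmodType L := ({ffun 'I_n1 -> Q (-1)} * {ffun 'I_n0 -> Q (succz (-1))})%type.
pose ev (u1 : {linear P (-1) -> Q (-1)}) (u0 : {linear P (succz (-1)) -> Q (succz (-1))}) : E :=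
  ([ffun k => u1 (b1 k)], [ffun k => u0 (b0 k)]).
pose ch (u1 : {linear P (-1) -> Q (-1)}) (u0 : {linear P (succz (-1)) -> Q (succz (-1))}) :=
  forall x, u0 (cdiff P (-1) x) = cdiff Q (-1) (u1 x).
pose U (e : restrict (alg_map L) E) := exists u1 u0, ch u1 u0 /\ ev u1 u0 = e.
have fE : fin_gen E.
  by apply: fin_gen_prod; apply: fin_gen_copies; apply: (strict_kb _ sQ).1.
have sU : submodP U.
  split=> [|r _ _ [u1 [u0 [cu <-]]] [v1 [v0 [cv <-]]]].
    exists \0, \0; split=> [x|]; first by rewrite /= linear0.
    by congr (_, _); apply/ffunP => k; rewrite !ffunE.
  have [r1 Hr1] := ract_lin (Q (-1)) r; have [r0 Hr0] := ract_lin (Q (succz (-1))) r.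
  exists ((r1 \o u1) \+ v1), ((r0 \o u0) \+ v0); split=> [x|].
    by rewrite /= Hr1 Hr0 linearD /ract linearZ cu cv.
  by congr (_, _); apply/ffunP => k; rewrite !ffunE /= ?Hr1 ?Hr0.
have [I [e [/choice[f1 /choice[f0 Hf]] He]]] := noetherian_sub nL.1 (fin_gen_restrict fE) sU.
exists I, f1, f0; split=> [i|u1 u0 cu]; first by case: (Hf i).
have [|c Ec] := He (ev u1 u0); first by exists u1, u0.
have /dep_choice[t1 Ht1] := fun i => ract_lin (P (-1)) (c i).
have /dep_choice[t0 Ht0] := fun i => ract_lin (P (succz (-1))) (c i).
have {}Ec : ev u1 u0 = \sum_i alg_map L (c i) *: ev (f1 i) (f0 i).
  by rewrite [LHS]Ec; apply: eq_bigr => i _; rewrite (Hf i).2.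
exists t1, t0; split.
- by move=> i x; rewrite Ht1 Ht0 /ract linearZ.
- have [s Hs] := lin_sum (fun i => f1 i \o t1 i).
  move=> x; rewrite -Hs; move: x; apply: (lin_eq_gen Hb1) => k; rewrite Hs.
  have /ex_linear[pr Hpr] : linear (fun e : E => e.1 k).
    by move=> a x y; rewrite /= !ffunE.
  have /(congr1 pr) := Ec; rewrite linear_sum Hpr ffunE => ->.
  by apply: eq_bigr => i _; rewrite linearZ Hpr ffunE /= Ht1 /ract linearZ.
have [s Hs] := lin_sum (fun i => f0 i \o t0 i).
move=> x; rewrite -Hs; move: x; apply: (lin_eq_gen Hb0) => k; rewrite Hs.
have /ex_linear[pr Hpr] : linear (fun e : E => e.2 k).
  by move=> a x y; rewrite /= !ffunE.
have /(congr1 pr) := Ec; rewrite linear_sum Hpr ffunE => ->.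
by apply: eq_bigr => i _; rewrite linearZ Hpr ffunE /= Ht0 /ract linearZ.
Qed.

Lemma silt2_le_anti (S T : silt2 L) : silt2_le S T -> silt2_le T S -> S = T.
Proof.
have [P SP sP] := silt2_strict S; have [Q TQ sQ] := silt2_strict T.
move=> /(silt2_leP SP TQ) PQ /(silt2_leP TQ SP) QP.
have [[iP _] [iQ _]] := (silt2_mem SP, silt2_mem TQ).
apply: (silt2_eq SP TQ); apply/add_eqP; [by case: sP|by case: sQ|].
have [I [f1 [f0 Hf]]] := approximation_exists sP sQ.
have [J [g1 [g0 Hg]]] := approximation_exists sQ sP.
by split; [apply: approx_summand Hg | apply: approx_summand Hf].
Qed.

End NoetherianAlgebra.

(** * Localization *)

Section RAction.
Variables (R : comNzRingType) (L : algebra R).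
Implicit Types M N : lmodType L.

Lemma ract_linear M N (f : {linear M -> N}) r x : f (ract r x) = ract r (f x).
Proof. exact: linearZ. Qed.

Lemma ractB M r (x y : M) : ract r (x - y) = ract r x - ract r y.
Proof. by rewrite ractD ractN. Qed.

Lemma ract_sum M r (I : finType) (F : I -> M) :
  ract r (\sum_i F i) = \sum_i ract r (F i).
Proof. exact: scaler_sumr. Qed.

Lemma ractDl M r s (x : M) : ract (r + s) x = ract r x + ract s x.
Proof. by rewrite /ract rmorphD scalerDl. Qed.

Lemma ractBl M r s (x : M) : ract (r - s) x = ract r x - ract s x.
Proof. by rewrite /ract rmorphB scalerBl. Qed.

Lemma ract0l M (x : M) : ract 0 x = 0.
Proof. by rewrite /ract rmorph0 scale0r. Qed.

Lemma submodP_ract M (U : M -> Prop) r x : submodP U -> U x -> U (ract r x).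
Proof. exact: submodPZ. Qed.

End RAction.

Section Loc.
Variables (R : comNzRingType) (L : algebra R) (p : prime_idealr R).
Notation Lp := (loc_alg L p).
Notation den := (den p).
Implicit Types (A B M N : lmodType L) (X Y Z : lmodType Lp).

Definition res X : lmodType L := restrict (@loc_can R L p) X.

Lemma res_lin X Y (f : {linear X -> Y}) :
  exists g : {linear res X -> res Y}, forall x, g x = f x.
Proof. by apply: ex_linear => a x y; exact: linearP. Qed.

Lemma lfrac_inv (s : den) : exists z : Lp,
  z * alg_map Lp (dval s) = 1 /\ alg_map Lp (dval s) * z = 1.
Proof.
exists (lfrac (1 : L) s).
have E : alg_map Lp (dval s) * lfrac (1 : L) s = 1.
  rewrite [LHS]loc_mulE den1M mulr1; apply/frac_eq; exists (den1 p).
  by rewrite !dvalE !ract1; symmetry; exact: mulr1.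
by rewrite -[_ * _ in X in X /\ _](alg_central (a := Lp)).
Qed.

Lemma ract_inj X (s : den) (x y : X) : ract (dval s) x = ract (dval s) y -> x = y.
Proof.
have [z [zs _]] := lfrac_inv s; move=> /(congr1 (fun x => z *: x)).
by rewrite /ract !scalerA zs !scale1r.
Qed.

Lemma ract_eq0 X (s : den) (x : X) : ract (dval s) x = 0 -> x = 0.
Proof. by move=> E; apply: (@ract_inj X s); rewrite E ract0. Qed.

Lemma ract_surj X (s : den) (x : X) : exists y, ract (dval s) y = x.
Proof.
have [z [_ sz]] := lfrac_inv s; exists (z *: x).
by rewrite /ract scalerA sz scale1r.
Qed.

Lemma ract_inv X (s : den) :
  exists f : {linear X -> X}, forall x, ract (dval s) (f x) = x.
Proof.
apply: (@lin_of_rel _ _ _ (fun x y => ract (dval s) y = x)).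
- exact: ract_surj.
- by move=> x y y' <- /ract_inj.
- by move=> a x x' y y' <- <-; rewrite ractD (ractZ (L := Lp)).
Qed.

Lemma lp_decomp (z : Lp) : exists (s : den) (a : L),
  alg_map Lp (dval s) * z = loc_can p a.
Proof.
have [a [s <-]] := lfracP z; exists s, a.
rewrite [LHS]loc_mulE; apply/frac_eq; exists (den1 p).
by rewrite !dvalE !ract1 !mul1r.
Qed.

(** The induced map A_p -> Y is onto; with [is_loc] it is also injective, so that Y is A_p without
    being built from fractions. *)
Definition dense A Y (j : {linear A -> res Y}) : Prop :=
  forall y : Y, exists (s : den) a, ract (dval s) y = j a.

Definition is_loc A Y (j : {linear A -> res Y}) : Prop :=
  dense j /\ forall a, j a = 0 -> exists s : den, ract (dval s) a = 0.

Lemma res_ract X r (x : X) : (ract (L := Lp) r x) = ract (r : R) (x : res X).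
Proof. by []. Qed.

Lemma res_scale X (a : L) (x : X) : (loc_can p a : Lp) *: x = a *: (x : res X).
Proof. by []. Qed.

Lemma loc_lift A X Y (i : {linear A -> res X}) (f : {linear A -> res Y}) :
  is_loc i -> exists g : {linear X -> Y}, forall a, g (i a) = f a.
Proof.
move=> [di ki].
(* The graph of the lift: x = i(a)/s is sent to f(a)/s. *)
have [|||g Hg] := @lin_of_rel Lp X Y (fun x y => exists (s : den) a,
   ract (L := Lp) (dval s) x = i a /\ ract (L := Lp) (dval s) y = f a).
- move=> x; have [s [a E]] := di x; have [y Ey] := @ract_surj Y s (f a).
  by exists y, s, a.
- move=> x y y' [s [a [Ea Fa]]] [t [b [Eb Fb]]].
  have [|u] := ki (ract (dval t) a - ract (dval s) b).
    rewrite linearB !(ract_linear i) -Ea -Eb -!res_ract !ractA.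
    by apply/eqP; rewrite subr_eq0; apply/eqP; congr (ract _ _); ring.
  rewrite ractB => /eqP; rewrite subr_eq0 => /eqP /(congr1 f).
  rewrite !(ract_linear f) -Fa -Fb -!res_ract !ractA => E.
  apply: (@ract_inj Y (denM u (denM s t))); rewrite !dvalE.
  rewrite mulrA mulrAC E; congr (ract _ _); ring.
- move=> z x x' y y' [s [a [Ea Fa]]] [t [b [Eb Fb]]].
  have [v [c Ec]] := lp_decomp z.
  exists (denM v (denM s t)), (c *: ract (dval t) a + ract (dval v * dval s) b).
  have H (W : lmodType Lp) (w w' : W) (k : {linear A -> res W}) : ract (L := Lp) (dval s) w = k a ->
      ract (L := Lp) (dval t) w' = k b ->
      ract (L := Lp) (dval (denM v (denM s t))) (z *: w + w') =
      k (c *: ract (dval t) a + ract (dval v * dval s) b).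
    move=> Ew Ew'; rewrite linearP !(ract_linear k) -Ew -Ew' -!res_ract.
    rewrite ractD !dvalE; congr (_ + _).
      rewrite -[RHS]res_scale -Ec ractA /ract !scalerA; congr (_ *: _).
      by rewrite (rmorphM (alg_map Lp)) -!mulrA (alg_central (dval s * dval t) z) (mulrC (dval s)).
    by rewrite !ractA; congr (ract _ _); ring.
  by split; exact: H.
exists g => a; have [s [b [Eb Fb]]] := Hg (i a).
have [|u] := ki (ract (dval s) a - b).
  by rewrite linearB (ract_linear i) -Eb subrr.
rewrite ractB => /eqP; rewrite subr_eq0 => /eqP /(congr1 f).
rewrite !(ract_linear f) -Fb -!res_ract => E.
by apply: (@ract_inj Y s); apply: (@ract_inj Y u).
Qed.

Lemma loc_unique A X Y (i : {linear A -> res X}) (j : {linear A -> res Y}) :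
  is_loc i -> is_loc j -> mod_iso X Y.
Proof.
move=> li lj; have [g Hg] := loc_lift j li.
apply: (mod_iso_ex (f := g)).
  apply: inj_lin => x gx; have [s [a E]] := li.1 x.
  have [|u Eu] := lj.2 a; first by rewrite -Hg -E ract_linear gx ract0.
  apply: (@ract_eq0 X (denM u s)); rewrite dvalE -ractA E.
  by rewrite -[LHS](ract_linear i) Eu linear0.
move=> y; have [s [a E]] := lj.1 y; have [x Ex] := @ract_surj X s (i a).
by exists x; apply: (@ract_inj Y s); rewrite E -Hg -Ex ract_linear.
Qed.

Lemma loc_can_ex M : exists i : {linear M -> res (loc_mod p M)},
  is_loc i /\ forall x, i x = Defs.frac x (den1 p).
Proof.
have [i Hi] : exists i : {linear M -> res (loc_mod p M)}, forall x, i x = Defs.frac x (den1 p).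
  apply: ex_linear => a x y; rewrite -fracD; congr (_ + _).
  by rewrite [RHS]loc_scaleE den1M.
exists i; split=> //; split=> [w|a].
  have [x [s <-]] := fracP w; exists s, x; rewrite Hi.
  rewrite [LHS]loc_scaleE den1M; apply/frac_eq; exists (den1 p).
  by rewrite dvalE !ract1.
rewrite Hi -(frac0 M (den1 p)) => /frac_eq[u]; rewrite !dvalE !ract1 ract0 => E.
by exists u.
Qed.

Lemma loc_self X : is_loc (idfun : {linear res X -> res X}).
Proof.
split=> [x|a /= ->]; last by exists (den1 p); rewrite ract0.
by exists (den1 p), x; rewrite dvalE ract1.
Qed.

Lemma dense_image A Y (j : {linear A -> res Y}) : dense j ->
  exists (S : lmodType L) (e : {linear A -> S}) (i : {linear S -> res Y}),
    [/\ surj e, injective i, forall x, i (e x) = j x & is_loc i].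
Proof.
move=> dj; have [S [e [i [se ii E]]]] := image_factor j.
exists S, e, i; split=> //; split=> [y|a Ea].
  by have [s [a Ea]] := dj y; exists s, (e a); rewrite E.
exists (den1 p); rewrite dvalE ract1; apply: ii; by rewrite Ea linear0.
Qed.

(** The image of a dense map is a quotient of A, hence again in T, and Y is its localization. Dense
    maps survive quotients of Y and are easier to assemble than localizations. *)
Lemma loc_class_dense (T : lmodType L -> Prop) Y :
  is_torsion_class (@fin_gen L) T ->
  loc_class T Y <-> exists A, T A /\ exists j : {linear A -> res Y}, dense j.
Proof.
move=> [TC _ _ _ Tq]; split=> [[A TA /mod_iso_sym/mod_iso_bij[f [fi fs]]]|[A [TA [j dj]]]].
  exists A; split=> //; have [i [[di _] _]] := loc_can_ex A.
  have [f' Ef] := res_lin f; exists (f' \o i) => y.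
  have [w <-] := fs y; have [s [a E]] := di w; exists s, a.
  by rewrite /= -E Ef [RHS]ract_linear.
have [S [e [i [se _ _ li]]]] := dense_image dj.
exists S; first exact: Tq (fin_gen_surj se (TC _ TA)) se TA.
by have [k [lk _]] := loc_can_ex S; apply: loc_unique li lk.
Qed.

Lemma dense_fin_gen A Y (j : {linear A -> res Y}) : fin_gen A -> dense j -> fin_gen Y.
Proof.
move=> [n [g Hg]] dj; exists n, (fun k => j (g k)) => y.
have [s [a E]] := dj y; have [c Ea] := Hg a.
have [z [zs _]] := lfrac_inv s.
exists (fun k => z * loc_can p (c k)).
have -> : y = z *: (j a : Y) by rewrite -E /ract scalerA zs scale1r.
rewrite Ea linear_sum scaler_sumr; apply: eq_bigr => k _.
by rewrite -scalerA; congr (z *: _); rewrite linearZ.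
Qed.

Lemma loc_fin_gen M : fin_gen M -> fin_gen (loc_mod p M).
Proof.
by move=> fM; have [i [[di _] _]] := loc_can_ex M; apply: dense_fin_gen di.
Qed.

(** * Nakayama's lemma *)

Lemma notin_denB (s : den) r : r \in p -> dval s - r \notin p.
Proof.
move=> rp; apply/negP => H; have := valP s; rewrite -/(dval s) -[dval s](subrK r).
by rewrite rpredD.
Qed.

Definition den_of r (rp : r \notin p) : den := exist _ r rp.

Lemma den_ofE r (rp : r \notin p) : dval (den_of rp) = r.
Proof. by []. Qed.

Definition p_multiple X (x : X) : Prop :=
  exists n (r : 'I_n -> R) (y : 'I_n -> X),
    (forall k, r k \in p) /\ x = \sum_k ract (r k) (y k).

Lemma mod_pP X : exists pi : {linear X -> mod_p p X},
  surj pi /\ forall x, pi x = 0 <-> p_multiple x.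
Proof.
have Lin : linear (quot_proj (@pmul R Lp p X)).
  move=> a x y; rewrite quot_projD; congr (_ + _).
  by rewrite -quot_scaleE.
have [pi Epi] := ex_linear Lin.
exists pi; split=> [y|x].
  by have [x <-] := quot_projP y; exists x; rewrite Epi.
have {}Epi y : pi y = quot_proj (@pmul R Lp p X) y by exact: Epi.
have <- : pi 0 = 0 by exact: linear0.
rewrite !Epi quot_proj_eq subr0 unfold_in.
by split=> /asboolP.
Qed.

(* R_p-submodules, in terms of R. *)
Definition sat_sub X (B : X -> Prop) : Prop :=
  submodP (B : restrict (alg_map Lp) X -> Prop) /\
  forall (s : den) x, B (ract (dval s) x) -> B x.

Lemma sat_subP X (B : X -> Prop) : submodP B -> sat_sub B.
Proof.
move=> [B0 BD]; split=> [|s x Bsx]; first by split=> // a x y; exact: BD.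
have [z [zs _]] := lfrac_inv s.
have -> : x = z *: ract (dval s) x + 0 by rewrite addr0 /ract scalerA zs scale1r.
exact: BD.
Qed.

Lemma sat_sub_ract X (B : X -> Prop) r x : sat_sub B -> B x -> B (ract r x).
Proof. by move=> [sB _]; apply: (@submodPZ R (restrict (alg_map Lp) X) B r x sB). Qed.

(** Generation over R_p modulo B, with the denominator cleared so that all coefficients stay in
    R. *)
Definition spanned X (B : X -> Prop) (I : finType) (S : {set I}) (g : I -> X)
    (x : X) : Prop :=
  exists (s : den) (c : I -> R),
    B (ract (dval s) x - \sum_(k in S) ract (c k) (g k)).

Lemma spanned_elim X (B : X -> Prop) (I : finType) (S : {set I}) (g : I -> X) i x :
  sat_sub B -> i \in S -> spanned B (S :\ i) g (g i) -> spanned B S g x ->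
  spanned B (S :\ i) g x.
Proof.
move=> sB iS [t [a Ba]] [s [c Bc]].
exists (denM t s), (fun k => dval t * c k + c i * a k).
have := submodPD sB.1 (sat_sub_ract (dval t) sB Bc) (sat_sub_ract (c i) sB Ba).
rewrite (big_setD1 i iS) /=; congr B.
have -> : \sum_(k in S :\ i) ract (dval t * c k + c i * a k) (g k) =
    ract (dval t) (\sum_(k in S :\ i) ract (c k) (g k)) +
    ract (c i) (\sum_(k in S :\ i) ract (a k) (g k)).
  rewrite [ract (dval t) _]scaler_sumr [ract (c i) _]scaler_sumr -big_split /=.
  by apply: eq_bigr => k _; rewrite ractDl -!ractA.
rewrite dvalE -ractA !ractB [ract (dval t) (_ + _)]ractD.
have -> : ract (dval t) (ract (c i) (g i)) = ract (c i) (ract (dval t) (g i)).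
  by rewrite !ractA mulrC.
by zmodule.
Qed.

(** Induction on the spanning set, without determinants: g_i is congruent modulo B to a combination
    with coefficients in p, and moving its own term across leaves a coefficient outside p, so g_i
    can be eliminated. *)
Lemma nakayama X (B : X -> Prop) (I : finType) (S : {set I}) (g : I -> X) :
  sat_sub B -> (forall x, spanned B S g x) ->
  (forall x, exists y, B (x - y) /\ p_multiple y) -> forall x, B x.
Proof.
move=> sB; move: {2}#|S| (leqnn #|S|) => n.
elim: n S => [|n IH] S cS HS Hp.
  move=> x; have [s [c]] := HS x.
  have -> : S = set0 by apply/eqP; rewrite -cards_eq0 -leqn0.
  by rewrite big_set0 subr0; exact: sB.2.
have [S0|[i iS]] := set_0Vmem S.
  by apply: (IH S) => //; rewrite S0 cards0.
apply: (IH (S :\ i)) => // [|x].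
  by rewrite -ltnS; apply: leq_trans cS; rewrite [X in (_ < X)%N](cardsD1 i) iS.
apply: (spanned_elim sB iS) => //.
(* [W] is the set of y that, up to a denominator, are combinations of the g_k with coefficients in p
   modulo B. *)
pose W y := exists (s : den) (a : I -> R), (forall k, a k \in p) /\
  B (ract (dval s) y - \sum_(k in S) ract (a k) (g k)).
have W0 : W 0.
  exists (den1 p), (fun=> 0); split=> [k|]; first exact: rpred0.
  rewrite ract0 big1 ?subr0; first exact: sB.1.1.
  by move=> k _; rewrite ract0l.
have WD y z : W y -> W z -> W (y + z).
  move=> [s [a [ap Ba]]] [t [b [bp Bb]]].
  exists (denM s t), (fun k => dval t * a k + dval s * b k); split=> [k|].
    by rewrite rpredD // idealMr.
  have := submodPD sB.1 (sat_sub_ract (dval t) sB Ba) (sat_sub_ract (dval s) sB Bb).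
  congr B; rewrite !ractB !dvalE !ractD.
  have -> : \sum_(k in S) ract (dval t * a k + dval s * b k) (g k) =
      ract (dval t) (\sum_(k in S) ract (a k) (g k)) +
      ract (dval s) (\sum_(k in S) ract (b k) (g k)).
    rewrite [ract (dval t) _]scaler_sumr [ract (dval s) _]scaler_sumr -big_split /=.
    by apply: eq_bigr => k _; rewrite ractDl -!ractA.
  by rewrite !ractA (mulrC (dval t)); zmodule.
have Wp r y : r \in p -> W (ract r y).
  move=> rp; have [s [c Bc]] := HS y; exists s, (fun k => r * c k).
  split=> [k|]; first by rewrite mulrC idealMr.
  have := sat_sub_ract r sB Bc; congr B.
  rewrite ractB !ractA mulrC; congr (_ - _).
  by rewrite [LHS]scaler_sumr; apply: eq_bigr => k _; rewrite -ractA.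
have [y [By [n' [r [z [rp Ey]]]]]] := Hp (g i).
have [s [a [ap Ba]]] : W y.
  by rewrite Ey; apply: big_ind => // k _; exact: Wp.
exists (den_of (notin_denB s (ap i))), a.
have := submodPD sB.1 (sat_sub_ract (dval s) sB By) Ba.
rewrite (big_setD1 i iS) /=; congr B.
by rewrite den_ofE ractBl ractB; zmodule.
Qed.

(** * Finitely generated modules over L_p *)

Hypothesis fL : fin_gen (restrict (alg_map L) L^o).

Lemma fin_gen_spanned X : fin_gen X -> exists (I : finType) (g : I -> X),
  forall (B : X -> Prop) x, B 0 -> spanned B setT g x.
Proof.
move=> [n [g Hg]]; have [m [l Hl]] := fL.
exists ('I_n * 'I_m)%type, (fun q => loc_can p (l q.2 : L) *: g q.1).
suff H x : spanned (fun y => y = 0) setT (fun q => loc_can p (l q.2 : L) *: g q.1) x.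
  by move=> B x sB; have [s [c E]] := H x; exists s, c; rewrite E; exact: sB.
have sB : sat_sub (fun y : X => y = 0).
  by apply: sat_subP; split=> // a y z -> ->; rewrite scaler0 addr0.
have [c ->] := Hg x; elim/big_ind: _ => [|y z [s [a /eqP]]|i _].
- by exists (den1 p), (fun=> 0); rewrite ract0 sub0r big1 ?oppr0 // => k _; rewrite ract0l.
- rewrite subr_eq0 => /eqP Ey [t [b /eqP]]; rewrite subr_eq0 => /eqP Ez.
  exists (denM s t), (fun k => dval t * a k + dval s * b k).
  rewrite dvalE ractD mulrC -ractA Ey mulrC -ractA Ez.
  rewrite [ract (dval t) _]scaler_sumr [ract (dval s) _]scaler_sumr -big_split /=.
  apply/eqP; rewrite subr_eq0; apply/eqP.
  by apply: eq_bigr => k _; rewrite ractDl -!ractA.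
have [s [a E]] := lp_decomp (c i); have [d Ed] := Hl a.
exists s, (fun q => if q.1 == i then d q.2 else 0).
apply/eqP; rewrite subr_eq0; apply/eqP.
pose h j k : X := loc_can p (l k : L) *: g j.
transitivity (\sum_(q : 'I_n * 'I_m) ract (if q.1 == i then d q.2 else 0) (h q.1 q.2));
  last by apply: eq_bigl => q; rewrite inE.
rewrite -(pair_bigA _ (fun j k => ract (if j == i then d k else 0) (h j k))) /=.
rewrite (bigD1 i) //= [X in _ + X]big1 ?addr0 => [|j ji]; last first.
  by rewrite big1 // => k _; rewrite (negbTE ji) ract0l.
rewrite /ract scalerA E.
have -> : loc_can p a = \sum_j alg_map Lp (d j) * loc_can p (l j : L).
  have -> : a = \sum_j alg_map L (d j) * (l j : L) := Ed.
  by rewrite rmorph_sum; apply: eq_bigr => j _; rewrite rmorphM.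
by rewrite scaler_suml; apply: eq_bigr => k _; rewrite eqxx scalerA.
Qed.

(** A dual basis of P^-1 parametrizes Hom(P^-1, X) by X^n. The tuples whose map extends along the
    differential form the R_p-submodule [B], and the hypothesis gives X^n = B + p X^n, so Nakayama's
    lemma applies. *)
Lemma ext_zero_mod_p (P : complex Lp) X : strict_two_term P -> fin_gen X ->
  ext_zero P (mod_p p X) -> ext_zero P X.
Proof.
move=> sP fX H.
have [n [b [be Hbe]]] := dual_basis (strict_kb (-1) sP).
pose V : lmodType Lp := {ffun 'I_n -> X}.
pose B (y : V) := exists psi : {linear P (succz (-1)) -> X},
  forall x, psi (cdiff P (-1) x) = \sum_i (be x i : Lp) *: y i.
have [pi [spi kpi]] := mod_pP X.
have sB : sat_sub B.
  split=> [|s y [psi Hpsi]].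
    split=> [|r y z [u Hu] [v Hv]].
      by exists \0 => x; rewrite big1 // => i _; rewrite ffunE scaler0.
    have [f Hf] : exists f : {linear P (succz (-1)) -> X}, forall x, f x = ract r (u x) + v x.
      by apply: ex_linear => a x x'; rewrite !linearP /= !ractD scalerDr (ractZ (L := Lp)); zmodule.
    exists f => x; rewrite Hf Hu Hv ract_sum -big_split /=.
    apply: eq_bigr => i _; rewrite !ffunE scalerDr; congr (_ + _).
    by symmetry; exact: (ractZ (L := Lp)).
  have [f Hf] := ract_inv X s.
  exists (f \o psi) => x; apply: (@ract_inj X s); rewrite /= Hf Hpsi ract_sum.
  by apply: eq_bigr => i _; rewrite /ract !ffunE -[RHS]ractZ.
have BV y : B y.
  have fV : fin_gen V by exact: fin_gen_copies.
  have [I [g Hg]] := fin_gen_spanned fV.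
  apply: (nakayama (S := setT) (g := g) sB) => [z|{}y].
    by apply: Hg; exact: sB.1.1.
  have /ex_linear[f Hf] : linear (fun x => \sum_i (be x i : Lp) *: y i).
    move=> a x z; rewrite linearP scaler_sumr -big_split /=; apply: eq_bigr => i _.
    by rewrite !ffunE scalerDl scalerA.
  have [h Hh] := H (pi \o f).
  have [psi Hpsi] := (strict_kb (succz (-1)) sP).2 _ _ pi h spi.
  pose u : {linear P (-1) -> X} := f \- (psi \o cdiff P (-1)).
  have Hu x : p_multiple (u x) by apply/kpi; rewrite linearB Hpsi Hh subrr.
  exists [ffun i => u (b i)]; split.
    exists psi => x.
    have E1 : f x = psi (cdiff P (-1) x) + u x by rewrite /u /= addrC subrK.
    rewrite (_ : \sum_i _ = f x - u x); first by rewrite E1 addrK.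
    have -> : u x = \sum_i (be x i : Lp) *: u (b i).
      by rewrite {1}(Hbe x) linear_sum; apply: eq_bigr => i _; rewrite linearZ.
    by rewrite Hf -sumrB; apply: eq_bigr => i _; rewrite !ffunE scalerBr.
  have [rho [_ krho]] := mod_pP V; apply/krho.
  have -> : [ffun i => u (b i)] = \sum_i [ffun j => if j == i then u (b i) else 0] :> V.
    apply/ffunP => i; rewrite sum_ffunE (bigD1 i) //= !ffunE eqxx big1 ?addr0 // => j ji.
    by rewrite ffunE eq_sym (negbTE ji).
  rewrite linear_sum big1 // => i _; apply/krho.
  have [m [r [z [rp Ez]]]] := Hu (b i).
  exists m, r, (fun k => [ffun j => if j == i then z k else 0]); split=> //.
  apply/ffunP => j; rewrite ffunE sum_ffunE Ez; case: eqP => ji.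
    by apply: eq_bigr => k _; rewrite /ract !ffunE ji eqxx.
  by rewrite big1 // => k _; rewrite /ract !ffunE (introF eqP ji) scaler0.
move=> f; have [psi Hpsi] := BV [ffun i => f (b i)].
exists psi => x; rewrite Hpsi {2}(Hbe x) linear_sum.
by apply: eq_bigr => i _; rewrite ffunE linearZ.
Qed.

(* [e] bounds the size of a spanning set modulo W: it decreases strictly along
   chains of submodules, so a W above U with [e] maximal is minimal above U. *)
Lemma finite_length_killed X : fin_gen X ->
  (forall r (x : X), r \in p -> ract r x = 0) -> finite_length X.
Proof.
move=> fX Xp; have [I [g Hg]] := fin_gen_spanned fX.
pose G (U : X -> Prop) (S : {set I}) := forall x, spanned U S g x.
(* If all coefficients of w were in p, they would act by zero and w would lie in U. Some coefficient
   is thus a denominator, and its generator becomes redundant modulo W. *)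
have step (U W : X -> Prop) S w : submodP U -> submodP W -> (forall x, U x -> W x) ->
    W w -> ~ U w -> G U S -> exists2 i, i \in S & G W (S :\ i).
  move=> sU sW UW Ww nUw GS; have [s [c Uc]] := GS w.
  have [/existsP[i /andP[iS ci]]|/existsPn nc] :=
      boolP [exists i, (i \in S) && (c i \notin p)]; last first.
    case: nUw; apply: (sat_subP sU).2 (s) _ _; move: Uc.
    rewrite big1 ?subr0 // => k kS; apply: Xp.
    by move: (nc k); rewrite kS /= negbK.
  exists i => // x; apply: (spanned_elim (sat_subP sW) iS); last first.
    by have [t [d Ud]] := GS x; exists t, d; apply: UW.
  exists (den_of ci), (fun k => - c k).
  have := submodPB sW (submodP_ract (dval s) sW Ww) (UW _ Uc); congr W.
  rewrite opprB addrC subrK (big_setD1 i iS) /= den_ofE.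
  congr (_ + _); rewrite -sumrN; apply: eq_bigr => k _.
  by rewrite /ract rmorphN scaleNr opprK.
pose chain (U : X -> Prop) := exists n (F : nat -> X -> Prop),
  [/\ forall i, submodP (F i), forall x, F 0 x <-> U x, forall x, F n x
    & forall i, (i < n)%N -> [/\ forall x, F i x -> F i.+1 x, exists x, F i.+1 x /\ ~ F i x
      & forall V, submodP V -> (forall x, F i x -> V x) -> (forall x, V x -> F i.+1 x) ->
        (forall x, V x -> F i x) \/ forall x, F i.+1 x -> V x]].
have main m U (S : {set I}) : (#|S| <= m)%N -> submodP U -> G U S -> chain U.
  elim: m U S => [|m IH] U S cS sU GS.
    exists 0, (fun=> U); split=> // x; have [s [c]] := GS x.
    have -> : S = set0 by apply/eqP; rewrite -cards_eq0 -leqn0.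
    by rewrite big_set0 subr0; exact: (sat_subP sU).2.
  have [allU|] := EM (forall x, U x); first by exists 0, (fun=> U).
  move=> /existsNP[w nUw].
  pose above W := [/\ submodP W, forall x, U x -> W x & exists x, W x /\ ~ U x].
  pose e k := exists W, above W /\ (exists2 T, G W T & #|T| = k) /\
     forall T, G W T -> (k <= #|T|)%N.
  have e_ex W T : G W T -> exists k, (exists2 T, G W T & #|T| = k) /\
      forall T', G W T' -> (k <= #|T'|)%N.
    move=> GT; have ex : exists k, `[< exists2 T, G W T & #|T| = k >].
      by exists #|T|; apply/asboolP; exists T.
    exists (ex_minn ex); case: ex_minnP => k /asboolP Hk kmin; split=> // T' GT'.
    by apply: kmin; apply/asboolP; exists T'.
  have exe : exists k, `[< e k >].
    have [k Hk] := @e_ex (fun=> True) setT (fun x => Hg _ x Logic.I).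
    by exists k; apply/asboolP; exists (fun=> True); split=> //; split=> //; exists w.
  have eb k : `[< e k >] -> (k <= #|I|)%N.
    by move=> /asboolP[W [_ [[T _ <-] _]]]; exact: max_card.
  have [k /asboolP[W [[sW UW [w' [Ww' nUw']]] [_ kmin]]] kmax] := ex_maxnP exe eb.
  have [i iS GW] := step U W S w' sU sW UW Ww' nUw' GS.
  have [|n [F [sF F0 Fn HF]]] := IH W (S :\ i) _ sW GW.
    by rewrite -ltnS; apply: leq_trans cS; rewrite [X in (_ < X)%N](cardsD1 i) iS.
  exists n.+1, (fun j => if j is j'.+1 then F j' else U); split=> [[|j]|//|//|[|j] jn] //=.
    split=> [x /UW /F0 //||V sV UV VF].
      by exists w'; split=> //; apply/F0.
    have [VU|/existsNP[v /not_implyP[Vv nUv]]] := EM (forall x, V x -> U x); first by left.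
    right=> x /F0 Wx; apply: contrapT => nVx.
    have VW y : V y -> W y by move=> /VF /F0.
    have [l [[T' GT' lT'] lmin]] := e_ex _ _ (fun x => let: ex_intro s (ex_intro c H) := GS x in
      ex_intro _ s (ex_intro _ c (UV _ H)) : spanned V S g x).
    have /kmax lk : `[< e l >].
      apply/asboolP; exists V; split; first by split=> //; exists v.
      by split=> //; exists T'.
    have [i' i'T' GW'] := step V W T' x sV sW VW Wx nVx GT'.
    have := kmin _ GW'; rewrite leqNgt => /negP; apply.
    by apply: leq_trans lk; rewrite -lT' [X in (_ < X)%N](cardsD1 i') i'T'.
  exact: HF.
have [||n [F [sF F0 Fn HF]]] := main #|[set: I]| (fun x => x = 0) setT (leqnn _).
- by split=> // a x y -> ->; rewrite scaler0 addr0.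
- by move=> x; exact: Hg.
exists n, (fun i => [pred x | `[< F i x >]] : {pred X}); split.
- by move=> i; exact: (submodP_closed _).1 (sF i).
- by move=> x; rewrite inE; apply/asboolP/eqP => /F0.
- by move=> x; rewrite inE; apply/asboolP.
move=> i /HF[F1 [y [Fy nFy]] Fmax]; split.
- by move=> x; rewrite !inE => /asboolP Fx; apply/asboolP/F1.
- move=> /(_ y); rewrite !inE => H.
  by apply: nFy; apply/asboolP/H/asboolP.
move=> U sU FU UF.
have sU' : submodP (fun x => x \in U).
  by case: sU => U0 UD; split=> // a x y; exact: UD.
have [x Fx|x Ux|H|H] := Fmax _ sU'.
- by apply: FU; rewrite inE; apply/asboolP.
- by have := UF x Ux; rewrite inE => /asboolP.
- by left=> x /H Fx; rewrite inE; apply/asboolP.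
- by right=> x; rewrite inE => /asboolP /H.
Qed.

End Loc.

(** * Finite length modules *)

Section FiniteLength.
Variable A : pzRingType.
Implicit Types M N : lmodType A.

Lemma finite_length_iso M N : mod_iso M N -> finite_length M -> finite_length N.
Proof.
move=> /mod_iso_sym/mod_iso_bij[g [gi gs]] [n [F [sF F0 Fn HF]]].
exists n, (fun i => [pred y | g y \in F i] : {pred N}); split.
- move=> i; have [F_0 FD] := sF i; split; first by rewrite inE linear0.
  by move=> a x y; rewrite !inE => Fx Fy; rewrite linearP; exact: FD.
- by move=> x; rewrite inE F0 raddf_eq0.
- by move=> x; rewrite inE.
move=> i /HF[F1 nF1 Fmax]; split.
- by move=> x; rewrite !inE; exact: F1.
- by move=> H; apply: nF1 => x; have [y <-] := gs x; move: (H y); rewrite !inE.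
move=> U sU FU UF.
have /choice[h hK] := gs.
have hg x : h (g x) = x by apply: gi; rewrite hK.
have hl : linear h by move=> a x y; apply: gi; rewrite linearP !hK.
have [h' Eh] := ex_linear hl.
have [|||H|H] := Fmax [pred x | h' x \in U].
- case: sU => U0 UD; split; first by rewrite inE linear0.
  by move=> a x y; rewrite !inE => Ux Uy; rewrite linearP; exact: UD.
- by move=> x Fx; rewrite inE Eh; apply: FU; rewrite inE hK.
- move=> x; rewrite inE Eh => Ux; have := UF _ Ux; by rewrite inE hK.
- by left=> x Ux; rewrite inE; apply: H; rewrite inE Eh hg.
- by right=> x; rewrite inE => /H; rewrite inE Eh hg.
Qed.

Lemma finite_length_zero M : zero_mod M -> finite_length M.
Proof.
move=> M0; exists 0, (fun=> predT : {pred M}); split=> // x.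
by rewrite (M0 x) eqxx.
Qed.

End FiniteLength.

(** Each composition factor is killed by r. Otherwise r is onto on a factor generated by some y, so
    y = r a y modulo F_i; Nakayama's lemma in L_p then gives y in F_i. *)
Lemma finite_length_nilpotent (R : comNzRingType) (L : algebra R)
    (p : prime_idealr R) (X : lmodType (loc_alg L p)) (r : R) :
  fin_gen (restrict (alg_map L) L^o) -> finite_length X -> r \in p ->
  exists n, forall x : X, ract (r ^+ n) x = 0.
Proof.
move=> fL [n [F [sF F0 Fn HF]]] rp.
have sP i : submodP (fun x => x \in F i) by case: (sF i) => U0 UD; split=> // a x y; exact: UD.
have down i x : (i < n)%N -> x \in F i.+1 -> ract r x \in F i.
  move=> /HF[F1 nF1 Fmax] Fx.
  have [y Fy nFy] : exists2 y, y \in F i.+1 & y \notin F i.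
    apply: contrapT => H; apply: nF1 => y Fy; apply: contrapT => nFy; apply: H.
    by exists y => //; apply/negP.
  pose U z := exists f w, [/\ f \in F i, w \in F i.+1 & z = f + ract r w].
  have sU : submodP U.
    split=> [|a _ _ [f [w [Ff Fw ->]]] [f' [w' [Ff' Fw' ->]]]].
      exists 0, 0; rewrite ract0 addr0; split=> //; [exact: (sP _).1|exact: (sP _).1].
    exists (a *: f + f'), (a *: w + w'); split; [exact: (sP _).2|exact: (sP _).2|].
    by rewrite scalerDr ractD ractZ; zmodule.
  pose W z := exists f (a : loc_alg L p), f \in F i /\ z = f + a *: y.
  have sW : submodP W.
    split=> [|a _ _ [f [b [Ff ->]]] [f' [b' [Ff' ->]]]].
      by exists 0, 0; rewrite scale0r addr0; split=> //; exact: (sP _).1.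
    exists (a *: f + f'), (a * b + b'); split; first exact: (sP _).2.
    by rewrite scalerDr scalerDl scalerA; zmodule.
  have [z Fz|z|H|H] := Fmax [pred z | `[< U z >]] ((submodP_closed _).1 sU).
  - rewrite inE; apply/asboolP; exists z, 0; rewrite ract0 addr0; split=> //; exact: (sP _).1.
  - rewrite inE => /asboolP[f [w [Ff Fw ->]]].
    by apply: (submodPD (sP i.+1)); [exact: F1 | exact: submodP_ract (sP i.+1) Fw].
  - apply: H; rewrite inE; apply/asboolP; exists 0, x; rewrite add0r; split=> //; exact: (sP _).1.
  exfalso.
  have [z Fz|z|H'|H'] := Fmax [pred z | `[< W z >]] ((submodP_closed _).1 sW).
  - by rewrite inE; apply/asboolP; exists z, 0; rewrite scale0r addr0.
  - rewrite inE => /asboolP[f [a [Ff ->]]].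
    by apply: (submodPD (sP i.+1)); [exact: F1 | exact: submodPZ (sP i.+1) Fy].
  - move/negP: nFy; apply; apply: H'; rewrite inE; apply/asboolP; exists 0, 1.
    by rewrite add0r scale1r; split=> //; exact: (sP _).1.
  have := H _ Fy; rewrite inE => /asboolP[f [w [Ff Fw Ey]]].
  have := H' _ Fw; rewrite inE => /asboolP[f' [a [Ff' Ew]]].
  (* The left ideal annihilating y modulo F_i. Each v differs from r v a by an element of it, so it
     is all of L_p. *)
  pose B (z : (loc_alg L p)^o) := ((z : loc_alg L p) *: y) \in F i.
  have sB : submodP B.
    split=> [|b z z' Bz Bz']; first by rewrite /B scale0r; exact: (sP _).1.
    by rewrite /B scalerDl -scalerA; exact: (sP i).2.
  move/negP: nFy; apply; rewrite -[y]scale1r -/(B 1).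
  have [I [g Hg]] := fin_gen_spanned fL (fin_gen_self (loc_alg L p)).
  apply: (nakayama (S := setT) (g := g) (sat_subP sB)) => [v|v].
    by apply: Hg; exact: sB.1.
  exists (ract r ((v : loc_alg L p) * a : (loc_alg L p)^o)); split; last first.
    by exists 1, (fun=> r), (fun=> v * a); rewrite big_ord1.
  have E : y - ract r (a *: y) = f + ract r f'.
    by rewrite {1}Ey Ew ractD; zmodule.
  rewrite /B scalerBl.
  have -> : (ract r (v * a : (loc_alg L p)^o) : loc_alg L p) *: y = v *: ract r (a *: y).
    by rewrite [LHS](_ : _ = ract r ((v * a : loc_alg L p) *: y)) ?ractZ -?scalerA // /ract scalerA.
  rewrite -scalerBr E; apply: (submodPZ _ (sP i)).
  by apply: (submodPD (sP i)) => //; exact: (submodP_ract r (sP i)).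
have all m x : (m <= n)%N -> x \in F m -> ract (r ^+ m) x = 0.
  elim: m x => [|m IH] x mn; first by rewrite F0 expr0 ract1 => /eqP.
  by move=> Fx; rewrite exprSr -ractA; apply: IH; [exact: ltnW | exact: down].
by exists n => x; apply: all.
Qed.

(** * Common denominators and the vanishing of Hom(P, -[1]) *)

Section LocMore.
Variables (R : comNzRingType) (L : algebra R) (p : prime_idealr R).
Notation Lp := (loc_alg L p).
Notation den := (den p).
Implicit Types (A B M N : lmodType L) (X Y Z : lmodType Lp).

Lemma common_den A Y (j : {linear A -> res Y}) (I : finType) (y : I -> Y) :
  dense j -> exists s : den, forall k, exists a, ract (dval s) (y k) = j a.
Proof.
move=> dj; have /choice[s Hs] := fun k => dj (y k).
have rp : \prod_k dval (s k) \notin p.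
  elim/big_ind: _ => [|a b ap bp|k _]; first by rewrite idealr1.
    by rewrite prime_idealrM negb_or ap.
  exact: (valP (s k)).
exists (den_of rp) => k; have [a Ea] := Hs k.
exists (ract (\prod_(i | i != k) dval (s i)) a).
by rewrite den_ofE (bigD1 k) //= mulrC -ractA Ea [RHS]ract_linear.
Qed.

(** Extension and restriction of scalars are adjoint: L_p-linear maps from a localization to Y are
    the L-linear maps to [res Y]. *)
Lemma ext_zero_res (P : complex L) Y :
  ext_zero (loc_complex p P) Y <-> ext_zero P (res Y).
Proof.
have [i1 [l1 H1]] := loc_can_ex p (P (-1)).
have [i0 [l0 H0]] := loc_can_ex p (P (succz (-1))).
have Hd x : cdiff (loc_complex p P) (-1) (i1 x) = i0 (cdiff P (-1) x).
  by rewrite H1 H0 /=; exact: loc_mapE.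
split=> H f.
  have [g Hg] := loc_lift f l1; have [h Hh] := H g; have [h' Hh'] := res_lin h.
  by exists (h' \o i0) => x; rewrite /= Hh' -Hd Hh Hg.
have [f' Hf'] := res_lin f; have [h Hh] := H (f' \o i1).
have [g Hg] := loc_lift h l0; exists g => w.
have [s [a E]] := l1.1 w; apply: (@ract_inj _ _ _ _ s).
rewrite -!(ract_linear (L := Lp)) E.
by rewrite Hd Hg Hh /= Hf'.
Qed.

(** P^-1 is finitely generated, so one denominator s moves a map P^-1 -> Y into the image of M; lift
    it, extend it over P^0, and divide by s. *)
Lemma ext_zero_dense (P : complex L) M Y (j : {linear M -> res Y}) :
  fg_projective (P (-1)) -> dense j -> ext_zero P M -> ext_zero P (res Y).
Proof.
move=> [[n [b Hb]] pP] dj H f.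
have [s Hs] := common_den (fun k => f (b k)) dj.
have [m Hm] := ract_lin (res Y) (dval s).
have [x|g Hg] := @lift_proj _ _ _ _ j (m \o f) pP.
  have [c ->] := Hb x; have /choice[a Ha] := Hs.
  exists (\sum_k c k *: a k); rewrite /= !linear_sum; apply: eq_bigr => k _.
  by rewrite !linearZ Hm -Ha.
have [h Hh] := H g; have [u Hu] := ract_inv Y s; have [u' Hu'] := res_lin u.
exists (u' \o j \o h) => x; apply: (@ract_inj _ _ _ _ s).
by rewrite /= Hu' Hu Hh Hg /= Hm.
Qed.

End LocMore.

(** * The map Phi on torsion classes *)

Section Torsion.
Variables (R : comNzRingType) (L : algebra R).
Hypothesis nL : noetherian_algebra L.
Implicit Types (A B M N : lmodType L) (T : lmodType L -> Prop).

Lemma tors_surj T M N (f : {linear M -> N}) :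
  is_torsion_class (@fin_gen L) T -> surj f -> T M -> T N.
Proof.
by move=> [TC _ _ _ Tq] sf TM; apply: Tq (fin_gen_surj sf (TC _ TM)) sf TM.
Qed.

Lemma tors_fg T M : is_torsion_class (@fin_gen L) T -> T M -> fin_gen M.
Proof. by move=> [TC _ _ _ _]; exact: TC. Qed.

Section AtPrime.
Variable p : prime_idealr R.
Notation Lp := (loc_alg L p).
Implicit Types X Y Z : lmodType Lp.

(** Lift generators of B to Y by [h], scale by t, and let S be the image in Y of this free module
    together with A. It is an extension of a quotient of B by a quotient of A, provided relations
    among the lifts land in A. *)
Lemma dense_sum A B Y Z X (f : {linear X -> Y}) (g : {linear Y -> Z})
    (i : {linear A -> res X}) (j : {linear B -> res Z}) T :
  is_torsion_class (@fin_gen L) T -> short_exact f g ->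
  T A -> T B -> dense i -> dense j ->
  exists C, T C /\ exists k : {linear C -> res Y}, dense k.
Proof.
move=> tT [fi gs fg] TA TB di dj.
have fA := tors_fg tT TA; have [m [b Hb]] := tors_fg tT TB.
have /choice[y Hy] := fun k => gs (j (b k)).
have [f' Ef] := res_lin f; have [g' Eg] := res_lin g.
have gf0 x : g (f x) = 0 by apply/fg; exists x.
have gf0' x : g' (f' x) = 0 by rewrite Eg Ef; exact: gf0.
have [h Hh] := free_ext (y : 'I_m -> res Y).
have Hgh c : g' (h c) = j (\sum_k (c k : L) *: b k).
  by rewrite Hh !linear_sum; apply: eq_bigr => k _; rewrite !linearZ Eg Hy.
have [I [k [Kk Hk]]] := fg_sub_algebra nL
  (fin_gen_copies 'I_m (fin_gen_self L)) (submodP_ker (g' \o h)).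
have /choice[x Hx] : forall l, exists x, f x = h (k l).
  by move=> l; apply/fg; rewrite -Eg; exact: Kk.
have [t /choice[a Ha]] := common_den x di.
(* The relations are finitely generated, so one denominator t brings all of them into the image of
   A. *)
have HK c : g' (h c) = 0 -> exists a, ract (dval t) (h c) = f' (i a).
  move=> /Hk[d ->]; exists (\sum_l d l *: a l).
  rewrite !linear_sum ract_sum; apply: eq_bigr => l _.
  by rewrite !linearZ -ractZ -Hx -Ef -Ha (ract_linear f').
pose V : lmodType L := ({ffun 'I_m -> L^o} * A)%type.
have [psi Hpsi] : exists psi : {linear V -> res Y},
    forall v, psi v = ract (dval t) (h v.1) + f' (i v.2).
  apply: ex_linear => c v w; rewrite !linearP /= ractD scalerDr ractZ.
  by zmodule.
have [S [e [iota [se ii E]]]] := image_factor psi.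
have fS : fin_gen S.
  apply: fin_gen_surj se _; apply: fin_gen_prod => //.
  exact/fin_gen_copies/fin_gen_self.
exists S; split; last first.
  exists iota => z; have [s [b' Eb]] := dj (g z).
  have [c Ec] := Hb b'.
  pose c' : {ffun 'I_m -> L^o} := [ffun k => c k].
  have Ec' : g' (h c') = j b'.
    by rewrite Hgh Ec; congr (j _); apply: eq_bigr => l _; rewrite ffunE.
  have /fg[x' Ex'] : g (ract (dval s) z - h c') = 0.
    by rewrite linearB (ract_linear g) Eb -Eg Ec' subrr.
  have [s' [a' Ea']] := di x'.
  exists (denM t (denM s' s)), (e (ract (dval s') c', ract (dval t) a')).
  rewrite E Hpsi /= !(ract_linear h) !(ract_linear i) -Ea' !(ract_linear f') Ef Ex'.
  rewrite -!res_ract !dvalE !ractB !ractA.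
  by rewrite mulrA; zmodule.
have [S2 [e2 [i2 [se2 ii2 E2]]]] := image_factor (g' \o iota).
have [S1 [i1 [ii1 Hi1]]] := sub_ex (submodP_ker e2).
have TS1 : T S1.
  have /ex_linear[u Hu] : linear (fun a' : A => e (0, a')).
    by move=> c v w; rewrite -linearP; congr (e (_, _)); rewrite /= scaler0 addr0.
  have [z|v Hv] := @factor_inj _ S1 S A i1 u ii1.
    apply/Hi1; apply: ii2; rewrite E2 /= Hu E Hpsi /= !linear0 ract0 add0r.
    exact: gf0'.
  apply: (tors_surj (f := v) tT _ TA) => s1.
  have [[c a'] Ev] := se (i1 s1).
  have /HK[a'' Ea''] : g' (h c) = 0.
    apply: (@ract_eq0 _ _ _ _ t); rewrite res_ract -(ract_linear g').
    have : i2 (e2 (i1 s1)) = 0 by rewrite (Hi1 _).2 ?linear0 //; exists s1.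
    by rewrite E2 /= -Ev E Hpsi linearD gf0' addr0.
  exists (a'' + a'); apply: ii1; rewrite Hv Hu -Ev; apply: ii.
  by rewrite !E !Hpsi /= linear0 ract0 add0r Ea'' !linearD.
have TS2 : T S2.
  have [r Hr] := ract_lin (res Z) (dval t).
  have [z|v Hv] := @factor_inj _ S2 _ B i2 (r \o j) ii2.
    have [c ->] := Hb z; exists (e2 (e ([ffun k => c k], 0))).
    rewrite E2 /= E Hpsi /= !linear0 addr0 (ract_linear g') Hgh Hr.
    by congr (ract _ (j _)); apply: eq_bigr => l _; rewrite ffunE.
  apply: (tors_surj (f := v) tT _ TB) => s2.
  have [s <-] := se2 s2; have [[c a'] <-] := se s.
  exists (\sum_k (c k : L) *: b k); apply: ii2; rewrite Hv /= Hr -Hgh E2 /= E Hpsi.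
  by rewrite linearD (ract_linear g') gf0' addr0.
have [_ _ _ Text _] := tT.
apply: (Text S1 S S2 i1 e2) => //; split=> // s; exact: Hi1.
Qed.

Lemma Phi_torsion T : is_torsion_class (@fin_gen L) T ->
  is_torsion_class (@finite_length Lp) (@Phi R L T p).
Proof.
move=> tT; split.
- by move=> X [].
- move=> X X0; split; last exact: finite_length_zero.
  apply/(loc_class_dense _ tT); exists (res X); split.
    by case: tT => _ Tz _ _ _; apply: Tz.
  by exists idfun; exact: (loc_self X).1.
- move=> X Y XY [[A TA XA] fX]; split; last exact: finite_length_iso fX.
  by exists A => //; apply: mod_iso_trans XA; exact: mod_iso_sym.
- move=> X Y Z f g fY ex [/(loc_class_dense _ tT)[A [TA [i di]]] _].
  move=> [/(loc_class_dense _ tT)[B [TB [j dj]]] _].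
  split=> //; apply/(loc_class_dense _ tT); exact: dense_sum ex TA TB di dj.
- move=> X Y f fY sf [/(loc_class_dense _ tT)[A [TA [i di]]] _].
  split=> //; apply/(loc_class_dense _ tT); exists A; split=> //.
  have [f' Ef] := res_lin f; exists (f' \o i) => y.
  have [x <-] := sf y; have [s [a E]] := di x; exists s, a.
  by rewrite /= Ef -E (ract_linear f).
Qed.

Lemma mod_p_finite_length X : fin_gen X -> finite_length (mod_p p X).
Proof.
move=> fX; have [pi [spi kpi]] := mod_pP X.
apply: (finite_length_killed nL.2) => [|r y rp]; first exact: fin_gen_surj spi fX.
have [x <-] := spi y; rewrite -(ract_linear pi); apply/kpi.
by exists 1, (fun=> r), (fun=> x); rewrite big_ord1.
Qed.

Lemma Phi_mod_p T A X (j : {linear A -> res X}) :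
  is_torsion_class (@fin_gen L) T -> T A -> dense j -> Phi T (mod_p p X).
Proof.
move=> tT TA dj; split; last first.
  by apply: mod_p_finite_length; apply: dense_fin_gen dj; exact: tors_fg tT TA.
have [pi [spi kpi]] := mod_pP X; have [pi' Epi] := res_lin pi.
apply/(loc_class_dense _ tT); exists A; split=> //; exists (pi' \o j) => y.
have [x <-] := spi y; have [s [a E]] := dj x; exists s, a.
by rewrite /= Epi -E (ract_linear pi).
Qed.

End AtPrime.

Lemma loc_loc (p q : prime_idealr R) A : spec_le q p ->
  mod_iso (loc_mod q A) (loc_mod q (res (loc_mod p A))).
Proof.
move=> qp.
have [i [[di ki] _]] := loc_can_ex p A.
have [k [[dk kk] _]] := loc_can_ex q (res (loc_mod p A)).
have [l [ll _]] := loc_can_ex q A.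
have nq (s : den p) : dval s \notin q.
  by apply/negP => /qp; apply/negP; exact: (valP s).
apply: (loc_unique ll (j := k \o i)); split=> [y|a].
  have [s [w E]] := dk y; have [t [a Ea]] := di w.
  exists (denM (den_of (nq t)) s), a.
  by rewrite /= dvalE den_ofE -ractA E -Ea (ract_linear k).
move=> /kk[s]; rewrite -(ract_linear i) => /ki[t Et].
by exists (denM (den_of (nq t)) s); rewrite dvalE den_ofE -ractA.
Qed.

Lemma Phi_Tc T : is_torsion_class (@fin_gen L) T -> Tc (@Phi R L T).
Proof.
move=> tT; split=> [p|p q qp Y [[A TA YA] fY]]; first exact: Phi_torsion.
split=> //; exists (loc_mod p A); last first.
  by apply: mod_iso_trans YA _; exact: loc_loc.
have [i [[di _] _]] := loc_can_ex p A.
by split; [exact: loc_fin_gen (tors_fg tT TA) | exact: Phi_mod_p tT TA di].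
Qed.

Lemma prime_of_pred (D : R -> Prop) : D 0 -> ~ D 1 ->
  (forall a x y, D x -> D y -> D (a * x + y)) ->
  (forall x y, D (x * y) -> D x \/ D y) ->
  exists p : prime_idealr R, forall r, r \in p <-> D r.
Proof.
move=> D0 D1 DD DM.
pose S : {pred R} := [pred r | `[< D r >]].
have inS r : (r \in S) = `[< D r >] by rewrite inE.
have Sid : idealr_closed S.
  split; [by rewrite inS; apply/asboolP | by rewrite inS; apply/negP => /asboolP |].
  move=> a x y; rewrite !inS => /asboolP Dx /asboolP Dy.
  by apply/asboolP; exact: DD.
have Spr : prime_idealr_closed S.
  move=> x y; rewrite !inS => /asboolP /DM[Dx|Dy]; apply/orP.
    by left; apply/asboolP.
  by right; apply/asboolP.
pose p : prime_idealr R := HB.pack (S : R -> bool)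
  (isIdealr.Build R S Sid) (isPrimeIdealrClosed.Build R S Spr).
exists p => r; have -> : (r \in p) = `[< D r >] by exact: inS.
by split=> /asboolP.
Qed.

End Torsion.

Section Reflect.
Variables (R : comNzRingType) (L : algebra R).
Hypothesis nL : noetherian_algebra L.

(* A counterexample M all of whose proper quotients lie in T' has no nonzero
   submodule in T', and its annihilator p is a prime such that M is torsion free
   over R/p. Then M_p = M_p / p M_p contains a nonzero submodule in T', and
   multiplying by a denominator moves it into M. *)
Lemma Phi_reflect (T T' : lmodType L -> Prop) :
  is_torsion_class (@fin_gen L) T -> is_torsion_class (@fin_gen L) T' ->
  (forall (p : prime_idealr R) Y, @Phi R L T p Y -> @Phi R L T' p Y) ->
  forall M, T M -> T' M.
Proof.
move=> tT tT' TT' M0 TM0; apply: contrapT => nTM0.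
have [_ Tz _ Text _] := tT'.
pose Pr (U : M0 -> Prop) := exists (Q : lmodType L) (pi : {linear M0 -> Q}),
  [/\ surj pi, forall x, pi x = 0 <-> U x & ~ T' Q].
have [|||U [sU [M [pi [spi kpi nTM]]] Umax]] := @maximal_sub _ _ nL M0 Pr (fun x => x = 0).
- exact: tors_fg tT TM0.
- by split=> // a x y -> ->; rewrite scaler0 addr0.
- by exists M0, idfun; split=> // y; exists y.
have TM : T M := tors_surj tT spi TM0.
have fM := tors_fg tT TM.
(* Maximality of U: every proper quotient of M is in T'. *)
have quo (N : lmodType L) (rho : {linear M -> N}) x : surj rho -> x <> 0 -> rho x = 0 -> T' N.
  move=> srho x0 rx; apply: contrapT => nTN.
  have [z Ez] := spi x; apply: x0; rewrite -Ez; apply/kpi.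
  apply: (Umax (fun z => rho (pi z) = 0)).
  - exact: (submodP_ker (rho \o pi)).
  - exists N, (rho \o pi); split=> // y.
    by have [w <-] := srho y; have [v <-] := spi w; exists v.
  - by move=> w /kpi->; rewrite linear0.
  - by rewrite Ez.
have nosub (N : lmodType L) (i : {linear N -> M}) : injective i -> T' N -> zero_mod N.
  move=> ii TN x; apply: contrapT => x0.
  have [Q [rho [srho krho]]] := quot_ex (submodP_image i).
  have TQ : T' Q.
    apply: (quo Q rho (i x)) => //; last by apply/krho; exists x.
    by rewrite -[0](linear0 i) => /ii.
  by apply: nTM; apply: (Text N M Q i rho).
(* If r kills a nonzero x, then r M is a proper quotient of M, hence in T', and a submodule of M,
   hence zero. *)
have reg r (x y : M) : x <> 0 -> ract r x = 0 -> ract r y = 0.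
  move=> x0 rx; have [f Ef] := ract_lin M r.
  have [S [e [i [se ii E]]]] := image_factor f.
  have S0 : zero_mod S.
    apply: (nosub S i ii); apply: (quo S e x) => //.
    by apply: ii; rewrite E Ef rx linear0.
  by rewrite -Ef -E (S0 (e y)) linear0.
have [m m0] : exists m : M, m <> 0.
  apply: contrapT => nM; apply: nTM; apply: Tz => // x.
  by apply: contrapT => x0; apply: nM; exists x.
have [|||a b H|p Hp] := @prime_of_pred R (fun r => forall x : M, ract r x = 0).
- by move=> x; rewrite ract0l.
- by move=> /(_ m); rewrite ract1.
- by move=> a r s Hr Hs x; rewrite ractDl -ractA Hr Hs ract0 addr0.
- have [Hb|/existsNP[x bx]] := EM (forall x : M, ract b x = 0); first by right.
  by left=> y; apply: (reg _ _ _ bx); rewrite ractA.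
have [i [[di ki] _]] := loc_can_ex p M.
have [rho [srho krho]] := mod_pP (loc_mod p M).
pose Y := mod_p p (loc_mod p M : lmodType (loc_alg L p)).
have [A TA] : exists2 A, T' A & exists j : {linear A -> res Y}, dense j.
  have [/(loc_class_dense _ tT')[A [TA dA]] _] := TT' _ _ (Phi_mod_p nL tT TM di).
  by exists A.
move=> [j dj].
have [rho' Er] := res_lin rho.
pose k : {linear M -> res Y} := rho' \o i.
have sreg (s : den p) (x : M) : ract (dval s) x = 0 -> x = 0.
  move=> sx; apply: contrapT => x0; have := valP s; rewrite -/(dval s) => /negP; apply.
  by apply/Hp => y; apply: reg sx.
have kill (r : R) (w : loc_mod p M) : r \in p -> ract (L := loc_alg L p) r w = 0.
  move=> /Hp rM; have [s [x E]] := di w; apply: (@ract_eq0 _ _ _ _ s).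
  rewrite ractA mulrC -ractA E; rewrite -[LHS](ract_linear i) rM; exact: linear0.
have ik : injective k.
  apply: inj_lin => x; rewrite /k /= Er => /krho[n [r [y [rp Ex]]]].
  have /ki[s /sreg//] : i x = 0.
  by rewrite Ex big1 // => l _; apply: kill.
have dk : dense k.
  move=> y; have [w <-] := srho y; have [s [x E]] := di w; exists s, x.
  by rewrite /k /= Er -E (ract_linear rho).
have [n [a Ha]] := tors_fg tT' TA.
have [s /choice[b Hb]] := common_den (fun l => j (a l)) dk.
have [r Hr] := ract_lin (res Y) (dval s).
(* After scaling by s, the map [j] lands in the copy of M inside Y. Its image is a submodule of M in
   T', hence zero, which forces j = 0 and Y = 0. *)
have [x|sig Hsig] := @factor_inj _ M _ _ k (r \o j) ik.
  have [c ->] := Ha x; exists (\sum_l c l *: b l).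
  rewrite /= !linear_sum; apply: eq_bigr => l _.
  by rewrite !linearZ Hr -res_ract Hb.
have [S [e [i' [se ii' E]]]] := image_factor sig.
have S0 : zero_mod S by apply: (nosub S i' ii'); exact: tors_surj tT' se TA.
have j0 x : j x = 0.
  apply: (@ract_eq0 _ _ _ _ s); rewrite res_ract -Hr.
  by have /= <- := Hsig x; rewrite -E (S0 (e x)) !linear0.
apply: m0; apply: ik; rewrite linear0.
have [t [x Ex]] := dj (k m); apply: (@ract_eq0 _ _ _ _ t); by rewrite Ex j0.
Qed.

End Reflect.

(** * Silting classes *)

Section Silting.
Variable A : pzRingType.
Implicit Types (P Q : complex A) (M : lmodType A).

Lemma silt_le_quo P Q M : strict_two_term P -> strict_two_term Q -> is_silting P ->
  silt_le Q P -> quo Q M -> quo P M.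
Proof.
move=> sP sQ iP QP qM; apply: ext_zero_quo => //; first exact: quo_fin_gen sQ qM.
exact: quo_ext_zero QP qM.
Qed.

Lemma silt2_refl (S : silt2 A) : silt2_le S S.
Proof.
have [P SP _] := silt2_strict S.
by apply/(silt2_leP SP SP); have [[_ H _] _] := silt2_mem SP.
Qed.

(** A silting module is H^0 of a complex that is two-term only up to homotopy equivalence; here it
    is exchanged for a strict representative of the same class. *)
Lemma gen_H0_class (S : silt2 A) P Q M : S P -> S Q -> strict_two_term Q ->
  gen_by (H0 P) M <-> gen_by (H0 Q) M.
Proof.
move=> SP SQ sQ.
have sil Z : S Z -> is_silting Z by move=> /silt2_mem[].
have [_ [P' [kP' PP' zP']]] := silt2_mem SP.
have sP' : strict_two_term P' by [].
have SP' : S P'.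
  have [W sW HW] := silt2P S; have [tP WP] := (HW P).1 SP.
  have [tP' PP'a] := two_silting_hiso tP PP' sP'.
  by apply/HW; split=> // X; rewrite WP.
have E : gen_by (H0 P) M <-> gen_by (H0 P') M.
  have [s ss] := H0_surj PP'; have [t tt] := H0_surj (hiso_sym PP').
  by split; [exact: gen_by_surj tt | exact: gen_by_surj ss].
rewrite E !gen_H0 //; split; apply: silt_le_quo => //; try exact: sil.
  by apply/(silt2_leP SP' SQ); exact: silt2_refl.
by apply/(silt2_leP SQ SP'); exact: silt2_refl.
Qed.

End Silting.

(** * Exactness of localization *)

Lemma loc_mod_zero (R : comNzRingType) (L : algebra R) (p : prime_idealr R)
    (M : lmodType L) : zero_mod M -> zero_mod (loc_mod p M).
Proof.
by move=> M0 w; have [x [s <-]] := fracP w; rewrite (M0 x); exact: frac0.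
Qed.

Lemma loc_map_exact (R : comNzRingType) (L : algebra R) (p : prime_idealr R)
    (X Y Z : lmodType L) (f : {linear X -> Y}) (g : {linear Y -> Z})
    (f' : {linear res (loc_mod p X) -> res (loc_mod p Y)})
    (g' : {linear res (loc_mod p Y) -> res (loc_mod p Z)}) :
  (forall w, f' w = loc_map f w) -> (forall w, g' w = loc_map g w) ->
  short_exact f g -> short_exact f' g'.
Proof.
move=> Ef Eg [fi gs fg]; split.
- apply: inj_lin => w; have [x [s <-]] := fracP w; rewrite Ef loc_mapE.
  rewrite -(frac0 Y (den1 p)) => /frac_eq[u]; rewrite dvalE ract1 ract0 ract0.
  move=> E; rewrite -(frac0 X (den1 p)); apply/frac_eq; exists u.
  by rewrite dvalE ract1 !ract0; apply: fi; rewrite linear0 (ract_linear f).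
- move=> w; have [z [s <-]] := fracP w; have [y <-] := gs z.
  by exists (Defs.frac y s); rewrite Eg; exact: loc_mapE.
move=> w; have [y [s <-]] := fracP w; rewrite Eg loc_mapE; split.
  rewrite -(frac0 Z (den1 p)) => /frac_eq[u]; rewrite dvalE ract1 ract0 ract0.
  rewrite -(ract_linear g) => /fg[x Ex].
  by exists (Defs.frac x (denM u s)); rewrite Ef loc_mapE Ex; exact: frac_simpl.
move=> [v]; have [x [t <-]] := fracP v; rewrite Ef loc_mapE => /frac_eq[u E].
rewrite -(frac0 Z (den1 p)); apply/frac_eq; exists (denM u t).
rewrite !dvalE ract1 !ract0 -ractA -!(ract_linear g) -E.
by rewrite !(ract_linear g) (fg _).2 ?ract0 //; exists x.
Qed.

(** * Torsion classes and silting complexes under the two hypotheses *)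

Section Main.
Variables (R : comNzRingType) (L : algebra R).
Hypothesis nL : noetherian_algebra L.
Hypothesis silt_iso : forall p : prime_idealr R, loc_silt_iso L p.
Hypothesis tors_silt : forall p : prime_idealr R, all_tors_silting L p.
Implicit Types (P Q : complex L) (S T : silt2 L).

Definition silt_class P p (Y : lmodType (loc_alg L p)) : Prop :=
  gen_by (H0 (loc_complex p P)) Y /\ finite_length Y.

Lemma silt_loc S P p : S P -> strict_two_term P ->
  is_silting (loc_complex p P) /\ strict_two_term (loc_complex p P).
Proof.
move=> SP sP; have [F [HF _]] := silt_iso p.
have [iP _] := silt2_mem (HF _ _ SP); split=> //; split; first by case: iP.
by move=> i i1 i0; apply: loc_mod_zero; exact: sP.2.
Qed.

Lemma silt_classP S P p Y : S P -> strict_two_term P ->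
  @silt_class P p Y <-> [/\ fin_gen Y, ext_zero (loc_complex p P) Y & finite_length Y].
Proof.
move=> SP sP; have [iP' sP'] := silt_loc p SP sP; rewrite /silt_class gen_H0 //.
split=> [[qY fY]|[fg eY fY]]; split=> //.
- exact: quo_fin_gen sP' qY.
- by apply: quo_ext_zero qY => //; case: iP'.
- exact: ext_zero_quo.
Qed.

(** By (ii) the class comes from a silting complex over L_p, and by (i) its additive equivalence
    class descends to L. *)
Lemma torsion_silt_class p (C : lmodType (loc_alg L p) -> Prop) :
  is_torsion_class (@finite_length (loc_alg L p)) C ->
  exists S P, [/\ S P, strict_two_term P & forall Y, C Y <-> silt_class P Y].
Proof.
move=> /tors_silt[M [P' tP' MP'] HC]; have [F [HF [[G FG GF] _]]] := silt_iso p.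
have [S' SP'] := silt2_of tP'.
have [P SP sP] := silt2_strict (G S').
exists (G S'), P; split=> // Y; rewrite HC.
have SlP : S' (loc_complex p P) by rewrite -(GF S'); exact: HF.
have [_ sP2] := silt_loc p SP sP.
have E := gen_H0_class Y SP' SlP sP2; rewrite /silt_class -E.
have [f [_ sf]] := mod_iso_bij MP'; have [g [_ sg]] := mod_iso_bij (mod_iso_sym MP').
split=> -[gY fY]; split=> //; first exact: gen_by_surj sg gY.
exact: gen_by_surj sf gY.
Qed.

(** The right side concerns one fixed prime and the left side none, which is what links the
    components of a family at different primes. *)
Lemma silt2_le_class S T P Q p : S P -> strict_two_term P -> T Q -> strict_two_term Q ->
  silt2_le S T <-> forall Y, @silt_class P p Y -> silt_class Q Y.
Proof.
move=> SP sP TQ sQ; have [F [HF [_ Fle]]] := silt_iso p.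
have [iP' sP'] := silt_loc p SP sP; have [iQ' sQ'] := silt_loc p TQ sQ.
rewrite Fle (silt2_leP (HF _ _ SP) (HF _ _ TQ)); split=> [PQ Y|H].
  by move=> [/(gen_H0 _ sP') qY fY]; split=> //; apply/gen_H0 => //; exact: silt_le_quo PQ qY.
apply: ext_zero_silt_le => //; apply: (ext_zero_mod_p nL.2) => //.
  exact: quo_fin_gen sP' (quo_H0 sP').
(* The test module is H^0(P_p) modulo p: it has finite length and lies in the class of P, and
   Nakayama's lemma recovers H^0(P_p) from it. *)
have [pi [spi _]] := mod_pP (H0 (loc_complex p P) : lmodType (loc_alg L p)).
have [|_ eV _] := (silt_classP _ TQ sQ).1 (H (mod_p p (H0 (loc_complex p P) : lmodType (loc_alg L p))) _).
  split; last by apply: mod_p_finite_length => //; exact: quo_fin_gen sP' (quo_H0 sP').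
  by apply/gen_H0 => //; apply: quo_surj spi _; exact: quo_H0.
exact: eV.
Qed.

(** Vanishing of Hom(P, -[1]) goes from X/pX to X by Nakayama's lemma and on to X_q by density. So
    at q the class of Q is contained in that of P, and this decides the order. *)
Lemma r_pq_silt_le S T P Q p q (C : lmodType (loc_alg L p) -> Prop)
    (D : lmodType (loc_alg L q) -> Prop) :
  S P -> strict_two_term P -> T Q -> strict_two_term Q ->
  (forall Y, C Y <-> silt_class P Y) -> (forall Y, D Y <-> silt_class Q Y) ->
  (forall Y, D Y -> @r_pq R L p q C Y) -> silt2_le T S.
Proof.
move=> SP sP TQ sQ HC HD H; apply/(silt2_le_class q TQ sQ SP sP) => Y.
move=> cY; have [fgY _ fY] := (silt_classP _ TQ sQ).1 cY.
move: cY => /HD/H[_ [X [fX /HC/(silt_classP _ SP sP)[_ eX _]] YX]].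
apply/(silt_classP _ SP sP); split=> //.
have [iP' sP'] := silt_loc p SP sP.
have {}eX := (ext_zero_res P X).1 (ext_zero_mod_p nL.2 sP' fX eX).
have [i [[di _] _]] := loc_can_ex q (res X).
have eY := (ext_zero_res P _).2 (ext_zero_dense (strict_kb (-1) sP) di eX).
have [f [_ sf]] := mod_iso_bij (mod_iso_sym YX).
have [_ sP2] := silt_loc q SP sP.
exact: ext_zero_surj (strict_kb (-1) sP2).2 sf eY.
Qed.

Lemma hom_poset_torsion (g : hom_poset (@spec_le R) (@silt2_le L)) :
  exists T : tors (@fin_gen L), forall p, exists P,
    [/\ g p P, strict_two_term P & forall Y, @Phi R L T p Y <-> silt_class P Y].
Proof.
have /dep_choice[P HP] : forall p : prime_idealr R, exists P, g p P /\ strict_two_term P.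
  by move=> p; have [P gP sP] := silt2_strict (g p); exists P.
pose T (M : lmodType L) := fin_gen M /\ forall p, ext_zero (P p) (res (loc_mod p M)).
have pP p i : projective (P p i) by case: (strict_kb i (HP p).2).
have surjT (M N : lmodType L) (f : {linear M -> N}) : surj f -> T M -> T N.
  move=> sf [fM eM]; split=> [|p]; first exact: fin_gen_surj sf fM.
  have [f' Ef] := @res_lin R L p _ _ (loc_map f).
  apply: (ext_zero_surj (f := f') (pP _ _) _ (eM p)) => w.
  have [y [s <-]] := fracP w; have [x <-] := sf y.
  by exists (Defs.frac x s); rewrite Ef; exact: loc_mapE.
have tT : is_torsion_class (@fin_gen L) T.
  split.
  - by move=> X [].
  - move=> X X0; split=> [|p]; first by exists 0, (fun=> 0) => x; exists (fun=> 0); rewrite big_ord0 (X0 x).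
    by move=> f; exists \0 => x; rewrite [RHS](loc_mod_zero X0).
  - by move=> X Y /mod_iso_bij[f [_ sf]]; exact: surjT.
  - move=> X Y Z f g' fY ex [fX eX] [fZ eZ]; split=> // p.
    have [f2 Ef] := @res_lin R L p _ _ (loc_map f).
    have [g2 Eg] := @res_lin R L p _ _ (loc_map g').
    exact: ext_zero_ext (pP _ _) (loc_map_exact Ef Eg ex) (eX p) (eZ p).
  - by move=> X Y f fY sf; exact: surjT.
exists (Tors tT) => p; exists (P p); have [gP sP] := HP p; split=> // Y.
rewrite (silt_classP _ gP sP); split.
  move=> [[M [fM eM] YM] fY]; split=> //.
    apply: fin_gen_iso (mod_iso_sym YM) _; exact: loc_fin_gen.
  have [f [_ sf]] := mod_iso_bij (mod_iso_sym YM).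
  have [_ sP2] := silt_loc p gP sP.
  exact: ext_zero_surj (strict_kb (-1) sP2).2 sf ((ext_zero_res _ _).2 (eM p)).
move=> /(silt_classP _ gP sP)[gY fY].
have [_ sP2] := silt_loc p gP sP.
have [I [u [u0 Hu]]] := (gen_H0 _ sP2).1 gY.
have [i0 [l0 H0]] := loc_can_ex p (P p (succz (-1))).
have [i1 [l1 H1]] := loc_can_ex p (P p (-1)).
have Hd x : cdiff (loc_complex p (P p)) (-1) (i1 x) = i0 (cdiff (P p) (-1) x).
  by rewrite H1 H0 /=; exact: loc_mapE.
have /dep_choice[v Hv] : forall i, exists v : {linear P p (succz (-1)) -> res Y},
    forall x, v x = u i (i0 x).
  by move=> i; have [u' Eu] := res_lin (u i); exists (u' \o i0) => x; rewrite /= Eu.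
have [j Hj] := copies_sum v.
have dj : dense j.
  move=> y; have [x ->] := Hu y.
  elim/big_ind: _ => [|y1 y2 [s [a Ea]] [t [b Eb]]|i _].
  - by exists (den1 p), 0; rewrite ract0 linear0.
  - exists (denM s t), (ract (dval t) a + ract (dval s) b).
    rewrite linearD !(ract_linear j) -Ea -Eb -!res_ract !ractA dvalE ractD.
    by rewrite (mulrC (dval t)).
  have [s [a Ea]] := l0.1 (x i).
  exists s, [ffun k => if k == i then a else 0].
  rewrite Hj (bigD1 i) //= ffunE eqxx big1 ?addr0 => [|k ki].
    by rewrite Hv -Ea (ract_linear (u i)).
  by rewrite ffunE (negbTE ki) linear0.
have [M [e [iota [se ii E dM]]]] := dense_image dj.
(* [M] embeds in [Y], so the maps from P^0 still kill boundaries before localization. *)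
have qM : quo (P p) M.
  have /dep_choice[w Hw] : forall i, exists w : {linear P p (succz (-1)) -> M},
      forall x, iota (w x) = v i x.
    move=> i; apply: factor_inj ii _ => x.
    exists (e [ffun k => if k == i then x else 0]); rewrite E Hj (bigD1 i) //= ffunE eqxx.
    by rewrite big1 ?addr0 // => k ki; rewrite ffunE (negbTE ki) linear0.
  exists I, w; split=> [i x|y].
    by apply: ii; rewrite Hw Hv -Hd u0 linear0.
  have [x <-] := se y; exists x; apply: ii; rewrite E Hj linear_sum.
  by apply: eq_bigr => i _; rewrite Hw.
have fM : fin_gen M := quo_fin_gen sP qM.
split=> //; exists M; last first.
  by have [k [lk _]] := loc_can_ex p M; exact: loc_unique dM lk.
split=> // q; have [i [[di ki] _]] := loc_can_ex q M.
(* If p is contained in q, monotonicity gives P_p <= P_q, which suffices as M is a quotient of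
   copies of H^0(P_p). Otherwise M_q = 0. *)
have [pq|npq] := EM (spec_le p q).
  apply: ext_zero_dense (strict_kb (-1) (HP q).2) di _.
  apply: quo_ext_zero (HP q).2 sP _ qM.
  by apply/(silt2_leP gP (HP q).1); exact: (hom_mono g pq).
have [r rp rq] : exists2 r, r \in p & r \notin q.
  apply: contrapT => H; apply: npq => r rp; apply: contrapT => rq; apply: H.
  by exists r => //; apply/negP.
(* A power of r kills Y, hence its submodule M, and it is invertible at q. *)
have [n Hn] := finite_length_nilpotent nL.2 fY rp.
have rn : r ^+ n \notin q.
  elim: n {Hn} => [|n IH]; first by rewrite expr0 idealr1.
  by rewrite exprS prime_idealrM negb_or rq.
move=> f; exists \0 => x; rewrite [RHS](_ : _ = 0) //.
have [s [a Ea]] := di (f x); apply: (@ract_eq0 _ _ _ _ s); rewrite Ea.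
apply: (@ract_eq0 _ _ _ _ (den_of rn)); rewrite den_ofE res_ract -(ract_linear i).
rewrite [ract _ a](_ : _ = 0) ?linear0 //; apply: ii.
by rewrite linear0 (ract_linear iota); exact: Hn.
Qed.

End Main.

Lemma tors_eq (A : pzRingType) (C : lmodType A -> Prop) (T T' : tors C) :
  tors_le T T' -> tors_le T' T -> T = T'.
Proof.
case: T T' => [T tT] [T' tT'] /= H H'.
have E : T = T'.
  by apply/funext => X; apply/propext; split; [exact: H | exact: H'].
by subst T'; congr Tors; exact: Prop_irrelevance.
Qed.

Lemma hom_poset_eq (X Y : Type) (leX : X -> X -> Prop) (leY : Y -> Y -> Prop)
    (f g : hom_poset leX leY) : (forall x, f x = g x) -> f = g.
Proof.
case: f g => [f Hf] [g Hg] /= /funext E; subst g.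
by congr HomPoset; exact: Prop_irrelevance.
Qed.

Theorem theorem1p6 (R : comNzRingType) (L : algebra R) :
  noetherian_algebra L ->
  ring_indecomposable R ->
  (forall p : prime_idealr R, loc_silt_iso L p) ->
  (forall p : prime_idealr R, all_tors_silting L p) ->
  compatible L /\
  exists f : tors (@fin_gen L) -> hom_poset (@spec_le R) (@silt2_le L),
    poset_iso (@tors_le L (@fin_gen L))
      (@hom_le _ _ (@spec_le R) (@silt2_le L)) f.
Proof.
move=> nL _ si ts.
(* Both halves start here: a compatible family, in particular any image of [Phi], is given by a
   monotone map to 2-silt L. *)
have mono (X : forall p : prime_idealr R, lmodType (loc_alg L p) -> Prop) : Tc X ->
    exists g : hom_poset (@spec_le R) (@silt2_le L), forall p, exists P,
      [/\ g p P, strict_two_term P & forall Y, X p Y <-> silt_class P Y].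
  move=> [tX rX].
  have /dep_choice[S] := fun p => torsion_silt_class si ts (tX p).
  move=> /dep_choice[P HP].
  have Sm q p : spec_le q p -> silt2_le (S q) (S p).
    move=> qp; have [SP sP XP] := HP p; have [SQ sQ XQ] := HP q.
    exact: (r_pq_silt_le nL si SP sP SQ sQ XP XQ (rX p q qp)).
  by exists (HomPoset Sm) => p; exists (P p).
split=> [X|].
  split=> [[T XT]|/mono[g Hg]].
    have -> : X = @Phi R L T.
      apply: functional_extensionality_dep => p; apply/funext => Y; apply/propext; exact: XT.
    by have := Phi_Tc nL (torsP T).
  have [T HT] := hom_poset_torsion nL si g; exists T => p Y.
  have [P [gP sP XP]] := Hg p; have [Q [gQ sQ TQ]] := HT p.
  rewrite XP TQ; split; move: Y; apply/(silt2_le_class nL si) => //;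
    try exact: gP; try exact: gQ; exact: silt2_refl.
have /choice[f Hf] := fun T : tors (@fin_gen L) => mono _ (Phi_Tc nL (torsP T)).
have fle T T' : tors_le T T' <-> hom_le (f T) (f T').
  split=> [TT' p|H].
    have [P [fP sP TP]] := Hf T p; have [Q [fQ sQ TQ]] := Hf T' p.
    apply/(silt2_le_class nL si p fP sP fQ sQ) => Y /TP[[M TM YM] fY].
    by apply/TQ; split=> //; exists M => //; exact: TT'.
  move=> M; apply: (Phi_reflect nL (torsP T) (torsP T')) => p Y.
  have [P [fP sP TP]] := Hf T p; have [Q [fQ sQ TQ]] := Hf T' p.
  by move=> /TP cY; apply/TQ; exact: ((silt2_le_class nL si p fP sP fQ sQ).1 (H p)) cY.
exists f; split=> //.
have /choice[h Hh] := hom_poset_torsion nL si.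
(* Both values at p define the same class of finite length modules, so they bound each other in
   2-silt L, and antisymmetry identifies them. *)
have fh g : f (h g) = g.
  apply: hom_poset_eq => p.
  have [P [fP sP TP]] := Hf (h g) p; have [Q [gQ sQ TQ]] := Hh g p.
  apply: (silt2_le_anti nL).
    by apply/(silt2_le_class nL si p fP sP gQ sQ) => Y /TP/TQ.
  by apply/(silt2_le_class nL si p gQ sQ fP sP) => Y /TQ/TP.
by exists h => // T; apply: tors_eq; apply/fle; rewrite fh => p; exact: silt2_refl.
Qed.
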